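(* Let $m>2$ be an integer, $\lambda=\frac{m-2}{2}>0$, let $n=2\tilde n+1$ with $\tilde n\in\mathbb{N}$, $\tilde n\ge 1$ (so $n$ is odd and $n\ne 1$), and let $1+c=\frac1n$. Let $x,y\in\mathbb{R}^m\setminus\{0\}$, $z=|x||y|$, $w=\frac{\langle x,y\rangle}{z}$. Let $K_m^c(t)=K_{m,scal}^c(t)+(\underline{x}\wedge\underline{y})\,K_{m,biv}^c(t)$ be the kernel of the radially deformed Fourier transform with auxiliary variable $t$ (defined in the context). Then, for $\mathrm{Re}\,s$ sufficiently large and with $r=\sqrt{s^2+z^2}$, the Laplace transform with respect to $t$ is $$\mathcal{L}(K_m^c)=\mathcal{L}(K_{m,scal}^c)+(\underline{x}\wedge\underline{y})\,\mathcal{L}(K_{m,biv}^c)$$ with $$\mathcal{L}(K_{m,scal}^c)=\frac{1}{r}\,\frac{(s+r)^{\tilde{n}+1}+(-1)^{\tilde{n}}(r-s)^{\tilde{n}+1}}{\left((s+r)^n-2w(-iz)^n+(-1)^{n}(r-s)^n\right)^{\lambda+1}}+\frac{iwz}{r}\,\frac{(-1)^{\tilde{n}}(r-s)^{\tilde{n}}-(s+r)^{\tilde{n}}}{\left((s+r)^n-2w(-iz)^n+(-1)^{n}(r-s)^n\right)^{\lambda+1}}$$ and $$\mathcal{L}(K_{m,biv}^c)=\frac{i}{r}\,\frac{(-1)^{\tilde{n}}(r-s)^{\tilde{n}}-(s+r)^{\tilde{n}}}{\left((s+r)^n-2w(-iz)^n+(-1)^n(r-s)^n\right)^{\lambda+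1}}.$$
   Context: The Clifford algebra $\mathcal{C}\ell_{0,m}$ (complexified) is generated by $e_1,\dots,e_m$ with $e_ie_j+e_je_i=-2\delta_{ij}$. For $x,y\in\mathbb{R}^m$, $\underline{x}\wedge\underline{y}:=\sum_{j<k}e_je_k(x_jy_k-x_ky_j)$. $J_\nu$ is the Bessel function of the first kind and $C_k^{\lambda}$ the Gegenbauer polynomial, with $\sum_{k\ge0}C_k^\lambda(w)u^k=(1-2wu+u^2)^{-\lambda}$. The Laplace transform is $\mathcal{L}(f)(s)=\int_0^\infty e^{-st}f(t)\,dt$, applied coefficientwise to Clifford-algebra-valued functions. $\sqrt{s^2+z^2}$ is the branch analytic on $\mathrm{Re}\,s>0$ and positive for $s>0$. For non-integer $p$, the power $\left((s+r)^n-2w(-iz)^n+(-1)^n(r-s)^n\right)^{p}$ means $(s+r)^{np}(1-2wu_R+u_R^2)^{p}$ with $u_R=\left(\frac{-iz}{s+r}\right)^n$ and principal powers (the two bases agree up to the factor $(s+r)^n$ because $(r-s)(r+s)=z^2$). The radially deformed Fourier transform is $\mathcal{F}_D=e^{i\frac{\pi}{2}\left(\frac12+\frac{m-1}{2(1+c)}\right)}e^{\frac{-i\pi}{4(1+c)^2}\left(\mathbf{D}^2-(1+c)^2\underline{x}^2\right)}$, with $\mathbf{D}=\partial_{\underline{x}}+c|x|^{-2}\underline{x}\,\mathbb{E}$, where $\partial_{\underline x}=\sum_j e_j\partial_{x_j}$, $\underline x=\sum_j e_jx_j$, $\mathbb{E}=\sum_j x_j\partial_{x_j}$. It is an integral transform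 whose kernel $K_m^c(x,y)$ has a known explicit series expansion. For $1+c=\frac1n$, $n=2\tilde n+1$, inserting an auxiliary variable $t>0$ in the Bessel functions of that series gives the following, which is taken as the definition of the kernel (the original kernel is recovered at $t=1$): $K_m^c(t)=K_{m,scal}^c(t)+(\underline{x}\wedge\underline{y})K_{m,biv}^c(t)$ with $$K_{m,scal}^c(t)=\frac{1}{2\lambda}z^{-\frac{\mu-2}{2}}A_\lambda+\frac12z^{-\frac{\mu-2}{2}}B_\lambda,\qquad K_{m,biv}^c(t)=-z^{-\frac{\mu}{2}}C_\lambda,\qquad \mu=1+\frac{m-1}{1+c}=1+n(m-1),$$ $$A_{\lambda}=\sum_{k=0}^{\infty}(k+\lambda)(-i)^{kn}J_{nk+n\lambda+\tilde n}(zt)C_k^\lambda(w)+i^{n-1}\sum_{k=0}^{\infty}(k+\lambda)(-i)^{kn}J_{nk+n\lambda-\tilde n}(zt)C_k^\lambda(w),$$ $$B_{\lambda}=\sum_{k=0}^{\infty}(-i)^{kn}J_{nk+n\lambda+\tilde n}(zt)C_k^\lambda(w)-i^{n-1}\sum_{k=0}^{\infty}(-i)^{kn}J_{nk+n\lambda-\tilde n}(zt)C_k^\lambda(w),$$ $$C_{\lambda}=(-i)^n\sum_{k=0}^{\infty}(-i)^{kn}J_{nk+n\lambda+3\tilde n+1}(zt)C_k^{\lambda+1}(w)+i\sum_{k=0}^{\infty}(-i)^{kn}J_{nk+n\lambda+\tilde n+1}(zt)C_k^{\lambda+1}(w).$$ *)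

(* Defs.v *)
From HB Require Import structures.
From mathcomp Require Import all_boot all_order all_algebra ring lra zify.

Set Implicit Arguments.
Unset Strict Implicit.
Unset Printing Implicit Defensive.

Import Order.TTheory GRing.Theory Num.Theory.
Local Open Scope ring_scope.

(* The Clifford algebra with e_i e_j + e_j e_i = -2 delta_ij over F, given by
   coordinates on the basis e_A = e_(a_1) ... e_(a_k), A = {a_1 < ... < a_k}:
   e_A e_B = cl_sign A B *: e_(symdiff A B).  cl_genM and cl_basis_prod below
   establish these facts; F = R[i] gives the complexified Cl_(0,m). *)
Definition clifford (F : comNzRingType) (m : nat) : Type :=
  {ffun {set 'I_m} -> F^o}.

HB.instance Definition _ (F : comNzRingType) (m : nat) :=
  GRing.Lmodule.copy (clifford F m) {ffun {set 'I_m} -> F^o}.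

Definition symdiff (m : nat) (A B : {set 'I_m}) : {set 'I_m} :=
  [set i | (i \in A) (+) (i \in B)].

(* One factor -1 for each pair (i, j) in A x B with j < i (moving e_j to the left
   of e_i) and one for each common index (e_i ^ 2 = -1). *)
Definition cl_sign (F : comNzRingType) (m : nat) (A B : {set 'I_m}) : F :=
  \prod_(i in A) \prod_(j in B | (j <= i)%N) (-1).

Section Clifford.
Variables (F : comNzRingType) (m : nat).
Implicit Types (A B D : {set 'I_m}) (f g h : clifford F m).
Local Notation sgn := (@cl_sign F m).

Definition cl_basis A : clifford F m := [ffun S => (S == A)%:R].

Definition cl_gen (i : 'I_m) : clifford F m := cl_basis [set i].

Definition cl_mul f g : clifford F m :=
  [ffun S => \sum_A sgn A (symdiff A S) * f A * g (symdiff A S)].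

Let symdK A : involutive (symdiff A).
Proof. by move=> B; apply/setP=> i; rewrite !inE addbA addbb. Qed.

Let symdA A B D : symdiff A (symdiff B D) = symdiff (symdiff A B) D.
Proof. by apply/setP=> i; rewrite !inE addbA. Qed.

Let symdC A B : symdiff A B = symdiff B A.
Proof. by apply/setP=> i; rewrite !inE addbC. Qed.

Let symd0 A : symdiff A set0 = A.
Proof. by apply/setP=> i; rewrite !inE addbF. Qed.

Let sd0 A : symdiff set0 A = A.
Proof. by rewrite symdC symd0. Qed.

Let sym_prod (v : 'I_m -> F) A B : (forall i, v i * v i = 1) ->
  \prod_(i in symdiff A B) v i = (\prod_(i in A) v i) * \prod_(i in B) v i.
Proof.
move=> vv; rewrite [LHS]big_mkcond [X in X * _]big_mkcond.
rewrite [X in _ * X]big_mkcond -big_split /=; apply: eq_bigr => i _.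
by rewrite inE; case: (i \in A); case: (i \in B); rewrite /= ?vv ?mulr1 ?mul1r.
Qed.

Let signsq (I : finType) (P : pred I) (a := \prod_(j | P j) (-1 : F)) : a * a = 1.
Proof. by rewrite /a prodr_const -exprMn mulrNN mulr1 expr1n. Qed.

Let sgnDl A B D : sgn (symdiff A B) D = sgn A D * sgn B D.
Proof. by apply: sym_prod => i; apply: signsq. Qed.

Let sgnDr A B D : sgn D (symdiff A B) = sgn D A * sgn D B.
Proof.
rewrite /cl_sign -big_split; apply: eq_bigr => i _ /=.
have E (S : {set 'I_m}) : \prod_(j in S | (j <= i)%N) (-1 : F) =
    \prod_(j in S) (if (j <= i)%N then -1 else 1) by rewrite big_mkcondr.
rewrite !E; apply: sym_prod => j.
by case: ifP => _; rewrite ?mulrNN mulr1.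
Qed.

Let sgn0l A : sgn set0 A = 1. Proof. by rewrite /cl_sign big_set0. Qed.
Let sgn0r A : sgn A set0 = 1.
Proof. by rewrite /cl_sign big1 // => i _; rewrite big1 // => j; rewrite inE. Qed.

Let symdD A : symdiff A A = set0.
Proof. by apply/setP => i; rewrite !inE addbb. Qed.

Let sgnsq A B : sgn A B * sgn A B = 1.
Proof.
by rewrite -sgnDr symdD sgn0r.
Qed.

Let mulA : associative cl_mul.
Proof.
move=> f g h; apply/ffunP => S; rewrite !ffunE.
under eq_bigr => B _ do rewrite ffunE mulr_sumr.
under [RHS]eq_bigr => A _ do rewrite ffunE mulr_sumr mulr_suml.
rewrite [RHS]exchange_big /=; apply: eq_bigr => B _.
rewrite (reindex_inj (inv_inj (symdK B))) /=; apply: eq_bigr => A _.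
rewrite -(symdA B A (symdiff B S)) (symdA A B S) (symdC A B) -(symdA B A S) symdK.
rewrite !sgnDl !sgnDr.
move: (sgnsq B S) => BS.
transitivity ((sgn B S * sgn B S) * (sgn B A * sgn A A * sgn A S * sgn B B * f B
  * g (symdiff B A) * h (symdiff A S))); last by rewrite BS mul1r; ring. 
ring.
Qed.

Let symd00 A B : (symdiff A B == set0) = (A == B).
Proof.
apply/eqP/eqP => [/setP E|->]; apply/setP => i.
  by have := E i; rewrite !inE; do 2!case: (_ \in _).
by rewrite !inE addbb.
Qed.

Let basisM A B : cl_mul (cl_basis A) (cl_basis B) = sgn A B *: cl_basis (symdiff A B).
Proof.
apply/ffunP => S; rewrite !ffunE (bigD1 A) //= big1 => [|D /negPf nD]; last first.
  by rewrite ffunE nD mulr0 mul0r.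
rewrite !ffunE eqxx mulr1 addr0.
have -> : (symdiff A S == B) = (S == symdiff A B).
  by apply/eqP/eqP => [<-|->]; rewrite symdK.
by case: eqP => [->|_]; rewrite ?symdK ?mulr1 ?mulr0 // /GRing.scale /= ?mulr1 ?mulr0.
Qed.

Let mul1 : left_id (cl_basis set0) cl_mul.
Proof.
move=> f; apply/ffunP => S; rewrite !ffunE (bigD1 set0) //= big1 => [|D /negPf nD].
  by rewrite ffunE eqxx sgn0l sd0 !mul1r addr0.
by rewrite ffunE nD mulr0 mul0r.
Qed.

Let mulr1' : right_id (cl_basis set0) cl_mul.
Proof.
move=> f; apply/ffunP => S; rewrite !ffunE (bigD1 S) //= big1 => [|D /negPf nD].
  by rewrite ffunE symd00 eqxx symdD sgn0r mul1r addr0 mulr1.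
by rewrite ffunE symd00 nD mulr0.
Qed.

Let mulDl : left_distributive cl_mul +%R.
Proof.
move=> f g h; apply/ffunP => S; rewrite !ffunE -big_split /=.
by apply: eq_bigr => A _; rewrite ffunE mulrDr mulrDl.
Qed.

Let mulDr : right_distributive cl_mul +%R.
Proof.
move=> f g h; apply/ffunP => S; rewrite !ffunE -big_split /=.
by apply: eq_bigr => A _; rewrite ffunE mulrDr.
Qed.

Let one_neq0 : cl_basis set0 != 0.
Proof.
by apply/eqP => /ffunP /(_ set0) /eqP; rewrite !ffunE eqxx oner_eq0.
Qed.

HB.instance Definition _ := GRing.Zmodule_isNzRing.Build (clifford F m)
  mulA mul1 mulr1' mulDl mulDr one_neq0.

Let scaleAl (a : F) f g : a *: (f * g) = (a *: f) * g.
Proof.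
apply/ffunP => S; rewrite !ffunE /GRing.scale /= mulr_sumr; apply: eq_bigr => A _.
by rewrite !ffunE /GRing.scale /=; ring.
Qed.

Let scaleAr (a : F) f g : a *: (f * g) = f * (a *: g).
Proof.
apply/ffunP => S; rewrite !ffunE /GRing.scale /= mulr_sumr; apply: eq_bigr => A _.
by rewrite !ffunE /GRing.scale /=; ring.
Qed.

HB.instance Definition _ := GRing.Lmodule_isLalgebra.Build F (clifford F m) scaleAl.
HB.instance Definition _ := GRing.Lalgebra_isAlgebra.Build F (clifford F m) scaleAr.

Lemma cl_genM i j : cl_gen i * cl_gen j + cl_gen j * cl_gen i = (- 2 * (i == j)%:R)%:A.
Proof.
have sg (a b : 'I_m) : sgn [set a] [set b] = if (b <= a)%N then -1 else 1.
  by rewrite /cl_sign big_set1 big_mkcondr big_set1.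
rewrite [cl_gen i * _]basisM [cl_gen j * _]basisM !sg symdC -scalerDl.
have [->|nij] := eqVneq i j.
  rewrite leqnn mulr1 symdD.
  by congr (_ *: _); ring.
rewrite mulr0 scale0r (_ : _ + _ = 0) ?scale0r //.
case: ltngtP nij => [||/val_inj ->] //; rewrite ?eqxx //; by rewrite ?addrN ?addNr.
Qed.

Lemma cl_basis_prod A : cl_basis A = \prod_(i <- enum A) cl_gen i.
Proof.
have so : sorted (fun i j : 'I_m => (i < j)%N) (enum A).
  rewrite /enum_mem -enumT /=; apply: sorted_filter => [a b d|]; first exact: ltn_trans.
  by rewrite -(@sorted_map _ _ val ltn) val_enum_ord iota_ltn_sorted.
rewrite -[in LHS](set_enum A); elim: (enum A) so => [|a s IH] /= pas.
  by rewrite big_nil; congr cl_basis; apply/setP => i; rewrite !inE.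
rewrite big_cons -IH ?(path_sorted pas) // [RHS]basisM.
have lta : {in s, forall b : 'I_m, (a < b)%N}.
  by apply/allP; apply: (order_path_min _ pas) => b d e; apply: ltn_trans.
rewrite (_ : sgn _ _ = 1) ?scale1r; last first.
  rewrite /cl_sign big_set1 big1 // => j; rewrite inE => /andP[/lta].
  by rewrite ltnNge => /negPf ->.
congr cl_basis; apply/setP => i; rewrite !inE.
by have [->|] := eqVneq i a => //=; case: (boolP (a \in s)) => // /lta; rewrite ltnn.
Qed.

End Clifford.

From mathcomp Require Import complex.
From mathcomp Require Import all_classical all_reals all_analysis.
Import numFieldNormedType.Exports.

Definition cl_wedge (R : rcfType) (m : nat) (x y : 'rV[R]_m) : clifford R[i] m :=
  \sum_(j < m) \sum_(k < m | (j < k)%N)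
    (x 0 j * y 0 k - x 0 k * y 0 j)%:C%C *: (cl_gen R[i] j * cl_gen R[i] k).

(* The norm `|x| of a row vector in the library is the maximum norm. *)
Definition edot (R : rcfType) (m : nat) (x y : 'rV[R]_m) : R :=
  \sum_(i < m) x 0 i * y 0 i.

Definition enorm (R : rcfType) (m : nat) (x : 'rV[R]_m) : R :=
  Num.sqrt (edot x x).

Section ComplexFunctions.
Variable R : realType.
Local Open Scope complex_scope.
Implicit Types (a s : R[i]) (u : nat -> R[i]) (p t : R).

Definition cabs a : R := Num.sqrt (Re a ^+ 2 + Im a ^+ 2).

(* Principal argument, in ]-pi, pi]; the value at 0 is irrelevant. *)
Definition carg a : R :=
  if 0 <= Im a then acos (Re a / cabs a) else - acos (Re a / cabs a).

Definition cexp a : R[i] := (expR (Re a))%:C * (cos (Im a) +i* sin (Im a)).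

(* Principal power with real exponent. *)
Definition cpow a p : R[i] := ((cabs a) `^ p)%:C * cexp ('i%C * (p * carg a)%:C).

Lemma cpow_nat a (k : nat) : cpow a k%:R = a ^+ k.
Proof.
have cexpD b d : cexp (b + d) = cexp b * cexp d.
  case: b d => b1 b2 [d1 d2]; rewrite /cexp /= expRD cosD sinD.
  by apply/eqP; rewrite eq_complex /=; apply/andP; split; apply/eqP; ring.
have polar : a = (cabs a)%:C * cexp ('i%C * (carg a)%:C).
  have [a0|a0] := eqVneq (cabs a) 0.
    rewrite a0 mul0r; case: a a0 => p q /eqP; rewrite /cabs /= sqrtr_eq0 => pq.
    apply/eqP; rewrite eq_complex /=; apply/andP.
    have := sqr_ge0 p; have := sqr_ge0 q.
    by split; rewrite -sqrf_eq0; apply/eqP; lra.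
  have a1 : 0 < cabs a by rewrite lt_neqAle eq_sym a0 sqrtr_ge0.
  have a2 : cabs a ^+ 2 = Re a ^+ 2 + Im a ^+ 2.
    by rewrite sqr_sqrtr // addr_ge0 ?sqr_ge0.
  have bd : -1 <= Re a / cabs a <= 1.
    rewrite ler_pdivlMr // ler_pdivrMr // mul1r mulN1r -ler_norml -sqrtr_sqr.
    by rewrite ler_wsqrtr // lerDl sqr_ge0.
  have sn : sin (acos (Re a / cabs a)) = `|Im a| / cabs a.
    rewrite sin_acos //; have -> : 1 - (Re a / cabs a) ^+ 2 = (Im a / cabs a) ^+ 2.
      by rewrite -(divff (expf_neq0 2 a0)) !expr_div_n -mulrBl {1}a2 addrAC subrr add0r.
    by rewrite sqrtr_sqr normf_div (gtr0_norm a1).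
  rewrite /cexp /carg; case: (a) a0 bd sn => p q /= a0 bd sn.
  rewrite mul0r mul1r !mul0r subrr expR0 !add0r !mul1r.
  apply/eqP; rewrite eq_complex /= !mul0r !subr0 !addr0 -?mulrA ?mul1r; apply/andP.
  case: ifP => q0; rewrite ?sinN ?cosN acosK ?in_itv //= sn.
    by rewrite ger0_norm // !(mulrC (cabs _)) !divfK.
  by rewrite ltr0_norm ?ltNge ?q0 // mulNr opprK !(mulrC (cabs _)) !divfK.
rewrite [in RHS]polar exprMn /cpow powR_mulrn ?sqrtr_ge0 // rmorphXn; congr (_ * _).
elim: k => [|k IH]; last rewrite exprS -IH -cexpD.
  rewrite mul0r mulr0 /cexp /= expR0 cos0 sin0 mul1r.
  by apply/eqP; rewrite eq_complex /= !eqxx.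
by congr cexp; rewrite -[in LHS]natr1 mulrDl mul1r rmorphD mulrDr addrC.
Qed.

Definition csum u : R[i] :=
  limn (series (u : nat -> (R[i] : numFieldType))).

Definition laplace_integrand (f : R -> R[i]) s t : R[i] :=
  cexp (- s * t%:C) * f t.

Definition laplace_exists (f : R -> R[i]) s : Prop :=
  lebesgue_measure.-integrable `]0, +oo[
    (fun t => (Re (laplace_integrand f s t))%:E) /\
  lebesgue_measure.-integrable `]0, +oo[
    (fun t => (Im (laplace_integrand f s t))%:E).

Definition laplace (f : R -> R[i]) s : R[i] :=
  (\int[lebesgue_measure]_(t in `]0, +oo[) Re (laplace_integrand f s t))%R +i*
  (\int[lebesgue_measure]_(t in `]0, +oo[) Im (laplace_integrand f s t))%R.

Definition cl_laplace_exists (m : nat) (F : R -> clifford R[i] m) s : Prop :=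
  forall A, laplace_exists (fun t => F t A) s.

Definition cl_laplace (m : nat) (F : R -> clifford R[i] m) s : clifford R[i] m :=
  [ffun A => laplace (fun t => F t A) s].

End ComplexFunctions.

Section SpecialFunctions.
Variable R : realType.
Implicit Types (a nu t lam w : R).

(* Euler's integral; it is the Gamma function only for a > 0. *)
Definition Gamma a : R :=
  (\int[lebesgue_measure]_(t in `]0%R, +oo[) (t `^ (a - 1) * expR (- t)))%R.

(* Bessel function of the first kind, for an order nu > -1 and t > 0. *)
Definition besselJ nu t : R :=
  limn (series (fun j : nat => (-1) ^+ j / (j`!%:R * Gamma (j%:R + nu + 1))
                               * (t / 2) `^ (2 * j%:R + nu))).

Definition pochhammer lam (l : nat) : R := \prod_(i < l) (lam + i%:R).

Definition gegenbauer lam (k : nat) : {poly R} :=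
  \sum_(j < k./2.+1)
    ((-1) ^+ j * pochhammer lam (k - j) / (j`!%:R * (k - j.*2)`!%:R))
      *: (2%:R *: 'X) ^+ (k - j.*2).

(* C_k^lam(w) is the coefficient of X ^ k in (1 - v) ^ (- lam), expanded as the
   binomial series in v = 2 w X - X ^ 2. *)
Lemma gegenbauer_generating lam w (k : nat) :
  (\sum_(j < k.+1) (pochhammer lam j / j`!%:R) *: ((2 * w) *: 'X - 'X ^+ 2) ^+ j)`_k
  = (gegenbauer lam k).[w].
Proof.
have coef_pow (j : nat) : (j <= k)%N -> (((2 * w) *: 'X - 'X ^+ 2) ^+ j)`_k =
    'C(j, k - j)%:R * (2 * w) ^+ (j - (k - j)) * (-1) ^+ (k - j).
  move=> jk; have -> : (2 * w) *: 'X - 'X ^+ 2 = ((2 * w)%:P - 'X) * 'X :> {poly R}.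
    by rewrite -mul_polyC; ring.
  rewrite exprMn coefMXn ltnNge jk /= exprBn coef_sum.
  have E (i : nat) : (((-1) ^+ i * (2 * w)%:P ^+ (j - i) * 'X ^+ i *+ 'C(j, i)) : {poly R})`_(k - j)
      = (if i == (k - j)%N then 'C(j, i)%:R * (2 * w) ^+ (j - i) * (-1) ^+ i else 0).
    have -> : (-1) ^+ i = ((-1) ^+ i)%:P :> {poly R} by rewrite polyC_exp polyCN.
    rewrite coefMn -polyC_exp -polyCM coefCM coefXn eq_sym.
    by case: eqP => _; rewrite ?mulr0 ?mul0rn // mulr1 -mulr_natl; ring.
  under eq_bigr => i _ do rewrite E.
  rewrite -big_mkcond /=; have [le|gt] := leqP (k - j) j.
    by rewrite (big_pred1 (Ordinal (le : (k - j < j.+1)%N))).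
  rewrite bin_small // !mul0r big_pred0 // => i; apply/eqP => ei.
  by have := ltn_ord i; rewrite ei ltnS leqNgt gt.
rewrite coef_sum; under eq_bigr => i _ do rewrite coefZ coef_pow ?leq_ord //.
rewrite (reindex_inj rev_ord_inj) /= /gegenbauer horner_sum.
rewrite [RHS](big_ord_widen k.+1 (fun j => (((-1) ^+ j * pochhammer lam (k - j)
  / (j`!%:R * (k - j.*2)`!%:R)) *: (2%:R *: 'X) ^+ (k - j.*2)).[w])); last by lia.
rewrite [RHS]big_mkcond /=; apply: eq_bigr => i _.
have ik : (i <= k)%N by rewrite leq_ord.
rewrite subSS subKn // hornerZ horner_exp hornerZ hornerX ltnS.
have [le|gt] := leqP i k./2; last by rewrite bin_small ?mul0r ?mulr0 //; lia.
have i2 : (i <= k - i)%N by lia.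
have e : (k - i - i = k - i.*2)%N by lia.
rewrite e; have := bin_fact i2; rewrite e => /(congr1 (fun n : nat => n%:R : R)).
rewrite !natrM => <-.
have f (a : nat) : a`!%:R != 0 :> R by rewrite pnatr_eq0 -lt0n fact_gt0.
have c0 : 'C(k - i, i)%:R != 0 :> R by rewrite pnatr_eq0 -lt0n bin_gt0.
by field; rewrite !f c0.
Qed.

End SpecialFunctions.

Section Kernel.
Variable R : realType.
Local Open Scope complex_scope.
Implicit Types (lam z w t c : R) (n nt k : nat).

Definition series_A lam z w n nt t : R[i] :=
  csum (fun k => (k%:R + lam)%:C * (- 'i%C) ^+ (k * n)
    * (besselJ (n%:R * k%:R + n%:R * lam + nt%:R) (z * t))%:C
    * ((gegenbauer lam k).[w])%:C)
  + 'i%C ^+ (n - 1) *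
  csum (fun k => (k%:R + lam)%:C * (- 'i%C) ^+ (k * n)
    * (besselJ (n%:R * k%:R + n%:R * lam - nt%:R) (z * t))%:C
    * ((gegenbauer lam k).[w])%:C).

Definition series_B lam z w n nt t : R[i] :=
  csum (fun k => (- 'i%C) ^+ (k * n)
    * (besselJ (n%:R * k%:R + n%:R * lam + nt%:R) (z * t))%:C
    * ((gegenbauer lam k).[w])%:C)
  - 'i%C ^+ (n - 1) *
  csum (fun k => (- 'i%C) ^+ (k * n)
    * (besselJ (n%:R * k%:R + n%:R * lam - nt%:R) (z * t))%:C
    * ((gegenbauer lam k).[w])%:C).

Definition series_C lam z w n nt t : R[i] :=
  (- 'i%C) ^+ n *
  csum (fun k => (- 'i%C) ^+ (k * n)
    * (besselJ (n%:R * k%:R + n%:R * lam + 3 * nt%:R + 1) (z * t))%:C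
    * ((gegenbauer (lam + 1) k).[w])%:C)
  + 'i%C *
  csum (fun k => (- 'i%C) ^+ (k * n)
    * (besselJ (n%:R * k%:R + n%:R * lam + nt%:R + 1) (z * t))%:C
    * ((gegenbauer (lam + 1) k).[w])%:C).

Variables (m n nt : nat) (c : R) (x y : 'rV[R]_m).
Let lam : R := (m%:R - 2) / 2.
Let mu : R := 1 + (m%:R - 1) / (1 + c).
Let z : R := enorm x * enorm y.
Let w : R := edot x y / z.

(* The kernel of the radially deformed Fourier transform in the case
   1 + c = 1 / n, n = 2 nt + 1, with a parameter t > 0 in the Bessel functions. *)
Definition rdft_scal t : R[i] :=
  (1 / (2 * lam) * z `^ (- ((mu - 2) / 2)))%:C * series_A lam z w n nt t
  + (1 / 2 * z `^ (- ((mu - 2) / 2)))%:C * series_B lam z w n nt t.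

Definition rdft_biv t : R[i] :=
  - (z `^ (- (mu / 2)))%:C * series_C lam z w n nt t.

Definition rdft_kernel t : clifford R[i] m :=
  (rdft_scal t)%:A + cl_wedge x y * (rdft_biv t)%:A.

End Kernel.

Section SqrtBranch.
Variables (K : numFieldType) (f : K^o -> K^o) (a s : K^o) (rho : K).
Hypothesis f_sqr : forall t, f t ^+ 2 = t ^+ 2 + a.
Hypothesis rho_gt0 : 0 < rho.
Hypothesis rho_le : forall t, rho <= `|f s + f t|.
Local Open Scope classical_set_scope.

Let f_cts : f t @[t --> s] --> f s.
Proof.
apply/(@cvgrPdist_lt K K^o K^o (nbhs s) _) => e e0.
have : (s - t) * (s + t) / rho @[t --> s] --> (s - s) * (s + s) / rho.
  pose FF : Filter (nbhs s) := nbhs_filter s.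
  apply: (@cvgM K K^o (nbhs s) FF); last exact: (@cvg_cst K^o _ _ (nbhs s) FF).
  apply: (@cvgM K K^o (nbhs s) FF).
    apply: (@cvgB K K^o K^o (nbhs s) FF); first exact: (@cvg_cst K^o _ _ (nbhs s) FF).
    exact: cvg_id.
  apply: (@cvgD K K^o K^o (nbhs s) FF); first exact: (@cvg_cst K^o _ _ (nbhs s) FF).
  exact: cvg_id.
rewrite subrr !mul0r => /(@cvgrPdist_lt K K^o K^o (nbhs s) _) /(_ _ e0); apply: filterS => t.
rewrite sub0r normrN; apply: le_lt_trans.
rewrite normf_div (gtr0_norm rho_gt0) ler_pdivlMr //.
have -> : (s - t) * (s + t) = (f s - f t) * (f s + f t).
  by rewrite -!subr_sqr !f_sqr; ring.
by rewrite normrM ler_wpM2l.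
Qed.

Let sum0 t : f t + f s != 0.
Proof. by rewrite addrC -normr_gt0 (lt_le_trans rho_gt0). Qed.

Lemma derivable_sqrt_branch : derivable (f : K^o -> K^o) s 1.
Proof.
apply/cvg_ex; exists ((0 + (s + s)) / (f (0 + s) + f s)).
have : (h + (s + s)) / (f (h + s) + f s) @[h --> (0 : K^o)^'] -->
  (0 + (s + s)) / (f (0 + s) + f s).
  pose FF : Filter (nbhs (0 : K^o)) := nbhs_filter _.
  have fD : h + s @[h --> (0 : K^o)] --> (0 + s : K^o).
    apply: (@cvgD K K^o K^o (nbhs 0) FF); first exact: cvg_id.
    exact: (@cvg_cst K^o _ _ (nbhs 0) FF).
  apply: cvg_within_filter; apply: (@cvgM K K^o (nbhs 0) FF).
    apply: (@cvgD K K^o K^o (nbhs 0) FF); first exact: cvg_id.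
    exact: (@cvg_cst K^o _ _ (nbhs 0) FF).
  apply: (@cvgV K K^o (nbhs 0) FF); first exact: sum0.
  apply: (@cvgD K K^o K^o (nbhs 0) FF); last exact: (@cvg_cst K^o _ _ (nbhs 0) FF).
  apply: (@cvg_comp _ _ _ (fun h : K^o => h + s) f _ _ _ fD).
  by rewrite add0r; exact: f_cts.
apply: cvg_trans; apply: near_eq_cvg.
near=> h.
have h0 : h != 0 by near: h; exact: nbhs_dnbhs_neq.
rewrite /GRing.scale /= mulr1; apply: (mulIf (sum0 (h + s))).
rewrite mulfVK // -mulrA -subr_sqr !f_sqr.
have -> : (h + s) ^+ 2 + a - (s ^+ 2 + a) = h * (h + (s + s)) by ring.
by rewrite mulKf.
Unshelve. all: by end_near.
Qed.

End SqrtBranch.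

Section LaplaceSide.
Variable R : realType.
Local Open Scope complex_scope.
Implicit Types (z w p : R) (s : R[i]).

(* sqrtc has values of nonnegative real part; cradius_gt0 and cradius_holomorphic below
   show that this is the branch that is analytic on 0 < Re s and positive on the
   positive reals. *)
Definition cradius z s : R[i] := sqrtc (s ^+ 2 + z%:C ^+ 2).

Definition den_base n z w s : R[i] :=
  (s + cradius z s) ^+ n - 2 * w%:C * (- 'i%C * z%:C) ^+ n
  + (-1) ^+ n * (cradius z s - s) ^+ n.

(* The power p of den_base: den_base = (s + r) ^ n (1 - 2 w u + u ^ 2), and principal
   powers are taken of s + r and of the second factor; for a natural number p this
   is the ordinary power of den_base, see den_pow_nat. *)
Definition den_pow n z w p s : R[i] :=
  let u := ((- 'i%C * z%:C) / (s + cradius z s)) ^+ n in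
  cpow (s + cradius z s) (n%:R * p) * cpow (1 - 2 * w%:C * u + u ^+ 2) p.

Lemma cradius_sqr z s : cradius z s ^+ 2 = s ^+ 2 + z%:C ^+ 2.
Proof. exact: sqr_sqrtc. Qed.

Lemma cradius_gt0 z (t : R) : 0 < t -> 0 < cradius z t%:C.
Proof.
move=> t0; have E : t%:C ^+ 2 + z%:C ^+ 2 = (t ^+ 2 + z ^+ 2)%:C.
  by rewrite rmorphD !rmorphXn.
have P : 0 < t ^+ 2 + z ^+ 2 by rewrite ltr_pwDl ?exprn_gt0 ?sqr_ge0.
by rewrite /cradius E sqrtc_sqrtr ?ler0c ?ltW // ltcR sqrtr_gt0.
Qed.

Lemma Re_cradius_gt0 z s : 0 < Re s -> 0 < Re (cradius z s).
Proof.
case: s => p q /= p0; rewrite /cradius !expr2 /=.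
set a := _ - _ + _; set b := _ + _ + _.
have Ea : a = p * p - q * q + z * z by rewrite /a; ring.
have Eb : b = 2 * p * q by rewrite /b; ring.
rewrite sqrtr_gt0 divr_gt0 // -ltrBlDr sub0r.
have [a0|a0] := ltP 0 a; first by rewrite (lt_le_trans _ (sqrtr_ge0 _)) // oppr_lt0.
have q0 : q != 0 by apply: contraTneq a0 => q0; rewrite -ltNge Ea q0; nra.
have b0 : 0 < b ^+ 2 by rewrite lt_neqAle sqr_ge0 eq_sym sqrf_eq0 Eb !mulf_neq0 // gt_eqF.
rewrite -[X in X < _]ger0_norm ?oppr_ge0 // normrN -sqrtr_sqr ltr_sqrt ?ltrDl //.
by rewrite ltr_wpDl // sqr_ge0.
Qed.

Lemma den_pow_nat n z w (k : nat) s : 0 < Re s ->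
  den_pow n z w k%:R s = den_base n z w s ^+ k.
Proof.
move=> s0; have r0 := Re_cradius_gt0 z s0.
have sr : s + cradius z s != 0.
  by apply/eqP => /(congr1 (@Re R)) /eqP; rewrite raddfD /= gt_eqF ?addr_gt0.
rewrite /den_pow /den_base -natrM !cpow_nat exprM -exprMn; congr (_ ^+ _).
have E : (cradius z s - s) = (- 1) * (- 'i%C * z%:C) ^+ 2 / (s + cradius z s).
  apply: (canRL (mulfK sr)); rewrite exprMn sqrrN sqr_i.
  have -> : (cradius z s - s) * (s + cradius z s) = cradius z s ^+ 2 - s ^+ 2 by ring.
  by rewrite cradius_sqr; ring.
have -> : (cradius z s - s) ^+ n = (-1) ^+ n * ((- 'i%C * z%:C) ^+ n) ^+ 2 / (s + cradius z s) ^+ n.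
  by rewrite E expr_div_n [in LHS]exprMn exprAC.
rewrite expr_div_n; set X := (- 'i%C * _) ^+ n; set v := (s + cradius z s) ^+ n.
have v0 : v != 0 by rewrite expf_neq0.
have ee : (-1) ^+ n * (-1) ^+ n = 1 :> R[i] by rewrite -expr2 sqrr_sign.
move: ((-1) ^+ n) ee => e ee; clearbody X v.
by rewrite 2!(mulrA e) ee mul1r; field.
Qed.

Lemma cradius_holomorphic z s : 0 < Re s ->
  derivable (cradius z : (R[i] : numFieldType)^o -> (R[i] : numFieldType)^o) s 1.
Proof.
move=> s0; have r0 := Re_cradius_gt0 z s0.
have Re0 t : 0 <= Re (cradius z t).
  by rewrite /cradius; case: (_ + _) => p q; rewrite sqrtr_ge0.
apply: (@derivable_sqrt_branch R[i] (cradius z) (z%:C ^+ 2) s (Re (cradius z s))%:C).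
- exact: cradius_sqr.
- by rewrite ltcR.
- move=> t; apply: le_trans (normc_ge_Re _); rewrite lecR raddfD /=.
  by rewrite ger0_norm ?addr_ge0 ?lerDl ?Re0.
Qed.

End LaplaceSide.

(* Main.v *)
(** The Bessel series is integrated term by term, each power t^a having transform
    Gamma(a+1) s^-(a+1).  With v = s + r and y = (z/v)^2 one has s = v(1-y)/2 and
    r = v(1+y)/2; expanding the powers of 1 - y by the binomial series, the
    coefficient of y^N in the resulting double sum is an N-th finite difference of a
    monic polynomial of degree N, so that the transform of J_nu(zt) is
    (z/v)^nu / r.  The series of the kernel thus become power series in
    u = (-iz/v)^n with Gegenbauer coefficients, which are summed by the generating
    function and its derivative.  Every interchange of limits is absolutely
    convergent because Re s may be taken large. *)

Require Import Defs.
From mathcomp Require Import all_boot all_order all_algebra.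
From mathcomp Require Import ring lra zify.
From mathcomp Require Import complex.
From mathcomp Require Import all_classical all_reals all_analysis.
From mathcomp Require Import measurable_realfun.

Set Implicit Arguments.
Unset Strict Implicit.
Unset Printing Implicit Defensive.

Import Order.TTheory GRing.Theory Num.Theory.
Import numFieldNormedType.Exports.
Local Open Scope ring_scope.
Local Open Scope complex_scope.
Local Open Scope classical_set_scope.
Local Notation Re := complex.Re.
Local Notation Im := complex.Im.

(** Two obstacles shape the development. Principal powers are multiplicative only as long as the
    arguments do not add up beyond ]-pi, pi], so every product is split into factors of the right
    half-plane; this dictates the variables v and y, since both v / 2 and 1 - y lie there. Secondly,
    the estimates must be uniform in the Bessel order, which grows with the summation index of the
    kernel. In place of asymptotics of Gamma, a power t^a is bounded by Gamma(a + 1) kappa^(-a)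
    exp(kappa t), with the Gamma factor left exact: in a Bessel term it cancels up to a coefficient
    of at most geometric growth. Every series then has terms of size at most C rho^k exp(kappa t),
    the one form of bound that the interchange of sum and transform asks for, and the demands on
    kappa merge into a single condition. Limits are first obtained without being named; uniqueness
    of sums identifies them with the closed forms afterwards. *)

(** * The complex modulus and sums of complex series *)

Section ComplexSeries.
Variable R : realType.
Implicit Types (a b l : R[i]) (u v : nat -> R[i]) (x C rho : R) (n : nat).

Lemma normcE_cabs a : `|a| = (cabs a)%:C.
Proof. exact: normc_def. Qed.

Lemma cabsM a b : cabs (a * b) = cabs a * cabs b.
Proof. by apply: (@complexI R); rewrite rmorphM /= -!normcE_cabs normrM. Qed.

Lemma cabsD a b : cabs (a + b) <= cabs a + cabs b.
Proof. by rewrite -lecR rmorphD /= -!normcE_cabs ler_normD. Qed.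

Lemma cabsN a : cabs (- a) = cabs a.
Proof. by apply: (@complexI R); rewrite -!normcE_cabs normrN. Qed.

Lemma cabsV a : cabs a^-1 = (cabs a)^-1.
Proof. by apply: (@complexI R); rewrite fmorphV /= -!normcE_cabs normfV. Qed.

Lemma cabsX a n : cabs (a ^+ n) = cabs a ^+ n.
Proof. by apply: (@complexI R); rewrite rmorphXn /= -!normcE_cabs normrX. Qed.

Lemma cabsR x : cabs x%:C = `|x|.
Proof. by rewrite /cabs /= expr0n addr0 sqrtr_sqr. Qed.

Lemma cabs0 : cabs (0 : R[i]) = 0. Proof. by rewrite cabsR normr0. Qed.

Lemma cabs1 : cabs (1 : R[i]) = 1. Proof. by rewrite cabsR normr1. Qed.

Lemma cabs_i : cabs ('i%C : R[i]) = 1.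
Proof. by rewrite /cabs /= expr0n add0r expr1n sqrtr1. Qed.

Lemma cabs_ge0 a : 0 <= cabs a.
Proof. exact: sqrtr_ge0. Qed.

Lemma cabs_eq0 a : (cabs a == 0) = (a == 0).
Proof. by rewrite -(inj_eq (@complexI R)) -normcE_cabs normr_eq0. Qed.

Lemma cabs_gt0 a : (0 < cabs a) = (a != 0).
Proof. by rewrite lt_neqAle cabs_ge0 andbT eq_sym cabs_eq0. Qed.

Lemma cabs_sum (I : Type) (r : seq I) (P : pred I) (F : I -> R[i]) :
  cabs (\sum_(i <- r | P i) F i) <= \sum_(i <- r | P i) cabs (F i).
Proof.
elim/big_ind2 : _ => [|p1 p2 q1 q2 h1 h2|i _] //; first by rewrite cabs0.
by rewrite (le_trans (cabsD _ _)) // lerD.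
Qed.

Lemma ler_Re_cabs a : `|Re a| <= cabs a.
Proof. by rewrite -sqrtr_sqr ler_wsqrtr // lerDl sqr_ge0. Qed.

Lemma ler_Im_cabs a : `|Im a| <= cabs a.
Proof. by rewrite -sqrtr_sqr ler_wsqrtr // lerDr sqr_ge0. Qed.

Lemma cabs_le_ReIm a : cabs a <= `|Re a| + `|Im a|.
Proof.
rewrite -(@ler_pXn2r _ 2) ?nnegrE ?addr_ge0 ?cabs_ge0 //.
rewrite sqr_sqrtr ?addr_ge0 ?sqr_ge0 // sqrrD !real_normK ?num_real //.
by rewrite -addrA lerD2l lerDr mulrn_wge0 // mulr_ge0.
Qed.

Lemma ReM a b : Re (a * b) = Re a * Re b - Im a * Im b.
Proof. by case: a b => [? ?] [? ?]. Qed.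

Lemma ImM a b : Im (a * b) = Re a * Im b + Im a * Re b.
Proof. by case: a b => [? ?] [? ?]. Qed.

Lemma ReD a b : Re (a + b) = Re a + Re b.
Proof. by case: a b => [? ?] [? ?]. Qed.

Lemma ImD a b : Im (a + b) = Im a + Im b.
Proof. by case: a b => [? ?] [? ?]. Qed.

Lemma ReN a : Re (- a) = - Re a. Proof. by case: a. Qed.

Lemma ImN a : Im (- a) = - Im a. Proof. by case: a. Qed.

Lemma complex_ext a b : Re a = Re b -> Im a = Im b -> a = b.
Proof. by case: a b => [? ?] [? ?] /= -> ->. Qed.

(** Convergence is taken by components, so that real limit theorems and dominated convergence apply
    directly; [csumE] links it to the limit in [R[i]]. *)
Definition has_csum u l :=
  (series (fun k => Re (u k)) @ \oo --> Re l) /\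
  (series (fun k => Im (u k)) @ \oo --> Im l).

Lemma Re_sum (I : Type) (r : seq I) (P : pred I) (F : I -> R[i]) :
  Re (\sum_(i <- r | P i) F i) = \sum_(i <- r | P i) Re (F i).
Proof. exact: (raddf_sum (@complex.Re R : {additive R[i] -> R})). Qed.

Lemma Im_sum (I : Type) (r : seq I) (P : pred I) (F : I -> R[i]) :
  Im (\sum_(i <- r | P i) F i) = \sum_(i <- r | P i) Im (F i).
Proof. exact: (raddf_sum (@complex.Im R : {additive R[i] -> R})). Qed.

(** The modulus form reduces complex convergence to one real null sequence, which can be
    squeezed. *)
Lemma has_csum_dist u l : has_csum u l <->
  (fun n => cabs (l - \sum_(0 <= k < n) u k)) @ \oo --> (0 : R).
Proof.
split=> [[h1 h2]|h].
  have h : (fun n => `|Re l - series (fun k => Re (u k)) n|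
      + `|Im l - series (fun k => Im (u k)) n|) @ \oo --> (0 : R).
    rewrite -(addr0 (0 : R)); apply: cvgD.
      by rewrite -[X in _ --> X](@normr0 R R); apply: cvg_norm;
        rewrite -[X in _ --> X](subrr (Re l)); apply: cvgB => //; apply: cvg_cst.
    by rewrite -[X in _ --> X](@normr0 R R); apply: cvg_norm;
      rewrite -[X in _ --> X](subrr (Im l)); apply: cvgB => //; apply: cvg_cst.
  apply: (squeeze_cvgr _ (cvg_cst 0) h); apply: nearW => n.
  rewrite cabs_ge0 /= (le_trans (cabs_le_ReIm _)) //.
  by rewrite !raddfB /= Re_sum Im_sum.
have key (f : nat -> R) (c : R) :
    (forall n, `|c - f n| <= cabs (l - \sum_(0 <= k < n) u k)) -> f @ \oo --> c.
  move=> le; apply/cvgrPdist_le => e e0; move/cvgrPdist_le: h => /(_ e e0).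
  apply: filterS => n; rewrite sub0r normrN ger0_norm ?cabs_ge0 //.
  exact: le_trans.
split; apply: key => n.
  by rewrite /series /= -Re_sum -raddfB ler_Re_cabs.
by rewrite /series /= -Im_sum -raddfB ler_Im_cabs.
Qed.

Lemma csumE u l : has_csum u l -> csum u = l.
Proof.
move=> /has_csum_dist h; apply: (@cvg_lim (R[i] : numFieldType)).
  exact: norm_hausdorff.
apply/cvgrPdist_lt => e e0.
(* The order of [R[i]] only compares numbers with equal imaginary parts, so a positive [e] is
   real. *)
have [x xe] : exists x, e = x%:C.
  by apply/complex_realP; rewrite realE ltW.
rewrite xe ltcR in e0 *.
move/cvgrPdist_lt: h => /(_ x e0); apply: filterS => n.
by rewrite sub0r normrN ger0_norm ?cabs_ge0 // normcE_cabs ltcR.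
Qed.

Lemma has_csum_unique u l l' : has_csum u l -> has_csum u l' -> l = l'.
Proof. by move=> /csumE <- /csumE. Qed.

Lemma eq_has_csum u v l : u =1 v -> has_csum u l -> has_csum v l.
Proof. by move=> /funext ->. Qed.

Lemma has_csumD u v a b :
  has_csum u a -> has_csum v b -> has_csum (fun k => u k + v k) (a + b).
Proof.
move=> [h1 h2] [h3 h4]; rewrite /has_csum !raddfD.
have E (f : {additive R[i] -> R}) : series (fun k => f (u k + v k)) =
    (fun n => series (fun k => f (u k)) n + series (fun k => f (v k)) n).
  by apply/funext => n; rewrite /series /= -big_split; apply: eq_bigr => ? _; rewrite raddfD.
by split; [rewrite (E (@complex.Re R)) | rewrite (E (@complex.Im R))]; apply: cvgD.
Qed.

Lemma has_csumZ c u l : has_csum u l -> has_csum (fun k => c * u k) (c * l).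
Proof.
move=> [h1 h2]; rewrite /has_csum ReM ImM; split.
  rewrite [X in X @ _ --> _](_ : _ = fun n => Re c * series (fun k => Re (u k)) n
     - Im c * series (fun k => Im (u k)) n); last first.
    apply/funext => n; rewrite /series /= !mulr_sumr -sumrB.
    by apply: eq_bigr => k _; rewrite ReM.
  by apply: cvgB; apply: cvgMr.
rewrite [X in X @ _ --> _](_ : _ = fun n => Re c * series (fun k => Im (u k)) n
     + Im c * series (fun k => Re (u k)) n); last first.
  apply/funext => n; rewrite /series /= !mulr_sumr -big_split.
  by apply: eq_bigr => k _; rewrite ImM.
by apply: cvgD; apply: cvgMr.
Qed.

Lemma has_csum_finite u n : (forall k, (n <= k)%N -> u k = 0) ->
  has_csum u (\sum_(0 <= k < n) u k).
Proof.
move=> u0; apply/has_csum_dist; apply: cvg_near_cst.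
exists n => // k /= nk; rewrite (big_cat_nat (leq0n n) nk) /=.
rewrite [X in _ - (_ + X)]big_nat_cond [X in _ - (_ + X)]big1 ?addr0 ?subrr ?cabs0 //.
by move=> i /andP[/andP[/u0]].
Qed.

(** Together with [has_csumZ] this multiplies a power series by its variable. *)
Lemma has_csum_shift u l : has_csum u l ->
  has_csum (fun k => if k is k'.+1 then u k' else 0) l.
Proof.
move=> [h1 h2]; split; rewrite -cvg_shiftS.
  rewrite [X in X @ _](_ : _ = series (fun k => Re (u k))) //.
  apply/funext => n; rewrite /series /= big_nat_recl //= add0r.
  by apply: eq_bigr.
rewrite [X in X @ _](_ : _ = series (fun k => Im (u k))) //.
apply/funext => n; rewrite /series /= big_nat_recl //= add0r.
by apply: eq_bigr.
Qed.

Lemma sum_geometric_le C rho n m : 0 <= C -> 0 <= rho < 1 ->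
  \sum_(n <= k < m) C * rho ^+ k <= C * rho ^+ n / (1 - rho).
Proof.
move=> C0 /andP[r0 r1]; have r10 : 0 < 1 - rho by rewrite subr_gt0.
have [nm|mn] := leqP n m; last first.
  by rewrite big_geq ?(ltnW mn) // divr_ge0 ?mulr_ge0 ?exprn_ge0 // ltW.
rewrite ler_pdivlMr // mulr_suml -(subnKC nm).
rewrite (telescope_sumr_eq (fun k => - (C * rho ^+ k))) => [||k _]; first last.
- by rewrite exprS; ring.
- by rewrite leq_addr.
by rewrite opprK addrC gerBl mulr_ge0 ?exprn_ge0.
Qed.

Lemma geometric_has_csum u C rho : 0 <= rho < 1 ->
  (forall k, cabs (u k) <= C * rho ^+ k) -> {l | has_csum u l}.
Proof.
move=> r01 le; have r1 : `|rho| < 1 by case/andP: r01 => ? ?; rewrite ger0_norm.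
have C0 : 0 <= C by have := le 0; rewrite mulr1; apply: le_trans; apply: cabs_ge0.
have key (f : nat -> R) : (forall k, `|f k| <= cabs (u k)) -> cvgn (series f).
  move=> fu; apply: normed_cvg.
  apply: (@series_le_cvg _ _ (geometric C rho)) => [n|n|n|].
  - exact: normr_ge0.
  - by rewrite geometric_ge0 //; case/andP: r01.
  - by rewrite /geometric /=; apply: le_trans (fu n) (le n).
  - exact: is_cvg_geometric_series.
exists (limn (series (fun k => Re (u k))) +i* limn (series (fun k => Im (u k)))).
by split; apply: key => k; rewrite ?ler_Re_cabs ?ler_Im_cabs.
Qed.

(** Up to an arbitrary error [e], the tail is a finite block of terms, which a geometric sum
    bounds. *)
Lemma geometric_csum_tail u C rho l n : 0 <= rho < 1 ->
  (forall k, cabs (u k) <= C * rho ^+ k) -> has_csum u l ->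
  cabs (l - \sum_(0 <= k < n) u k) <= C * rho ^+ n / (1 - rho).
Proof.
move=> r01 le ul.
have C0 : 0 <= C by have := le 0; rewrite mulr1; apply: le_trans; apply: cabs_ge0.
apply/ler_addgt0Pr => e e0.
move/has_csum_dist/cvgrPdist_lt: ul => /(_ e e0) [N _ /(_ (maxn n N) (leq_maxr n N))] /=.
rewrite sub0r normrN ger0_norm ?cabs_ge0 // => lt.
rewrite (_ : _ - _ = (l - \sum_(0 <= k < maxn n N) u k)
   + \sum_(n <= k < maxn n N) u k); last first.
  by rewrite (big_cat_nat (leq0n n) (leq_maxl n N)) /=; ring.
rewrite (le_trans (cabsD _ _)) // addrC lerD ?(ltW lt) //.
rewrite (le_trans (cabs_sum _ _ _)) //.
by apply: le_trans (sum_geometric_le _ _ C0 r01); apply: ler_sum.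
Qed.

Lemma geometric_csum_le u C rho l : 0 <= rho < 1 ->
  (forall k, cabs (u k) <= C * rho ^+ k) -> has_csum u l ->
  cabs l <= C / (1 - rho).
Proof.
move=> r01 le ul; have := geometric_csum_tail 0 r01 le ul.
by rewrite big_geq // subr0 mulr1.
Qed.

(* Rearrangement by diagonals; the factor 2 ^- i makes the sum over the
   diagonal of the row tails geometric. *)
Lemma has_csum_diagonal (f : nat -> nat -> R[i]) (T : nat -> R[i]) C rho (S : R[i]) :
  0 <= rho < 1 ->
  (forall i j, cabs (f i j) <= C * (rho / 2) ^+ i * rho ^+ j) ->
  (forall i, has_csum (f i) (T i)) -> has_csum T S ->
  has_csum (fun N => \sum_(0 <= i < N.+1) f i (N - i)%N) S.
Proof.
move=> r01 le hT hS; case/andP: (r01) => r0 r1.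
have C0 : 0 <= C.
  by have := le 0 0; rewrite !mulr1; apply: le_trans; apply: cabs_ge0.
have r10 : 0 < 1 - rho by rewrite subr_gt0.
(* The first n diagonals fill the triangle i + j < n, in which row i keeps its first n - i terms. *)
have E n : \sum_(0 <= N < n) \sum_(0 <= i < N.+1) f i (N - i)%N =
    \sum_(0 <= i < n) \sum_(0 <= j < n - i) f i j.
  elim: n => [|n IH]; first by rewrite !big_geq.
  rewrite big_nat_recr //= IH [in RHS]big_nat_recr //= subSnn big_nat1.
  rewrite [X in _ + X]big_nat_recr //= subnn addrA -big_split /=; congr (_ + _).
  rewrite big_nat [RHS]big_nat; apply: eq_bigr => i /andP[_ i_n].
  by rewrite subSn ?(ltnW i_n) // big_nat_recr.
apply/has_csum_dist.
have h0 : (fun n => cabs (S - \sum_(0 <= k < n) T k)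
     + 2 * C / (1 - rho) * rho ^+ n) @ \oo --> (0 : R).
  rewrite -(addr0 (0 : R)); apply: cvgD; first exact/has_csum_dist.
  by apply: (@cvg_geometric R (2 * C / (1 - rho)) rho); rewrite ger0_norm.
apply: (squeeze_cvgr _ (cvg_cst 0) h0); apply: nearW => n.
rewrite cabs_ge0 /= E.
rewrite (_ : _ - _ = (S - \sum_(0 <= k < n) T k) +
   \sum_(0 <= k < n) (T k - \sum_(0 <= j < n - k) f k j)); last first.
  by rewrite sumrB; ring.
rewrite (le_trans (cabsD _ _)) // lerD2l (le_trans (cabs_sum _ _ _)) //.
have half : 0 <= (2^-1 : R) < 1 by rewrite invr_ge0 ler0n invf_lt1 ?ltr1n.
apply: (@le_trans _ _ (\sum_(0 <= k < n) C * rho ^+ n / (1 - rho) * 2^-1 ^+ k)).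
  rewrite !big_nat; apply: ler_sum => k /andP[_ kn].
  apply: le_trans (geometric_csum_tail (n - k) r01 (le k) (hT k)) _.
  rewrite -{2}(subnKC (ltnW kn)) exprD exprMn.
  by rewrite le_eqVlt; apply/orP; left; apply/eqP; ring.
have cc : 0 <= C * rho ^+ n / (1 - rho).
  by rewrite divr_ge0 ?mulr_ge0 ?exprn_ge0 // ltW.
apply: le_trans (sum_geometric_le 0 n cc half) _.
by rewrite le_eqVlt; apply/orP; left; apply/eqP; field; rewrite gt_eqF.
Qed.

End ComplexSeries.

(** * Principal argument, logarithm and powers *)

Section ComplexPower.
Variable R : realType.
Implicit Types (a b : R[i]) (p q x : R) (n : nat).

Lemma cexpD a b : cexp (a + b) = cexp a * cexp b.
Proof.
case: a b => a1 a2 [b1 b2]; rewrite /cexp /= expRD cosD sinD.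
by apply: complex_ext => /=; ring.
Qed.

Lemma cexp0 : cexp (0 : R[i]) = 1.
Proof. by rewrite /cexp /= expR0 cos0 sin0 mul1r. Qed.

Lemma cexpR x : cexp x%:C = (expR x)%:C :> R[i].
Proof. by rewrite /cexp /= cos0 sin0 mulr1. Qed.

Lemma cabs_cexp a : cabs (cexp a) = expR (Re a).
Proof.
rewrite /cexp cabsM cabsR ger0_norm ?expR_ge0 // /cabs /= cos2Dsin2 sqrtr1.
by rewrite mulr1.
Qed.

Definition clog a : R[i] := ln (cabs a) +i* carg a.

Lemma cpowE a p : a != 0 -> cpow a p = cexp (p%:C * clog a).
Proof.
move=> a0; rewrite /cpow /powR cabs_eq0 (negPf a0) -cexpR -cexpD; congr cexp.
by apply: complex_ext => /=; ring.
Qed.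

Lemma cpowD a p q : a != 0 -> cpow a (p + q) = cpow a p * cpow a q.
Proof. by move=> a0; rewrite !cpowE // rmorphD mulrDl cexpD. Qed.

Lemma cpowr0 a : cpow a 0 = 1.
Proof. by rewrite (cpow_nat a 0). Qed.

Lemma cpowr1 a : cpow a 1 = a.
Proof. by rewrite (cpow_nat a 1). Qed.

Lemma cabs_cpow a p : cabs (cpow a p) = cabs a `^ p.
Proof.
rewrite /cpow cabsM cabs_cexp cabsR ger0_norm ?powR_ge0 //=.
by rewrite !(mul0r, mulr0) subr0 expR0 mulr1.
Qed.

Lemma cpow_neq0 a p : a != 0 -> cpow a p != 0.
Proof. by move=> a0; rewrite -cabs_gt0 cabs_cpow powR_gt0 // cabs_gt0. Qed.

Lemma cpowN a p : a != 0 -> cpow a (- p) = (cpow a p)^-1.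
Proof.
move=> a0; apply: (mulfI (cpow_neq0 p a0)).
by rewrite -cpowD // subrr cpowr0 divff // cpow_neq0.
Qed.

Lemma Re_gt0_neq0 a : 0 < Re a -> a != 0.
Proof. by move=> h; apply: contraTneq h => ->; rewrite ltxx. Qed.

Lemma cexp_ix x : cexp ('i%C * x%:C) = cos x +i* sin x :> R[i].
Proof.
rewrite /cexp (_ : 'i%C * x%:C = 0 +i* x) ?expR0 ?mul1r //.
by apply: complex_ext => /=; ring.
Qed.

(** A polar angle is unique in ]-pi, pi]; the arccosine in [carg] is evaluated only through this
    fact. *)
Lemma carg_eq x a : 0 < cabs a -> - pi < x <= pi ->
  a = (cabs a)%:C * cexp ('i%C * x%:C) -> carg a = x.
Proof.
move=> a0 /andP[x1 x2] E; rewrite /carg.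
have [Ec Es] : Re a / cabs a = cos x /\ Im a = cabs a * sin x.
  rewrite cexp_ix in E; split.
    by rewrite {1}E ReM /= mul0r subr0 mulrC mulKf ?gt_eqF.
  by rewrite {1}E ImM /= mul0r addr0.
rewrite Ec Es pmulr_rge0 //.
have [x0|x0] := leP 0 x.
  by rewrite sin_ge0_pi ?x0 // cosK // in_itv /= x0.
(* For negative x the sine is negative, so [carg] takes its second branch, where the arccosine of
   cos x is - x. *)
have sx : 0 < sin (- x) by apply: sin_gt0_pi; rewrite oppr_gt0 x0 /= ltrNl.
rewrite sinN oppr_gt0 in sx; rewrite leNgt sx /=.
by rewrite cosKN ?opprK // (ltW x0) ltW.
Qed.

Lemma cpolar a : a != 0 -> a = (cabs a)%:C * cexp ('i%C * (carg a)%:C).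
Proof.
move=> a0; rewrite -{1}(cpowr1 a) /cpow mul1r powRr1 ?cabs_ge0 //.
Qed.

(** On the right half-plane this form makes the argument differentiable and shows that it stays
    strictly within pi / 2 of 0. *)
Lemma carg_atan a : 0 < Re a -> carg a = atan (Im a / Re a).
Proof.
move=> a1; have a0 := Re_gt0_neq0 a1.
have c0 : 0 < cabs a by rewrite cabs_gt0.
set y := Im a / Re a; apply: carg_eq => //.
  rewrite (lt_trans _ (atan_gtNpi2 y)) /=; last first.
    by rewrite ltrN2 gtr_pMr ?pi_gt0 // invf_lt1 ?ltr1n.
  by rewrite ltW // (lt_trans (atan_ltpi2 y)) // gtr_pMr ?pi_gt0 // invf_lt1 ?ltr1n.
have ca : cos (atan y) != 0.
  by rewrite cos_atan invr_neq0 // gt_eqF // sqrtr_gt0 ltr_pwDl // sqr_ge0.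
have E1 : cabs a * cos (atan y) = Re a.
  rewrite cos_atan (_ : 1 + y ^+ 2 = (cabs a / Re a) ^+ 2); last first.
    rewrite [RHS]expr_div_n /cabs sqr_sqrtr ?addr_ge0 ?sqr_ge0 // /y.
    by field; rewrite gt_eqF.
  by rewrite sqrtr_sqr ger0_norm ?divr_ge0 ?cabs_ge0 ?ltW // invf_div mulrC divfK ?gt_eqF.
have E2 : cabs a * sin (atan y) = Im a.
  have := atanK y; rewrite /tan => /(canRL (divfK ca)) ->.
  by rewrite mulrCA E1 divfK // gt_eqF.
by apply: complex_ext; rewrite cexp_ix ?ReM ?ImM /= mul0r ?subr0 ?addr0 ?E1 ?E2.
Qed.

(** Both arguments are smaller than pi / 2 in absolute value, so their sum is again principal and no
    multiple of 2 pi has to be corrected. *)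
Lemma cpowM a b p : 0 < Re a -> 0 < Re b -> cpow (a * b) p = cpow a p * cpow b p.
Proof.
move=> a1 b1; have a0 := Re_gt0_neq0 a1; have b0 := Re_gt0_neq0 b1.
have c0 : 0 < cabs (a * b) by rewrite cabs_gt0 mulf_neq0.
rewrite !cpowE ?mulf_neq0 // -cexpD -mulrDr; congr (cexp (_ * _)).
apply: complex_ext => /=; first by rewrite cabsM lnM ?posrE ?cabs_gt0.
apply: carg_eq => //; last first.
  by rewrite rmorphD mulrDr cexpD cabsM rmorphM mulrACA -!cpolar.
rewrite !carg_atan // [pi]splitr opprD ltrD ?atan_gtNpi2 //=.
by rewrite ltW // ltrD ?atan_ltpi2.
Qed.

Lemma cpowR x p : 0 < x -> cpow x%:C p = (x `^ p)%:C :> R[i].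
Proof.
move=> x0; rewrite /cpow cabsR gtr0_norm // carg_atan //= mul0r atan0 mulr0.
by rewrite mulr0 cexp0 mulr1.
Qed.

End ComplexPower.

(** * The exponential and binomial series, by differentiation along a segment *)

Section BinomialSeries.
Variable R : realType.
Implicit Types (a b d v : R[i]) (p q t C rho : R) (n j N : nat).

(** Derivative with respect to a real parameter, by components: a series in v is studied along t v
    for t in [0, 1]. *)
Definition has_cderive (f : R -> R[i]) t d :=
  is_derive (t : R^o) 1 (fun t => Re (f t) : R^o) (Re d) /\
  is_derive (t : R^o) 1 (fun t => Im (f t) : R^o) (Im d).

Lemma has_cderiveM f g t a b : has_cderive f t a -> has_cderive g t b ->
  has_cderive (fun t => f t * g t) t (a * g t + f t * b).
Proof.
move=> [f1 f2] [g1 g2]; split.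
  rewrite (_ : (fun t => _) = (fun t => Re (f t)) * (fun t => Re (g t))
    - (fun t => Im (f t)) * (fun t => Im (g t))); last first.
    by apply/funext => y; rewrite ReM.
  apply: is_derive_eq; rewrite ReD !ReM /GRing.scale /=; ring.
rewrite (_ : (fun t => _) = (fun t => Re (f t)) * (fun t => Im (g t))
  + (fun t => Im (f t)) * (fun t => Re (g t))); last first.
  by apply/funext => y; rewrite ImM.
apply: is_derive_eq; rewrite ImD !ImM /GRing.scale /=; ring.
Qed.

Lemma has_cderiveZ p f t a : has_cderive f t a ->
  has_cderive (fun t => p%:C * f t) t (p%:C * a).
Proof.
move=> [h1 h2]; split.
  rewrite (_ : (fun t => _) = p *: (fun t => Re (f t) : R^o)); last first.
    by apply/funext => y; rewrite ReM /= mul0r subr0.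
  by apply: is_derive_eq; rewrite ReM /= mul0r subr0.
rewrite (_ : (fun t => _) = p *: (fun t => Im (f t) : R^o)); last first.
  by apply/funext => y; rewrite ImM /= mul0r addr0.
by apply: is_derive_eq; rewrite ImM /= mul0r addr0.
Qed.

Lemma is_derive_chain (f g : R -> R) t (x y : R) :
  is_derive (g t : R^o) 1 (f : R^o -> R^o) x -> is_derive (t : R^o) 1 (g : R^o -> R^o) y ->
  is_derive (t : R^o) 1 (fun t => f (g t) : R^o) (y * x).
Proof. by move=> h1 h2; rewrite mulrC; exact: (is_derive1_comp h1 h2). Qed.

Lemma has_cderive_cexp f t a : has_cderive f t a ->
  has_cderive (fun t => cexp (f t)) t (a * cexp (f t)).
Proof.
move=> [f1 f2].
have e1 := is_derive_chain (is_derive_expR (Re (f t))) f1.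
have e2 := is_derive_chain (is_derive_cos (Im (f t))) f2.
have e3 := is_derive_chain (is_derive_sin (Im (f t))) f2.
split.
  rewrite (_ : (fun t => _) = (fun t => expR (Re (f t))) * (fun t => cos (Im (f t)))); last first.
    by apply/funext => y; rewrite /cexp ReM /= mul0r subr0.
  by apply: is_derive_eq; rewrite /cexp /GRing.scale /= !ReM !ImM /=; ring.
rewrite (_ : (fun t => _) = (fun t => expR (Re (f t))) * (fun t => sin (Im (f t)))); last first.
  by apply/funext => y; rewrite /cexp ImM /= mul0r addr0.
by apply: is_derive_eq; rewrite /cexp /GRing.scale /= ?ImM ?ReM ?ImM /=; ring.
Qed.

(** The mean value theorem is applied to the two components separately. *)
Lemma has_cderive0_eq f : (forall t, 0 <= t <= 1 -> has_cderive f t 0) ->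
  f 1 = f 0.
Proof.
move=> h.
have key (g : R -> R) :
    (forall t, 0 <= t <= 1 -> is_derive (t : R^o) 1 (g : R^o -> R^o) 0) -> g 1 = g 0.
  move=> dg.
  have cg : {within `[0, 1], continuous (g : R^o -> R^o)}.
    apply: derivable_within_continuous => y; rewrite in_itv /= => /dg.
    by move=> ?; exact: ex_derive.
  have dg' y : y \in `]0, 1[%R -> is_derive (y : R^o) 1 (g : R^o -> R^o) ((fun=> 0) y).
    by rewrite in_itv /= => /andP[y0 y1]; apply: dg; rewrite !ltW.
  have [c _] := MVT (@ltr01 R) dg' cg.
  by rewrite mul0r => /eqP; rewrite subr_eq0 => /eqP.
by apply: complex_ext; apply: (key (fun t => _ (f t))) => t /h[].
Qed.

(** The ratio test as an explicit bound; the constant sums the quotients |f i| / rho^i for i <= N,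
    so it also covers the terms before the ratio estimate starts. *)
Lemma ratio_bound (f : nat -> R) rho N : 0 < rho ->
  (forall j, (N <= j)%N -> `|f j.+1| <= rho * `|f j|) ->
  exists C, forall j, `|f j| <= C * rho ^+ j.
Proof.
move=> r0 le; exists (\sum_(i < N.+1) `|f i| / rho ^+ i) => j.
have small k : (k <= N)%N -> `|f k| <= (\sum_(i < N.+1) `|f i| / rho ^+ i) * rho ^+ k.
  move=> kN; rewrite -ler_pdivrMr ?exprn_gt0 //.
  have kN' : (k < N.+1)%N by rewrite ltnS.
  rewrite (bigD1 (Ordinal kN')) //= lerDl; apply: sumr_ge0 => i _.
  by rewrite divr_ge0 // exprn_ge0 // ltW.
have [jN|] := leqP j N; first exact: small.
elim: j => // j IH; rewrite ltnS leq_eqVlt => /orP[/eqP <-|Nj].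
  rewrite (le_trans (le N _)) // exprS mulrCA ler_wpM2l ?(ltW r0) //.
  exact: small.
rewrite (le_trans (le j _)) ?(ltnW Nj) // exprS mulrCA ler_wpM2l ?(ltW r0) //.
exact: IH.
Qed.

(** The coefficient of v^j in (1 - v)^(-p). *)
Definition bcoef p j : R := pochhammer p j / j`!%:R.

(** Coefficientwise form of the differential equation (1 - v) f' = p f. *)
Lemma bcoefS p j : j.+1%:R * bcoef p j.+1 = (p + j%:R) * bcoef p j.
Proof.
rewrite /bcoef /pochhammer big_ord_recr /= factS natrM.
have a0 : j.+1%:R != 0 :> R by rewrite pnatr_eq0.
have b0 : j`!%:R != 0 :> R by rewrite pnatr_eq0 -lt0n fact_gt0.
by move: (j.+1%:R) a0 => A a0; field; rewrite ?a0 ?b0.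
Qed.

(** Each derivation raises the factor p + j of the recurrence by 1, so |p| + 2 + j serves for the
    sequence and its first two derived sequences alike. *)
Lemma bcoefS1 p j : j.+1%:R * pseries_diffs (bcoef p) j.+1 =
  (p + j.+1%:R) * pseries_diffs (bcoef p) j.
Proof. by rewrite {1}/pseries_diffs bcoefS mulrCA. Qed.

Lemma bcoefS2 p j : j.+1%:R * pseries_diffs (pseries_diffs (bcoef p)) j.+1 =
  (p + j.+2%:R) * pseries_diffs (pseries_diffs (bcoef p)) j.
Proof. by rewrite {1}/pseries_diffs bcoefS1 mulrCA. Qed.

Lemma bcoef0 p : bcoef p 0 = 1.
Proof. by rewrite /bcoef /pochhammer big_ord0 divr1. Qed.

Lemma ratio_shift_lt1 p q : 0 <= q < 1 -> exists2 rho, 0 < rho < 1 &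
  exists N, forall j, (N <= j)%N -> (`|p| + 2 + j%:R) * q <= rho * j.+1%:R.
Proof.
(* The ratio is the midpoint of q and 1; the gap (1 - q) / 2, multiplied by j, absorbs (|p| + 2) q
   for large j. *)
move=> /andP[q0 q1]; exists ((q + 1) / 2); first by apply/andP; split; lra.
have d0 : 0 < (1 - q) / 2 by lra.
exists (Num.truncn ((`|p| + 2) * q / ((1 - q) / 2))).+1 => j Nj.
have h : (`|p| + 2) * q / ((1 - q) / 2) <= j%:R.
  have hj := ltW (truncnS_gt ((`|p| + 2) * q / ((1 - q) / 2))).
  by apply: le_trans hj _; rewrite ler_nat.
rewrite ler_pdivrMr // in h.
rewrite -[j.+1%:R]natr1 mulrDl; move: ((_ + _) * q) (j%:R : R) h => A x h.
by rewrite (_ : _ * (x + 1) = x * q + x * ((1 - q) / 2) + (q + 1) / 2); [lra | field].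
Qed.

(* The bounds on the first and second derived coefficient sequences are those
   that termwise differentiation of the series requires. *)
Lemma bcoef_geometric p q : 0 <= q < 1 -> exists2 rho, 0 < rho < 1 &
  exists C, forall j, [/\ `|bcoef p j| * q ^+ j <= C * rho ^+ j,
    `|pseries_diffs (bcoef p) j| * q ^+ j <= C * rho ^+ j &
    `|pseries_diffs (pseries_diffs (bcoef p)) j| * q ^+ j <= C * rho ^+ j].
Proof.
move=> q01; have [rho r01 [N hN]] := ratio_shift_lt1 p q01.
have /andP[q0 _] := q01; have /andP[r0 _] := r01.
exists rho => //.
have key (f : nat -> R) : (forall j, j.+1%:R * `|f j.+1| <= (`|p| + 2 + j%:R) * `|f j|) ->
    exists C, forall j, `|f j| * q ^+ j <= C * rho ^+ j.
  move=> le; have [|C hC] := @ratio_bound (fun j => f j * q ^+ j) rho N r0.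
    move=> j Nj; rewrite !normrM exprS (normrM q) (ger0_norm q0).
    have j0 : (0 : R) < j.+1%:R by rewrite ltr0n.
    rewrite -(ler_pM2l j0).
    rewrite [X in X <= _](_ : _ = (j.+1%:R * `|f j.+1|) * (q * `|q ^+ j|)); last by ring.
    apply: le_trans (ler_wpM2r _ (le j)) _; first by rewrite mulr_ge0.
    rewrite [X in X <= _](_ : _ = ((`|p| + 2 + j%:R) * q) * (`|f j| * `|q ^+ j|)); last by ring.
    rewrite [X in _ <= X](_ : _ = (rho * j.+1%:R) * (`|f j| * `|q ^+ j|)); last by ring.
    by rewrite ler_wpM2r ?mulr_ge0 // hN.
  by exists C => j; have := hC j; rewrite normrM [`|q ^+ _|]ger0_norm // exprn_ge0.
have tri (i j : nat) : (i <= 2)%N -> `|p + (j + i)%:R| <= `|p| + 2 + j%:R.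
  move=> i2; apply: le_trans (ler_normD _ _) _.
  by rewrite -addrA lerD2l normr_nat natrD [X in X <= _]addrC lerD2r ler_nat.
have [j|C0 h0] := key (bcoef p).
  rewrite -[j.+1%:R]normr_nat -normrM bcoefS normrM ler_wpM2r //.
  by have := tri 0 j isT; rewrite addn0.
have [j|C1 h1] := key (pseries_diffs (bcoef p)).
  rewrite -[j.+1%:R]normr_nat -normrM bcoefS1 normrM ler_wpM2r //.
  by have := tri 1 j isT; rewrite addn1.
have [j|C2 h2] := key (pseries_diffs (pseries_diffs (bcoef p))).
  rewrite -[j.+1%:R]normr_nat -normrM bcoefS2 normrM ler_wpM2r //.
  by have := tri 2 j isT; rewrite addn2.
exists (`|C0| + `|C1| + `|C2|) => j; split.
- apply: le_trans (h0 j) _; rewrite ler_wpM2r ?exprn_ge0 ?(ltW r0) //.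
  by rewrite (le_trans (ler_norm _)) // -addrA lerDl addr_ge0.
- apply: le_trans (h1 j) _; rewrite ler_wpM2r ?exprn_ge0 ?(ltW r0) //.
  by rewrite (le_trans (ler_norm _)) // addrAC lerDr addr_ge0.
- apply: le_trans (h2 j) _; rewrite ler_wpM2r ?exprn_ge0 ?(ltW r0) //.
  by rewrite (le_trans (ler_norm _)) // lerDr addr_ge0.
Qed.

(** The complex series is two real power series in t, with coefficients c_j Re(v^j) and c_j Im(v^j),
    to which termwise differentiation applies. Taking K > 1 puts the whole segment [0, 1] inside the
    interval of convergence. *)
Lemma power_series_cderive (c : nat -> R) v K C rho : 1 < K -> 0 < rho < 1 ->
  (forall j, [/\ `|c j| * (K * cabs v) ^+ j <= C * rho ^+ j,
    `|pseries_diffs c j| * (K * cabs v) ^+ j <= C * rho ^+ j &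
    `|pseries_diffs (pseries_diffs c) j| * (K * cabs v) ^+ j <= C * rho ^+ j]) ->
  exists S D : R -> R[i], forall t, `|t| < K ->
    [/\ has_csum (fun j => (c j)%:C * v ^+ j * (t ^+ j)%:C) (S t),
        has_csum (fun j => (pseries_diffs c j)%:C * v ^+ j.+1 * (t ^+ j)%:C) (D t) &
        has_cderive S t (D t)].
Proof.
move=> K1 r01 hC; have /andP[r0 r1] := r01; have v0 := cabs_ge0 v.
have cvgK (f : nat -> R) (g : nat -> R) (B : R) : 0 <= B ->
    (forall j, `|g j| <= B * cabs v ^+ j) ->
    (forall j, `|f j| * (K * cabs v) ^+ j <= C * rho ^+ j) ->
    cvgn (pseries (fun j => f j * g j) K).
  move=> B0 gv fC; rewrite /pseries.
  have [||l [h _]] := @geometric_has_csum _ (fun j => (f j * g j * K ^+ j)%:C) (B * C) rho.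
  - by rewrite (ltW r0).
  - move=> j; rewrite cabsR !normrM -(mulrA B).
    apply: (@le_trans _ _ (B * (`|f j| * (K * cabs v) ^+ j))); last by rewrite ler_wpM2l.
    have Kj : 0 <= K ^+ j by rewrite exprn_ge0 // (le_trans _ (ltW K1)).
    rewrite -mulrA [X in _ <= X]mulrCA ler_wpM2l // (ger0_norm Kj) [X in _ <= _ * X]exprMn.
    by rewrite [X in X <= _]mulrC [X in _ <= X]mulrCA ler_wpM2l.
  by apply/cvg_ex; exists (Re l); exact: h.
have cx t (V : R[i]) y : Re (t%:C * V * y%:C) = t * Re V * y.
  by rewrite !(ReM, ImM) /=; ring.
have cy t (V : R[i]) y : Im (t%:C * V * y%:C) = t * Im V * y.
  by rewrite !(ReM, ImM) /=; ring.
have dfs (f g : nat -> R) : pseries_diffs (fun j => f j * g j) =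
    (fun j => pseries_diffs f j * g j.+1).
  by apply/funext => j; rewrite /pseries_diffs mulrA.
have sub (g : nat -> R) i : (forall j, `|g j| <= cabs v ^+ j) ->
    (forall j, `|g (i + j)%N| <= cabs v ^+ i * cabs v ^+ j).
  by move=> gv j; apply: le_trans (gv _) _; rewrite exprD.
have K0 : `|K| = K by rewrite gtr0_norm // (lt_trans _ K1).
have der (g : nat -> R) : (forall j, `|g j| <= cabs v ^+ j) -> forall t, `|t| < K ->
    [/\ cvgn (pseries (fun j => c j * g j) t),
     cvgn (pseries (fun j => pseries_diffs c j * g j.+1) t) &
     is_derive (t : R^o) 1 (fun t => limn (pseries (fun j => c j * g j) t) : R^o)
      (limn (pseries (fun j => pseries_diffs c j * g j.+1) t))].
  move=> gv t tK.
  have c0 := cvgK c g _ (exprn_ge0 0 v0) (sub g 0%N gv) (fun j => let: And3 h _ _ := hC j in h).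
  have c1 := cvgK (pseries_diffs c) (fun j => g j.+1) _ (exprn_ge0 1 v0) (sub g 1 gv)
    (fun j => let: And3 _ h _ := hC j in h).
  have c2 := cvgK (pseries_diffs (pseries_diffs c)) (fun j => g j.+2) _ (exprn_ge0 2 v0)
    (sub g 2 gv) (fun j => let: And3 _ _ h := hC j in h).
  split.
  - by apply: is_cvg_pseries_inside c0 _; rewrite K0.
  - by apply: is_cvg_pseries_inside c1 _; rewrite K0.
  - rewrite -(dfs c g); apply: (@pseries_snd_diffs _ _ K).
    + exact: c0.
    + by rewrite (dfs c g).
    + by rewrite (dfs c g) (dfs (pseries_diffs c) (fun j => g j.+1)).
    + by rewrite K0.
have gRe j : `|Re (v ^+ j)| <= cabs v ^+ j by rewrite -cabsX ler_Re_cabs.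
have gIm j : `|Im (v ^+ j)| <= cabs v ^+ j by rewrite -cabsX ler_Im_cabs.
pose S t : R[i] := limn (pseries (fun j => c j * Re (v ^+ j)) t)
  +i* limn (pseries (fun j => c j * Im (v ^+ j)) t).
pose D t : R[i] := limn (pseries (fun j => pseries_diffs c j * Re (v ^+ j.+1)) t)
  +i* limn (pseries (fun j => pseries_diffs c j * Im (v ^+ j.+1)) t).
exists S, D => t tK; have [c1 d1 e1] := der _ gRe t tK; have [c2 d2 e2] := der _ gIm t tK.
split=> //.
- by split; [under eq_fun do rewrite cx | under eq_fun do rewrite cy].
- by split; [under eq_fun do rewrite cx | under eq_fun do rewrite cy].
Qed.

(** The sum S(t) of the series at t v satisfies S' = v S, so S(t) exp(- t v) is constantly 1. *)
Lemma cexp_series v : has_csum (fun j => (j`!%:R^-1)%:C * v ^+ j) (cexp v).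
Proof.
pose c (j : nat) : R := j`!%:R^-1.
have cc : pseries_diffs c = c by exact: pseries_diffs_inv_fact.
(* This is X^j / j! <= exp X for X = 4 |v|; the spare factor 2^j gives the geometric decay. *)
have hC j : `|c j| * (2 * cabs v) ^+ j <= expR (2 * cabs v * 2) * 2^-1 ^+ j.
  rewrite exprVn ler_pdivlMr ?exprn_gt0 // -[X in X <= _]mulrA -exprMn.
  have X0 : 0 <= 2 * cabs v * 2 by rewrite !mulr_ge0 ?cabs_ge0.
  rewrite ger0_norm ?invr_ge0 //; move: (_ * 2) X0 => X X0.
  case: j => [|j]; first by rewrite /c expr0 fact0 invr1 mulr1 -expR0 ler_expR.
  by rewrite mulrC; apply: le_trans (expR_ge1Dxn j X0); rewrite lerDr.
have h01 : 0 < (2^-1 : R) < 1 by rewrite invr_gt0 ltr0n invf_lt1 ?ltr1n.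
have two1 : 1 < (2 : R) by rewrite ltr1n.
have hC3 j : [/\ `|c j| * (2 * cabs v) ^+ j <= expR (2 * cabs v * 2) * 2^-1 ^+ j,
    `|pseries_diffs c j| * (2 * cabs v) ^+ j <= expR (2 * cabs v * 2) * 2^-1 ^+ j &
    `|pseries_diffs (pseries_diffs c) j| * (2 * cabs v) ^+ j
      <= expR (2 * cabs v * 2) * 2^-1 ^+ j].
  by rewrite !cc; split; apply: hC.
have [S [D hSD]] := power_series_cderive two1 h01 hC3.
have DS t : `|t| < 2 -> D t = v * S t.
  move=> /hSD[s1 s2 _]; apply: has_csum_unique s2 _; rewrite cc.
  by apply: eq_has_csum (has_csumZ v s1) => j; rewrite exprS; ring.
have S0 : S 0 = 1.
  have [|s1 _ _] := hSD 0; first by rewrite normr0.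
  apply: has_csum_unique s1 _.
  have := @has_csum_finite _ (fun j => (c j)%:C * v ^+ j * (0 ^+ j)%:C) 1.
  rewrite big_nat1 /c fact0 invr1 !expr0 !mul1r; apply => -[|j] // _.
  by rewrite expr0n mulr0.
have tv t : has_cderive (fun t => t%:C * (- v)) t (- v).
  split.
    rewrite (_ : (fun t => _) = (- Re v) *: (id : R^o -> R^o)); last first.
      by apply/funext => y; rewrite ReM ReN /= mul0r subr0 mulrC.
    by apply: is_derive_eq; rewrite ReN /GRing.scale /= mulr1.
  rewrite (_ : (fun t => _) = (- Im v) *: (id : R^o -> R^o)); last first.
    by apply/funext => y; rewrite ImM ImN /= mul0r addr0 mulrC.
  by apply: is_derive_eq; rewrite ImN /GRing.scale /= mulr1.
have := @has_cderive0_eq (fun t => S t * cexp (t%:C * (- v))).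
rewrite S0 !mul0r cexp0 mulr1 mul1r => SE.
have {}SE : S 1 = cexp v.
  rewrite -[LHS]mulr1 -cexp0 -(addNr v) cexpD mulrA SE ?mul1r // => t /andP[t0 t1].
  have t2 : `|t| < 2 by rewrite ger0_norm // (le_lt_trans t1) // ltr1n.
  have [_ _ dS] := hSD t t2.
  have := has_cderiveM dS (has_cderive_cexp (tv t)).
  by rewrite DS // (_ : _ + _ = 0) //; ring.
rewrite -SE; have [|s1 _ _] := hSD 1; first by rewrite normr1 ltr1n.
by apply: eq_has_csum s1 => j; rewrite expr1n mulr1.
Qed.

(** The recurrence of the coefficients gives (1 - t v) S'(t) = p v S(t) for the sum S(t) at t v.
    With L(t) the principal logarithm of 1 - t v, the product S(t) exp(p L(t)) has derivative 0 and
    equals 1 at t = 0, hence also at t = 1. *)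
Lemma binomial_series p v : cabs v < 1 ->
  has_csum (fun j => (bcoef p j)%:C * v ^+ j) (cpow (1 - v) (- p)).
Proof.
move=> v1; have v0 := cabs_ge0 v.
(* This choice satisfies both K > 1 and K |v| < 1. *)
pose K : R := 2 / (1 + cabs v).
have K1 : 1 < K by rewrite /K ltr_pdivlMr; lra.
have Kv : 0 <= K * cabs v < 1.
  by rewrite /K mulrAC ltr_pdivrMr ?mulr_ge0 ?invr_ge0; lra.
have [rho r01 [C hC]] := bcoef_geometric p Kv.
have [S [D hSD]] := power_series_cderive K1 r01 hC.
have sS t (tK : `|t| < K) := let: And3 h _ _ := hSD t tK in h.
have sD t (tK : `|t| < K) := let: And3 _ h _ := hSD t tK in h.
have dS t (tK : `|t| < K) := let: And3 _ _ h := hSD t tK in h.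
have ode t : `|t| < K -> D t = v * (p%:C * S t + t%:C * D t).
  move=> tK; apply: has_csum_unique (sD t tK) _.
  have := has_csumZ v (has_csumD (has_csumZ p%:C (sS t tK))
    (has_csum_shift (has_csumZ t%:C (sD t tK)))).
  apply: eq_has_csum => -[|j].
    rewrite /pseries_diffs bcoefS !expr0 expr1 addr0 addr0 !rmorphM /=; ring.
  have -> : pseries_diffs (bcoef p) j.+1 = (p + j.+1%:R) * bcoef p j.+1 by exact: bcoefS.
  by rewrite /pseries_diffs !exprS !(rmorphM, rmorphD) /=; ring.
(* [N t] is |1 - t v|^2, and [L t] is the logarithm of 1 - t v written with real functions; the
   arctangent form is legitimate because 1 - t v has positive real part. *)
pose N t := (1 - t * Re v) ^+ 2 + (t * Im v) ^+ 2.
pose L t := 2^-1 * ln (N t) +i* atan (- (t * Im v) / (1 - t * Re v)).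
have tv t : 0 <= t <= 1 -> 0 < 1 - t * Re v.
  move=> /andP[t0 t1]; rewrite subr_gt0.
  have := ler_norm (Re v); have := ler_Re_cabs v; nra.
have dL t : 0 <= t <= 1 -> has_cderive L t (- v / (1 - t%:C * v)).
  move=> /tv t1; have N0 : 0 < N t by rewrite ltr_pwDl ?exprn_gt0 ?sqr_ge0.
  have M0 : 1 - t * Re v != 0 by rewrite gt_eqF.
  have dl : is_derive (t : R^o) 1 (fun t => 1 - t * Re v : R^o) (- Re v).
    rewrite (_ : (fun t => _) = cst 1 - (Re v *: (id : R^o -> R^o))); last first.
      by apply/funext => y /=; rewrite mulrC.
    by apply: is_derive_eq; rewrite /GRing.scale /=; ring.
  have dr : is_derive (t : R^o) 1 (fun t => t * Im v : R^o) (Im v).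
    rewrite (_ : (fun t => _) = (Im v *: (id : R^o -> R^o))); last first.
      by apply/funext => y /=; rewrite mulrC.
    by apply: is_derive_eq; rewrite /GRing.scale /=; ring.
  have dN : is_derive (t : R^o) 1 (N : R^o -> R^o)
      (2 * (1 - t * Re v) * (- Re v) + 2 * (t * Im v) * Im v).
    rewrite (_ : N = (fun t => 1 - t * Re v) ^+ 2 + (fun t => t * Im v) ^+ 2) //.
    by apply: is_derive_eq; rewrite /GRing.scale /=; ring.
  have dq : is_derive (t : R^o) 1 (fun t => - (t * Im v) / (1 - t * Re v) : R^o)
      (- Im v / (1 - t * Re v) ^+ 2).
    rewrite (_ : (fun t => _) = (- (fun t => t * Im v)) * (fun t => (1 - t * Re v)^-1)) //.
    have di := @is_deriveV _ (fun t => 1 - t * Re v) t _ 1 M0 dl.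
    by apply: is_derive_eq; rewrite /GRing.scale /= !fctE /=; field.
  have e1 := @is_derive_chain (@ln R) N t _ _ (is_derive1_ln N0) dN.
  have e2 := @is_derive_chain atan (fun t => - (t * Im v) / (1 - t * Re v)) t _ _
    (is_derive1_atan _) dq.
  have dE : - v / (1 - t%:C * v) =
      (- Re v * (1 - t * Re v) + t * Im v ^+ 2) / N t +i* (- Im v / N t).
    have v0' : 1 - t%:C * v != 0.
      apply: Re_gt0_neq0; suff -> : Re (1 - t%:C * v) = 1 - t * Re v by [].
      by rewrite ReD ReN ReM /=; ring.
    apply: (mulIf v0'); rewrite divfK //.
    apply: complex_ext; rewrite ?ReM ?ImM ?ReD ?ImD ?ReN ?ImN ?ReM ?ImM /= /N.
      by field; rewrite gt_eqF.
    by field; rewrite gt_eqF.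
  rewrite dE; split => /=.
    rewrite (_ : (fun t => _) = 2^-1 *: (fun t => ln (N t) : R^o)) //.
    by apply: is_derive_eq; rewrite /GRing.scale /=; field; rewrite gt_eqF.
  apply: is_derive_eq.
  by rewrite /N; field; rewrite M0 gt_eqF.
have L0 : L 0 = 0.
  rewrite /L /N; apply: complex_ext => /=; rewrite !mul0r.
    by rewrite subr0 expr0n expr1n addr0 ln1 mulr0.
  by rewrite oppr0 mul0r atan0.
have LE : L 1 = clog (1 - v).
  have t1 : 0 < 1 - 1 * Re v by apply: tv; rewrite ler01 lexx.
  have R1 : Re (1 - v) = 1 - Re v by rewrite ReD ReN.
  have I1 : Im (1 - v) = - Im v by rewrite ImD ImN add0r.
  rewrite mul1r in t1.
  apply: complex_ext => /=; last by rewrite carg_atan R1 ?I1 // !mul1r.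
  rewrite /cabs R1 I1 sqrrN /N !mul1r -powR12_sqrt; last first.
    by rewrite addr_ge0 ?sqr_ge0.
  by rewrite ln_powR.
have S0 : S 0 = 1.
  apply: has_csum_unique (sS 0 _) _; first by rewrite normr0 (lt_trans _ K1).
  have := @has_csum_finite _ (fun j => (bcoef p j)%:C * v ^+ j * (0 ^+ j)%:C) 1.
  rewrite big_nat1 bcoef0 !expr0 !mul1r; apply => -[|j] // _.
  by rewrite expr0n mulr0.
have v1' : 1 - v != 0.
  by apply: Re_gt0_neq0; rewrite ReD ReN /= -(mul1r (Re v)) tv // ler01 lexx.
have := @has_cderive0_eq (fun t => S t * cexp (p%:C * L t)).
rewrite L0 S0 mulr0 cexp0 mulr1 LE -cpowE // => SE.
have {}SE : S 1 = cpow (1 - v) (- p).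
  rewrite cpowN //; apply: (mulIf (cpow_neq0 p v1')); rewrite mulVf ?cpow_neq0 //.
  apply: SE => t t01.
  have tK : `|t| < K by case/andP: t01 => t0 t1; rewrite ger0_norm // (le_lt_trans t1).
  have dpL : has_cderive (fun t => p%:C * L t) t (p%:C * (- v / (1 - t%:C * v))).
    exact: has_cderiveZ (dL t t01).
  have := has_cderiveM (dS t tK) (has_cderive_cexp dpL).
  have v0' : 1 - t%:C * v != 0.
    apply: Re_gt0_neq0; rewrite ReD ReN ReM /= mul0r subr0; exact: tv.
  suff -> : D t * cexp (p%:C * L t) + S t * (p%:C * (- v / (1 - t%:C * v))
     * cexp (p%:C * L t)) = 0 by [].
  rewrite -[X in _ = X](mul0r (cexp (p%:C * L t))) -[in LHS]mulrA; apply/eqP.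
  have Dt : D t = p%:C * v * S t / (1 - t%:C * v).
    apply: (canRL (mulfK v0')); rewrite mulrBr mulr1 {1}ode //; ring.
  rewrite Dt; apply/eqP; field; exact: v0'.
rewrite -SE; have := sS 1; rewrite normr1 => /(_ K1).
by apply: eq_has_csum => j; rewrite expr1n mulr1.
Qed.

End BinomialSeries.

(** * The Laplace transform: linearity and interchange with series *)

Section LaplaceSeries.
Variable R : realType.
Notation mu := (@lebesgue_measure R).
Notation D := (`]0, +oo[%classic : set R).
Implicit Types (f g : R -> R[i]) (a c l s : R[i]) (t x M C rho kappa delta : R).

Let mD : measurable (D : set (measurableTypeR R)).
Proof. by []. Qed.

Lemma integrable_expRN delta : 0 < delta ->
  mu.-integrable D (fun t => (expR (- delta * t))%:E).
Proof.
move=> d0.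
have h : mu.-integrable D (EFin \o exponential_pdf delta).
  by apply: integrableS (integrable_exponential_pdf d0).
apply: (eq_integrable mD (fun t => (delta^-1)%:E * (exponential_pdf delta t)%:E)%E) => //; last first.
  exact: integrableZl.
move=> t; rewrite inE /= in_itv /= andbT => t0.
by rewrite exponential_pdfE ?ltW // -EFinM mulrA mulVf ?gt_eqF // mul1r.
Qed.

Lemma integrable_dominated (h : R -> R) M delta : 0 < delta ->
  measurable_fun D h -> (forall t, 0 < t -> `|h t| <= M * expR (- delta * t)) ->
  mu.-integrable D (fun t => (h t)%:E).
Proof.
move=> d0 mh le.
have M0 : 0 <= M.
  by have := le 1 ltr01; rewrite -(pmulr_lge0 M (expR_gt0 (- delta * 1))); apply: le_trans.
apply: (le_integrable mD _ _ (integrableZl mD M (integrable_expRN d0))) => //.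
  exact/measurable_EFinP.
move=> t; rewrite /= in_itv /= andbT => t0.
by rewrite lee_fin (ger0_norm (mulr_ge0 M0 (expR_ge0 _))) le.
Qed.

(** Dominated convergence for the partial sums, with a multiple of an exponential as majorant. *)
Lemma integrable_series (g : nat -> R -> R) (G : R -> R) (u : nat -> R) M delta :
  0 < delta ->
  (forall k, mu.-integrable D (fun t => (g k t)%:E)) ->
  (forall k, (\int[mu]_(t in D) g k t)%R = u k) ->
  (forall t, 0 < t -> series (g ^~ t) @ \oo --> G t) ->
  (forall n t, 0 < t -> `|series (g ^~ t) n| <= M * expR (- delta * t)) ->
  mu.-integrable D (fun t => (G t)%:E) /\
  series u @ \oo --> (\int[mu]_(t in D) G t)%R.
Proof.
move=> d0 ig Eu gG le.
have isum n : mu.-integrable D (fun t => (series (g ^~ t) n)%:E).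
  apply: (eq_integrable mD (fun t => \sum_(0 <= k < n) (g k t)%:E)%E) => //.
    by move=> t _; rewrite sumEFin.
  exact: integrable_sum.
have iM := integrableZl mD M (integrable_expRN d0).
have cv t : D t -> (fun n => (series (g ^~ t) n)%:E) @ \oo --> (G t)%:E.
  by rewrite /= in_itv /= andbT => t0; apply/fine_cvgP; split;
    [apply: nearW | exact: gG].
have bd n t : D t -> (`|(series (g ^~ t) n)%:E| <= M%:E * (expR (- delta * t))%:E)%E.
  by rewrite /= in_itv /= andbT => t0; rewrite -EFinM lee_fin le.
have ms n := measurable_int _ (isum n).
have mG : measurable_fun D (fun t => (G t)%:E) := emeasurable_fun_cvg _ _ ms cv.
have [iG _] := dominated_convergence (mu := mu) mD ms mG (aeW mu cv) iM
  (aeW mu (fun t n => bd n t)).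
move=> h; split=> //; move: h.
have Es n : (\int[mu]_(t in D) (series (g ^~ t) n)%:E)%E = (series u n)%:E.
  rewrite /series /=; under eq_integral do rewrite -sumEFin.
  rewrite integral_sum // -sumEFin; apply: eq_bigr => k _.
  by rewrite -Eu /Rintegral fineK // integrable_fin_num.
under eq_fun do rewrite Es.
rewrite -[X in _ --> X]fineK ?integrable_fin_num //.
by case/fine_cvgP.
Qed.

(** Existence and value travel together, because the integral denotes a number whether or not the
    integrand is integrable. *)
Definition has_laplace f s l := laplace_exists f s /\ laplace f s = l.

Lemma has_laplaceE f s l : has_laplace f s l <->
  [/\ laplace_exists f s,
    (\int[mu]_(t in D) Re (laplace_integrand f s t))%R = Re l &
    (\int[mu]_(t in D) Im (laplace_integrand f s t))%R = Im l].
Proof.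
split=> [[h <-]|[h h1 h2]] //; split=> //.
by apply: complex_ext => /=.
Qed.

(** Two different points are allowed, so that an exponential factor can be moved from the function
    into the kernel exp(- s t). *)
Lemma eq_laplace_integrand f g s s' l :
  (forall t, 0 < t -> laplace_integrand f s t = laplace_integrand g s' t) ->
  has_laplace f s l -> has_laplace g s' l.
Proof.
move=> fg /has_laplaceE[[i1 i2] e1 e2]; apply/has_laplaceE.
have E t : t \in D -> laplace_integrand f s t = laplace_integrand g s' t.
  by rewrite inE /= in_itv /= andbT => /fg.
split.
- split; [apply: (eq_integrable mD) i1 | apply: (eq_integrable mD) i2] => // t tD; by rewrite E.
- by rewrite -e1; apply: eq_Rintegral => t tD; rewrite E.
- by rewrite -e2; apply: eq_Rintegral => t tD; rewrite E.
Qed.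

Lemma eq_has_laplace f g s l : (forall t, 0 < t -> f t = g t) ->
  has_laplace f s l -> has_laplace g s l.
Proof.
by move=> fg; apply: eq_laplace_integrand => t /fg; rewrite /laplace_integrand => ->.
Qed.

Lemma has_laplaceD f g s a c : has_laplace f s a -> has_laplace g s c ->
  has_laplace (fun t => f t + g t) s (a + c).
Proof.
move=> /has_laplaceE[[i1 i2] e1 e2] /has_laplaceE[[j1 j2] e3 e4]; apply/has_laplaceE.
have E t : laplace_integrand (fun t => f t + g t) s t =
    laplace_integrand f s t + laplace_integrand g s t by rewrite /laplace_integrand mulrDr.
split.
- split.
    apply: (eq_integrable mD) (integrableD mD i1 j1) => // t _; by rewrite /= E ReD.
  apply: (eq_integrable mD) (integrableD mD i2 j2) => // t _; by rewrite /= E ImD.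
- under eq_Rintegral do rewrite E ReD.
  by rewrite RintegralD // e1 e3 ReD.
- under eq_Rintegral do rewrite E ImD.
  by rewrite RintegralD // e2 e4 ImD.
Qed.

Lemma has_laplaceZ f s a c : has_laplace f s a -> has_laplace (fun t => c * f t) s (c * a).
Proof.
move=> /has_laplaceE[[i1 i2] e1 e2]; apply/has_laplaceE.
have E t : laplace_integrand (fun t => c * f t) s t = c * laplace_integrand f s t.
  by rewrite /laplace_integrand mulrCA.
have k1 x := integrableZl mD x i1.
have k2 x := integrableZl mD x i2.
split.
- split.
    apply: (eq_integrable mD) (integrableB mD (k1 (Re c)) (k2 (Im c))) => // t _.
    by rewrite E (ReM c).
  apply: (eq_integrable mD) (integrableD mD (k2 (Re c)) (k1 (Im c))) => // t _.
  by rewrite E (ImM c).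
- under eq_Rintegral do rewrite E (ReM c).
  rewrite RintegralB //; [|exact: (k1 (Re c))|exact: (k2 (Im c))].
  by rewrite !RintegralZl // e1 e2 (ReM c).
- under eq_Rintegral do rewrite E (ImM c).
  rewrite RintegralD //; [|exact: (k2 (Re c))|exact: (k1 (Im c))].
  by rewrite !RintegralZl // e1 e2 (ImM c).
Qed.

(** After multiplication by exp(- s t), the partial sums are dominated by C / (1 - rho) exp(- (Re s
    - kappa) t), which is integrable since Re s > kappa. The sum [L] is left open and identified in
    each application by [has_csum_unique]. *)
Lemma has_laplace_csum (f : nat -> R -> R[i]) s (l : nat -> R[i]) C rho kappa :
  0 <= rho < 1 -> kappa < Re s ->
  (forall k t, 0 < t -> cabs (f k t) <= C * rho ^+ k * expR (kappa * t)) ->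
  (forall k, has_laplace (f k) s (l k)) ->
  exists2 L, has_csum l L & has_laplace (fun t => csum (fun k => f k t)) s L.
Proof.
move=> r01 ks le hl; have /andP[r0 r1] := r01.
have C0 : 0 <= C.
  have := le 0 1 ltr01; rewrite expr0 mulr1 -(pmulr_lge0 C (expR_gt0 (kappa * 1))).
  by apply: le_trans; apply: cabs_ge0.
have hs t : 0 < t -> has_csum (fun k => laplace_integrand (f k) s t)
    (laplace_integrand (fun t => csum (fun k => f k t)) s t).
  move=> t0; apply: has_csumZ.
  have [k|S hS] := @geometric_has_csum _ (fun k => f k t) (C * expR (kappa * t)) rho r01.
    by rewrite mulrAC le.
  by rewrite (csumE hS).
have bd k t : 0 < t -> cabs (laplace_integrand (f k) s t) <=
    C * expR (- (Re s - kappa) * t) * rho ^+ k.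
  move=> t0; rewrite /laplace_integrand cabsM cabs_cexp ReM /= mulr0 subr0 ReN.
  apply: le_trans (ler_wpM2l (expR_ge0 _) (le k t t0)) _.
  rewrite (_ : - (Re s - kappa) * t = - Re s * t + kappa * t) ?expRD; last by ring.
  by rewrite le_eqVlt; apply/orP; left; apply/eqP; ring.
have bs (p : R[i] -> R) n t : (forall a, `|p a| <= cabs a) -> 0 < t ->
    `|series (fun k => p (laplace_integrand (f k) s t)) n| <=
    C / (1 - rho) * expR (- (Re s - kappa) * t).
  move=> hp t0; rewrite /series /=; apply: le_trans (ler_norm_sum _ _ _) _.
  have Ce : 0 <= C * expR (- (Re s - kappa) * t) by rewrite mulr_ge0 ?expR_ge0.
  rewrite mulrAC; apply: le_trans (_ : _ <= C * expR (- (Re s - kappa) * t) * rho ^+ 0 / (1 - rho)) _.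
    apply: le_trans (sum_geometric_le 0 n Ce r01); apply: ler_sum => k _.
    exact: le_trans (hp _) (bd k t t0).
  by rewrite expr0 mulr1.
have ds : 0 < Re s - kappa by rewrite subr_gt0.
have hl' k := (has_laplaceE _ _ _).1 (hl k).
have [] := @integrable_series (fun k t => Re (laplace_integrand (f k) s t))
  (fun t => Re (laplace_integrand (fun t => csum (fun k => f k t)) s t))
  (fun k => Re (l k)) (C / (1 - rho)) (Re s - kappa) ds.
- by move=> k; have [[]] := hl' k.
- by move=> k; have [_] := hl' k.
- by move=> t t0; have [] := hs t t0.
- by move=> n t t0; apply: bs => // a; apply: ler_Re_cabs.
move=> i1 c1.
have [] := @integrable_series (fun k t => Im (laplace_integrand (f k) s t))
  (fun t => Im (laplace_integrand (fun t => csum (fun k => f k t)) s t))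
  (fun k => Im (l k)) (C / (1 - rho)) (Re s - kappa) ds.
- by move=> k; have [[]] := hl' k.
- by move=> k; have [_ _] := hl' k.
- by move=> t t0; have [] := hs t t0.
- by move=> n t t0; apply: bs => // a; apply: ler_Im_cabs.
move=> i2 c2.
by exists (laplace (fun t => csum (fun k => f k t)) s).
Qed.

End LaplaceSeries.

(** * Euler's integral: functional equation, scaling and bounds *)

Section GammaLaplace.
Variable R : realType.
Notation mu := (@lebesgue_measure R).
Notation D := (`]0, +oo[%classic : set R).
Implicit Types (a c t x y M K kappa : R) (s : R[i]).

Let mD : measurable (D : set (measurableTypeR R)).
Proof. by []. Qed.

(** For t <= 1 the power is at most 1; for larger t it is at most an integer power, which a single
    term of the exponential series controls. *)
Lemma powR_le_expR a c : 0 <= a -> 0 < c ->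
  exists2 K, 0 < K & forall t, 0 < t -> t `^ a <= K * expR (c * t).
Proof.
move=> a0 c0; pose n := Num.truncn a.
have an : a <= n.+1%:R by rewrite ltW // truncnS_gt.
have cn : 0 < n.+1`!%:R / c ^+ n.+1 by rewrite divr_gt0 ?exprn_gt0 // ltr0n fact_gt0.
exists (1 + n.+1`!%:R / c ^+ n.+1) => [|t t0]; first by rewrite addr_gt0.
have h1 : 1 <= expR (c * t) by rewrite -expR0 ler_expR mulr_ge0 // ltW.
have h2 : t ^+ n.+1 <= n.+1`!%:R / c ^+ n.+1 * expR (c * t).
  rewrite mulrAC ler_pdivlMr ?exprn_gt0 // -exprMn -ler_pdivrMl; last first.
    by rewrite ltr0n fact_gt0.
  rewrite mulrC (mulrC t); apply: le_trans (expR_ge1Dxn n _).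
    by rewrite lerDr.
  by rewrite mulr_ge0 // ltW.
rewrite mulrDl mul1r; have [t1|t1] := leP t 1.
  apply: le_trans (_ : 1 <= _).
    have := ge0_ler_powR a0 (x := t) (y := 1); rewrite powR1; apply => //; rewrite nnegrE ?ltW //.
  by rewrite (le_trans h1) // lerDl mulr_ge0 ?expR_ge0 // ltW.
apply: le_trans (ler_powR (ltW t1) an) _; rewrite powR_mulrn ?(ltW t0) //.
by rewrite (le_trans h2) // lerDr expR_ge0.
Qed.

Lemma measurable_powR_expRN a c : measurable_fun D (fun t => t `^ a * expR (- c * t)).
Proof.
apply: measurable_funM; first exact: measurable_funTS.
by apply: measurable_funTS; apply: measurableT_comp.
Qed.

Lemma integrable_powR_expRN a c : 0 <= a -> 0 < c ->
  mu.-integrable D (fun t => (t `^ a * expR (- c * t))%:E).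
Proof.
move=> a0 c0; have c2 : 0 < c / 2 by rewrite divr_gt0.
have [K K0 hK] := powR_le_expR a0 c2.
apply: (@integrable_dominated _ _ K (c / 2)) => //; first exact: measurable_powR_expRN.
move=> t t0; rewrite ger0_norm ?mulr_ge0 ?powR_ge0 ?expR_ge0 //.
apply: le_trans (ler_wpM2r (expR_ge0 _) (hK t t0)) _.
by rewrite -[X in X <= _]mulrA -expRD le_eqVlt; apply/orP; left; apply/eqP; congr (_ * expR _); field.
Qed.

Lemma cvg_expRN c : 0 < c -> expR (- c * x) @[x --> +oo] --> 0.
Proof.
move=> c0; rewrite (_ : (fun x => expR (- c * x)) =
    (fun z => expR (- z)) \o (fun z => c * z)); last by apply/funext => x; rewrite /= mulNr.
apply: (@cvg_comp _ _ _ _ _ _ (pinfty_nbhs R)); last exact: cvgr_expR.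
exact: gt0_cvgMry.
Qed.

Lemma cvg_powR_expRN a c : 0 <= a -> 0 < c -> x `^ a * expR (- c * x) @[x --> +oo] --> 0.
Proof.
move=> a0 c0; have c2 : 0 < c / 2 by rewrite divr_gt0.
have [K K0 hK] := powR_le_expR a0 c2.
have h : K * expR (- (c / 2) * x) @[x --> +oo] --> 0.
  by rewrite -(mulr0 K); apply: cvgMr; exact: cvg_expRN.
apply: (squeeze_cvgr _ (cvg_cst 0) h); near=> x.
have x0 : 0 < x by near: x; exact: nbhs_pinfty_gt.
rewrite mulr_ge0 ?powR_ge0 ?expR_ge0 //=.
apply: le_trans (ler_wpM2r (expR_ge0 _) (hK x x0)) _.
by rewrite -[X in X <= _]mulrA -expRD le_eqVlt; apply/orP; left; apply/eqP; congr (_ * expR _); field.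
Unshelve. all: by end_near. Qed.

Lemma is_derive_expRN c x : is_derive (x : R^o) 1 (fun y => expR (- c * y) : R^o)
  (- c * expR (- c * x)).
Proof.
have h : is_derive (x : R^o) 1 (fun y => - c * y : R^o) (- c).
  rewrite (_ : (fun y => _) = (- c) *: (id : R^o -> R^o)) //.
  by apply: is_derive_eq; rewrite /GRing.scale /= mulr1.
exact: (is_derive_chain (is_derive_expR _) h).
Qed.

Lemma is_derive_powR_expRN a c x : 0 < x ->
  is_derive (x : R^o) 1 (fun y => y `^ a * expR (- c * y) : R^o)
  (a * (x `^ (a - 1) * expR (- c * x)) - c * (x `^ a * expR (- c * x))).
Proof.
move=> x0; have h1 := is_derive1_powR a x0; have h2 := is_derive_expRN c x.
rewrite (_ : (fun y => _) = (fun y : R^o => y `^ a : R^o) * (fun y : R^o => expR (- c * y) : R^o)) //.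
by apply: is_derive_eq; rewrite /GRing.scale /=; ring.
Qed.

Lemma continuous_expRN c : continuous (fun y : R => expR (- c * y)).
Proof.
move=> x; have h := is_derive_expRN c x.
by apply/differentiable_continuous/derivable1_diffP; exact: ex_derive.
Qed.

Lemma cvg_powR_expRN0 a c : 0 < a -> x `^ a * expR (- c * x) @[x --> 0^'+] --> (0 : R).
Proof.
move=> a0; rewrite -[X in _ --> X](mul0r (expR (- c * 0))); apply: cvgM; first exact: powR_cvg0.
by apply: cvg_at_right_filter; exact: continuous_expRN.
Qed.

(** The fundamental theorem on the half-line for nonnegative integrands, with a primitive that
    vanishes at infinity. *)
Lemma Rintegral_primitive (f F : R -> R) :
  (forall x, 0 <= x -> 0 <= f x) -> (forall x, 0 < x -> derivable (f : R^o -> R^o) x 1) ->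
  f x @[x --> 0^'+] --> f 0 -> F x @[x --> +oo] --> 0 ->
  (forall x, 0 < x -> is_derive (x : R^o) 1 (F : R^o -> R^o) (f x)) ->
  F x @[x --> 0^'+] --> F 0 -> mu.-integrable D (fun t => (f t)%:E) ->
  (\int[mu]_(t in D) f t)%R = - F 0.
Proof.
move=> f0 df f00 Foo dF F00 fi.
rewrite Rintegral_itv_obnd_cbnd //.
rewrite (@Rintegral_ge0_continuous_FTC2y _ f F 0 0) // ?sub0r //.
- apply/continuous_within_itvcyP; split=> // x; rewrite in_itv /= andbT => x0.
  by apply/differentiable_continuous/derivable1_diffP; exact: df.
- by move=> x x0; have := dF x x0 => h; exact: ex_derive.
- move=> x; rewrite in_itv /= andbT => x0; rewrite derive1E.
  by have h := dF x x0; exact: derive_val.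
Qed.

Lemma Rintegral_expRN c : 0 < c -> (\int[mu]_(t in D) expR (- c * t))%R = c^-1.
Proof.
move=> c0; transitivity (- - (c^-1 * expR (- c * 0))); last first.
  by rewrite opprK mulr0 expR0 mulr1.
apply: (@Rintegral_primitive (fun t => expR (- c * t)) (fun t => - (c^-1 * expR (- c * t)))).
- by move=> x _; exact: expR_ge0.
- by move=> x _; have h := is_derive_expRN c x; exact: ex_derive.
- by apply: cvg_at_right_filter; exact: continuous_expRN.
- by rewrite -[X in _ --> X]oppr0 -[X in _ --> - X](mulr0 c^-1); apply: cvgN; apply: cvgMr; exact: cvg_expRN.
- move=> x x0; have h := is_derive_expRN c x.
  rewrite (_ : (fun y => _) = - (c^-1 *: (fun t => expR (- c * t) : R^o))) //.
  by apply: is_derive_eq; rewrite /GRing.scale /=; field; rewrite gt_eqF.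
- apply: cvg_at_right_filter; apply: cvgN; apply: cvgMr; exact: continuous_expRN.
- exact: integrable_expRN.
Qed.

Lemma GammaE a : Gamma (a + 1) = (\int[mu]_(t in D) (t `^ a * expR (- 1 * t)))%R :> R.
Proof.
by rewrite /Gamma; apply: eq_Rintegral => t _; rewrite addrK mulN1r.
Qed.

(** Integration by parts: h = t^a exp(- t) has derivative g - h, with g = a t^(a - 1) exp(- t). As g
    - h changes sign, a majorant e = K exp(- t / 2) of h is added to make the integrand nonnegative;
    its integral 2 K cancels at the end. The assumption 1 < a makes g continuous at 0 with value
    0. *)
Lemma GammaS a : 1 < a -> Gamma (a + 1) = a * Gamma a.
Proof.
move=> a1; have a0 : 0 < a by rewrite (lt_trans ltr01).
have b0 : 0 < a - 1 by rewrite subr_gt0.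
have half : 0 < (2^-1 : R) by rewrite invr_gt0.
have [K K0 hK] := powR_le_expR (ltW a0) half.
pose g t := a * (t `^ (a - 1) * expR (- 1 * t)).
pose h t := t `^ a * expR (- 1 * t).
pose e t := K * expR (- 2^-1 * t).
have gi : mu.-integrable D (fun t => (g t)%:E).
  exact: (integrableZl mD a (integrable_powR_expRN (ltW b0) ltr01)).
have hi : mu.-integrable D (fun t => (h t)%:E) := integrable_powR_expRN (ltW a0) ltr01.
have ei : mu.-integrable D (fun t => (e t)%:E).
  exact: (integrableZl mD K (integrable_expRN half)).
have ghi : mu.-integrable D (EFin \o (fun t => g t - h t)) := integrableB mD gi hi.
have he t : 0 < t -> h t <= e t.
  move=> t0; rewrite /h /e; apply: le_trans (ler_wpM2r (expR_ge0 _) (hK t t0)) _.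
  by rewrite -[X in X <= _]mulrA -expRD le_eqVlt; apply/orP; left; apply/eqP; congr (_ * expR _); field.
have e0 : (\int[mu]_(t in D) e t)%R = 2 * K.
  by rewrite RintegralZl ?Rintegral_expRN ?invrK 1?mulrC //; exact: integrable_expRN.
have := @Rintegral_primitive (fun t => g t - h t + e t) (fun t => h t - 2 * e t).
rewrite RintegralD // RintegralB // e0.
have E0 : h 0 - 2 * e 0 = - (2 * K).
  by rewrite /h /e powR0 ?gt_eqF // mul0r sub0r mulr0 expR0 mulr1.
rewrite E0.
have -> : (\int[mu]_(t in D) h t)%R = Gamma (a + 1) by rewrite GammaE.
have -> : (\int[mu]_(t in D) g t)%R = a * Gamma a.
  rewrite RintegralZl //; last exact: integrable_powR_expRN (ltW b0) ltr01.
  by rewrite -GammaE subrK.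
have dh x : 0 < x -> is_derive (x : R^o) 1 (h : R^o -> R^o) (g x - h x).
  by move=> x0; apply: is_derive_eq; first exact: is_derive_powR_expRN; rewrite mul1r.
have dg x : 0 < x -> derivable (g : R^o -> R^o) x 1.
  move=> x0; apply: (@derivableZ _ R^o R^o (fun t => t `^ (a - 1) * expR (- 1 * t)) a).
  by have k := is_derive_powR_expRN (a - 1) 1 x0; exact: ex_derive.
have de x : is_derive (x : R^o) 1 (e : R^o -> R^o) (- 2^-1 * e x).
  have k := is_derive_expRN 2^-1 x.
  rewrite /e (_ : (fun t => _) = K *: (fun t => expR (- 2^-1 * t) : R^o)) //.
  by apply: is_derive_eq; rewrite /GRing.scale /=; ring.
have h00 : h x @[x --> 0^'+] --> h 0.
  by rewrite {2}/h powR0 ?gt_eqF // mul0r; exact: cvg_powR_expRN0.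
have g00 : g x @[x --> 0^'+] --> g 0.
  rewrite {2}/g powR0 ?gt_eqF // mul0r mulr0 -[X in _ --> X](mulr0 a); apply: cvgMr.
  exact: cvg_powR_expRN0.
have e00 : e x @[x --> 0^'+] --> e 0.
  by apply: cvgMr; apply: cvg_at_right_filter; exact: continuous_expRN.
have hoo : h x @[x --> +oo] --> 0 by apply: cvg_powR_expRN; rewrite // ltW.
have eoo : e x @[x --> +oo] --> 0.
  by rewrite -(mulr0 K); apply: cvgMr; exact: cvg_expRN.
move=> H; suff : a * Gamma a - Gamma (a + 1) + 2 * K = - - (2 * K) by lra.
apply: H.
- move=> x; rewrite le_eqVlt => /orP[/eqP <-|x0].
    by rewrite /g /h /e !powR0 ?gt_eqF // !mul0r mulr0 subrr add0r mulr_ge0 ?expR_ge0 // ltW.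
  rewrite -addrA addr_ge0 // ?mulr_ge0 ?powR_ge0 ?expR_ge0 ?(ltW a0) //.
  by rewrite addrC subr_ge0 he.
- move=> x x0; apply: (@derivableD _ R^o R^o); last by have k := de x; exact: ex_derive.
  apply: (@derivableB _ R^o R^o); first exact: dg.
  by have k := dh x x0; exact: ex_derive.
- by apply: cvgD => //; apply: cvgB.
- by rewrite -[X in _ --> X](subr0 0) -[X in _ --> _ - X](mulr0 2); apply: cvgB => //; apply: cvgMr.
- move=> x x0; have k1 := dh x x0; have k2 := de x.
  rewrite (_ : (fun t => _) = h - 2 *: (e : R^o -> R^o)) //.
  by apply: is_derive_eq; rewrite /GRing.scale /=; field.
- by rewrite -E0; apply: cvgB => //; apply: cvgMr.
- by apply: (eq_integrable mD) (integrableD mD ghi ei).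
Qed.

(** The substitution x = M t in Euler's integral, multiplied through by M^(a + 1) to avoid a
    quotient. *)
Lemma Rintegral_powR_expRN a M : 0 < a -> 0 < M ->
  (\int[mu]_(t in D) (t `^ a * expR (- M * t)))%R = Gamma (a + 1) * M `^ (- (a + 1)).
Proof.
move=> a0 M0.
have i1 := integrable_powR_expRN (ltW a0) ltr01.
have iM := integrable_powR_expRN (ltW a0) M0.
pose G t := t `^ a * expR (- 1 * t).
pose F t := M * t.
have dF x : is_derive (x : R^o) 1 (F : R^o -> R^o) M.
  rewrite (_ : (F : R^o -> R^o) = M *: (id : R^o -> R^o)) //.
  by apply: is_derive_eq; rewrite /GRing.scale /= mulr1.
have F' : F^`() = cst M.
  by apply/funext => x; rewrite derive1E; have h := dF x; exact: derive_val.
have F0 : F 0 = 0 by rewrite /F mulr0.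
have cF : continuous F.
  move=> x; have h := dF x.
  by apply/differentiable_continuous/derivable1_diffP; exact: ex_derive.
have := @increasing_ge0_integration_by_substitutiony _ F G 0.
rewrite F' F0 => H.
have {}H : (\int[mu]_(x in `[0%R, +oo[) (G x)%:E = \int[mu]_(x in `[0%R, +oo[)
    (((G \o F) * (cst M : R -> R))%R x)%:E)%E.
  apply: H.
  - by move=> x y _ _ xy; rewrite /F ltr_pM2l.
  - by move=> x _; exact: cst_continuous.
  - exact: is_cvg_cst.
  - exact: is_cvg_cst.
  - split; first by move=> x _; have h := dF x; exact: ex_derive.
    by apply: cvg_at_right_filter; exact: cF.
  - exact: gt0_cvgMry.
  - apply/continuous_within_itvcyP; split.
      move=> x; rewrite in_itv /= andbT => x0.
      have h := is_derive_powR_expRN a 1 x0.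
      by apply/differentiable_continuous/derivable1_diffP; exact: ex_derive.
    by rewrite /G powR0 ?gt_eqF // mul0r; exact: cvg_powR_expRN0.
  - by move=> x _; rewrite mulr_ge0 ?powR_ge0 ?expR_ge0.
have Ma : M `^ (a + 1) != 0 by rewrite gt_eqF // powR_gt0.
have GF t : t \in D -> M `^ (a + 1) * (t `^ a * expR (- M * t)) = G (F t) * M.
  rewrite inE /= in_itv /= andbT => t0.
  rewrite /G /F powRM ?(ltW M0) ?(ltW t0) // powRD ?(gt_eqF M0) ?implybT //.
  by rewrite powRr1 ?(ltW M0) // mulN1r mulNr; ring.
have iGF : mu.-integrable D (EFin \o (fun t => G (F t) * M)).
  apply: (eq_integrable mD) (integrableZl mD (M `^ (a + 1)) iM) => // t tD /=.
  by rewrite -EFinM GF.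
have RH : (\int[mu]_(t in D) G t = \int[mu]_(t in D) (G (F t) * M))%R.
  by rewrite !Rintegral_itv_obnd_cbnd // /Rintegral H.
rewrite powRN; apply: (mulIf Ma); rewrite divfK // GammaE RH.
by rewrite mulrC -RintegralZl //; apply: eq_Rintegral => t /GF.
Qed.

(** With T = kappa t, Gamma(a + 1) is at least the integral of x^a exp(- x) over [T, oo[, which is
    at least T^a exp(- T). *)
Lemma powR_le_Gamma a kappa t : 0 <= a -> 0 < kappa -> 0 < t ->
  t `^ a <= Gamma (a + 1) * kappa `^ (- a) * expR (kappa * t).
Proof.
move=> a0 k0 t0; pose T := kappa * t.
have T0 : 0 < T by rewrite mulr_gt0.
have i1 := integrable_powR_expRN a0 ltr01.
suff h : T `^ a * expR (- T) <= Gamma (a + 1).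
  have ka : 0 < kappa `^ a by rewrite powR_gt0.
  rewrite powRN -/T mulrAC ler_pdivlMr // -powRM ?(ltW t0) ?(ltW k0) // mulrC -ler_pdivrMr.
    by rewrite -expRN.
  exact: expR_gt0.
have cE : continuous (fun x : R => expR (- 1 * x)) := @continuous_expRN 1.
have iT : (\int[mu]_(x in `[T, +oo[) (expR (- 1 * x))%:E = (expR (- T))%:E)%E.
  rewrite (@ge0_continuous_FTC2y _ _ (fun x => - expR (- 1 * x)) _ 0).
  - by rewrite sub0e mulN1r EFinN oppeK.
  - by move=> x _; exact: expR_ge0.
  - exact: continuous_subspaceT.
  - by rewrite -[X in _ --> X]oppr0; apply: cvgN; exact: cvg_expRN.
  - move=> x _; apply: (@derivableN _ R^o R^o).
    by have h := is_derive_expRN 1 x; exact: ex_derive.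
  - by apply: cvgN; apply: cvg_at_right_filter; exact: cE.
  - move=> x _; rewrite derive1E.
    have h := is_derive_expRN 1 x.
    have h' : is_derive (x : R^o) 1 (fun x => - expR (- 1 * x) : R^o) (expR (- 1 * x)).
      by apply: is_derive_eq; ring.
    exact: derive_val.
rewrite GammaE -lee_fin fineK ?integrable_fin_num // EFinM -iT.
have sub : `[T, +oo[ `<=` D.
  by move=> x; rewrite /= !in_itv /= !andbT; apply: lt_le_trans.
rewrite -ge0_integralZl //; last 2 first.
- apply/measurable_EFinP; apply: measurable_funTS; exact: continuous_measurable_fun.
- by rewrite lee_fin powR_ge0.
apply: (@le_trans _ _ (\int[mu]_(x in `[T, +oo[) (x `^ a * expR (- 1 * x))%:E)%E).
  apply: ge0_le_integral => //.
  - by move=> x _; rewrite -EFinM lee_fin mulr_ge0 ?powR_ge0 ?expR_ge0.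
  - apply/measurable_EFinP; apply: measurable_funM => //; apply: measurable_funTS.
    exact: continuous_measurable_fun.
  - apply/measurable_EFinP; apply: (measurable_funS mD sub).
    exact: measurable_powR_expRN.
  - move=> x; rewrite /= in_itv /= andbT => Tx; rewrite -EFinM lee_fin.
    rewrite ler_wpM2r ?expR_ge0 // ge0_ler_powR // nnegrE ltW //.
    exact: lt_le_trans Tx.
apply: ge0_subset_integral => //.
- by apply/measurable_EFinP; exact: measurable_powR_expRN.
- by move=> x _; rewrite lee_fin mulr_ge0 ?powR_ge0 ?expR_ge0.
Qed.

(** For kappa = t = 1, [powR_le_Gamma] reads 1 <= Gamma(a + 1) e. *)
Lemma Gamma_gt0 a : 0 <= a -> 0 < Gamma (a + 1) :> R.
Proof.
move=> a0; have := powR_le_Gamma a0 ltr01 ltr01.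
rewrite !powR1 !mulr1 => h; rewrite -(pmulr_lgt0 _ (expR_gt0 1)).
exact: lt_le_trans ltr01 h.
Qed.

End GammaLaplace.

(** * Rising factorials, finite differences and the transform of a power *)

Section PowerLaplace.
Variable R : realType.
Notation mu := (@lebesgue_measure R).
Notation D := (`]0, +oo[%classic : set R).
Implicit Types (a t x M : R) (s : R[i]) (N n j : nat).

Let mD : measurable (D : set (measurableTypeR R)).
Proof. by []. Qed.

Lemma pochhammerS x n : pochhammer x n.+1 = pochhammer x n * (x + n%:R).
Proof. by rewrite /pochhammer big_ord_recr. Qed.

Lemma pochhammer0 x : pochhammer x 0 = 1.
Proof. by rewrite /pochhammer big_ord0. Qed.

Lemma pochhammerSl x n : pochhammer x n.+1 = x * pochhammer (x + 1) n.
Proof.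
rewrite /pochhammer big_ord_recl addr0; congr (_ * _); apply: eq_bigr => i _.
by rewrite -addrA -natr1 (addrC 1).
Qed.

Lemma pochhammerD x n j : pochhammer x (n + j) = pochhammer x n * pochhammer (x + n%:R) j.
Proof.
elim: j => [|j IH]; first by rewrite addn0 pochhammer0 mulr1.
by rewrite addnS !pochhammerS IH natrD mulrA addrA.
Qed.

Lemma pochhammer_ge0 x n : 0 <= x -> 0 <= pochhammer x n.
Proof. by move=> x0; apply: prodr_ge0 => i _; rewrite addr_ge0. Qed.

Lemma ler_pochhammer x y n : 0 <= x -> x <= y -> pochhammer x n <= pochhammer y n.
Proof.
by move=> x0 xy; apply: ler_prod => i _; rewrite addr_ge0 //= lerD2r.
Qed.

Lemma pochhammer_nat N n : pochhammer (N.+1%:R : R) n * N`!%:R = (N + n)`!%:R.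
Proof.
elim: n => [|n IH]; first by rewrite pochhammer0 mul1r addn0.
by rewrite pochhammerS mulrAC IH addnS factS natrM -natrD addSn mulrC.
Qed.

Lemma bin_le_exp2 N n : ('C(N, n) <= 2 ^ N)%N.
Proof.
elim: N n => [|N IH] [|n]; rewrite ?bin0 ?expn_gt0 ?bin0n //.
by rewrite binS expnS mul2n -addnn leq_add.
Qed.

(** Rising factorials increase with x, and at x = N + 1 the coefficient is the binomial number C(N +
    n, n). *)
Lemma bcoef_nat_le x N n : 0 <= x -> x <= N.+1%:R -> bcoef x n <= 2 ^+ (N + n).
Proof.
move=> x0 xN; have nf : (0 : R) < n`!%:R by rewrite ltr0n fact_gt0.
have Nf : (0 : R) < N`!%:R by rewrite ltr0n fact_gt0.
apply: le_trans (_ : bcoef N.+1%:R n <= _).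
  by rewrite /bcoef ler_pM2r ?invr_gt0 // ler_pochhammer.
rewrite /bcoef -(ler_pM2r Nf) mulrAC pochhammer_nat.
have := @bin_fact (N + n) n (leq_addl _ _); rewrite addnK => <-.
rewrite mulnCA natrM mulrC mulKf ?gt_eqF // natrM ler_pM2r // -natrX ler_nat.
exact: bin_le_exp2.
Qed.

Lemma GammaD a n : 0 < a -> Gamma (a + n%:R + 1) = pochhammer (a + 1) n * Gamma (a + 1).
Proof.
move=> a0; elim: n => [|n IH]; first by rewrite addr0 pochhammer0 mul1r.
rewrite -natr1 addrA GammaS; last by rewrite ltrDr ltr_pwDl.
by rewrite IH pochhammerS mulrA; congr (_ * _); ring.
Qed.

(** Pascal's rule: up to sign, the difference of order N + 1 is the N-th difference of the first
    difference. *)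
Lemma alternating_binomial_sumS N (f : nat -> R) :
  \sum_(i < N.+2) (-1) ^+ i * 'C(N.+1, i)%:R * f i =
  \sum_(i < N.+1) (-1) ^+ i * 'C(N, i)%:R * (f i - f i.+1).
Proof.
have -> : \sum_(i < N.+1) (-1) ^+ i * 'C(N, i)%:R * (f i - f i.+1) =
    \sum_(i < N.+2) (-1) ^+ i * 'C(N, i)%:R * f i -
    \sum_(i < N.+1) (-1) ^+ i * 'C(N, i)%:R * f i.+1.
  rewrite [X in _ = X - _]big_ord_recr /= bin_small // mulr0 mul0r addr0 -sumrB.
  by apply: eq_bigr => i _; rewrite mulrBr.
rewrite big_ord_recl [X in _ = X - _]big_ord_recl /= !bin0 -addrA; congr (_ + _).
rewrite -sumrB; apply: eq_bigr => i _; rewrite /bump /= add1n binS natrD exprS; ring.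
Qed.

(* The N-th finite difference of a monic polynomial of degree N. *)
Lemma alternating_pochhammer_sum N x :
  \sum_(i < N.+1) (-1) ^+ i * 'C(N, i)%:R * pochhammer (x + i%:R) N = (-1) ^+ N * N`!%:R.
Proof.
elim: N x => [|N IH] x; first by rewrite big_ord1 bin0 pochhammer0 !mulr1.
rewrite (alternating_binomial_sumS N (fun i => pochhammer (x + i%:R) N.+1)).
have E (i : nat) : pochhammer (x + i%:R) N.+1 - pochhammer (x + i.+1%:R) N.+1 =
    - N.+1%:R * pochhammer (x + 1 + i%:R) N.
  rewrite pochhammerSl pochhammerS -[i.+1%:R]natr1 -[N.+1%:R]natr1.
  by rewrite (_ : x + i%:R + 1 = x + 1 + i%:R) 1?(_ : x + (i%:R + 1) = x + 1 + i%:R); ring.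
under eq_bigr do rewrite E mulrCA.
by rewrite -mulr_sumr IH factS natrM exprS; ring.
Qed.

Lemma has_laplace_powR_real a M : 0 < a -> 0 < M ->
  has_laplace (fun t => (t `^ a)%:C) M%:C (Gamma (a + 1) * M `^ (- (a + 1)))%:C.
Proof.
move=> a0 M0.
have E t : laplace_integrand (fun t => (t `^ a)%:C) M%:C t = (t `^ a * expR (- M * t))%:C.
  rewrite /laplace_integrand (_ : - M%:C * t%:C = (- M * t)%:C) ?cexpR -?rmorphM /=.
    by rewrite mulrC.
  by rewrite rmorphM rmorphN.
apply/has_laplaceE; split.
- split.
    apply: (eq_integrable mD) (integrable_powR_expRN (ltW a0) M0) => // t _.
    by rewrite E.
  by apply: (eq_integrable mD (cst 0%E)) => [t _|]; [rewrite E | exact: integrable0].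
- rewrite -(Rintegral_powR_expRN a0 M0).
  by apply: eq_Rintegral => t _; rewrite E.
- transitivity (\int[mu]_(t in D) (0 : R))%R; last by rewrite /Rintegral integral0.
  by apply: eq_Rintegral => t _; rewrite E.
Qed.

(* exp (- s t) is expanded around the real exponent M, chosen so large that s lies in
   the disc of radius M about M; the binomial series then sums the result. *)
Lemma has_laplace_powR a s : 0 < a -> 0 < Re s ->
  has_laplace (fun t => (t `^ a)%:C) s ((Gamma (a + 1))%:C * cpow s (- (a + 1))).
Proof.
move=> a0 s0; have ns := Re_gt0_neq0 s0.
(* For this M, |M - s|^2 = M^2 - 2 M Re s + |s|^2 = M^2 - |s|^2 < M^2. *)
pose M := cabs s ^+ 2 / Re s; pose d := M%:C - s.
have M0 : 0 < M by rewrite divr_gt0 ?exprn_gt0 ?cabs_gt0.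
have dM : cabs d < M.
  rewrite -(@ltr_pXn2r _ 2) ?nnegrE ?cabs_ge0 ?(ltW M0) //.
  have E : cabs s ^+ 2 = Re s ^+ 2 + Im s ^+ 2 by rewrite sqr_sqrtr ?addr_ge0 ?sqr_ge0.
  rewrite [X in X < _]sqr_sqrtr ?addr_ge0 ?sqr_ge0 // /d ReD ImD ReN ImN /= sub0r sqrrN.
  have MR : M * Re s = cabs s ^+ 2 by rewrite /M divfK // gt_eqF.
  have s2 : 0 < cabs s ^+ 2 by rewrite exprn_gt0 // cabs_gt0.
  rewrite [X in X < _](_ : _ = M ^+ 2 - 2 * (M * Re s) + (Re s ^+ 2 + Im s ^+ 2)).
    by rewrite MR -E; lra.
  by ring.
(* The room between |d| and M is shared out: t^l / l! <= k1^(-l) exp(k1 t) leaves the ratio |d| / k1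
   < 1, and exp(ep t) pays for t^a, while k1 + ep stays below M. *)
pose k1 := (cabs d + M) / 2; pose ep := (M - k1) / 2.
have d0 := cabs_ge0 d.
have [k10 dk1 k1M] : [/\ 0 < k1, cabs d < k1 & k1 < M] by rewrite /k1; split; lra.
have ep0 : 0 < ep by rewrite /ep; lra.
have [K K0 hK] := powR_le_expR (ltW a0) ep0.
pose f (l : nat) t : R[i] := (l`!%:R^-1)%:C * d ^+ l * (t `^ (a + l%:R))%:C.
have rho01 : 0 <= cabs d / k1 < 1 by rewrite divr_ge0 ?(ltW k10) // ltr_pdivrMr // mul1r.
have bd l t : 0 < t -> cabs (f l t) <= K * (cabs d / k1) ^+ l * expR ((k1 + ep) * t).
  move=> t0; rewrite /f !cabsM !cabsR cabsX.
  have lf : (0 : R) < l`!%:R by rewrite ltr0n fact_gt0.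
  rewrite ger0_norm ?invr_ge0 ?(ltW lf) // ger0_norm ?powR_ge0 //.
  rewrite powRD ?(gt_eqF t0) ?implybT // powR_mulrn ?(ltW t0) //.
  have tl : t ^+ l / l`!%:R <= k1 ^- l * expR (k1 * t).
    rewrite [leRHS]mulrC ler_pdivlMr ?exprn_gt0 // mulrAC -exprMn [t * _]mulrC.
    have X0 : 0 <= k1 * t by rewrite mulr_ge0 // ltW.
    move: (k1 * t) X0 => X X0; case: l {lf} => [|l].
      by rewrite expr0 fact0 divr1 -expR0 ler_expR.
    by apply: le_trans (expR_ge1Dxn l X0); rewrite lerDr.
  rewrite mulrDl expRD expr_div_n.
  rewrite [leLHS](_ : _ = cabs d ^+ l * (t `^ a * (t ^+ l / l`!%:R))); last by ring.
  rewrite [leRHS](_ : _ = cabs d ^+ l * ((K * expR (ep * t)) * (k1 ^- l * expR (k1 * t)))).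
    rewrite ler_wpM2l ?exprn_ge0 //; apply: ler_pM; rewrite ?powR_ge0 ?hK //.
    by rewrite divr_ge0 ?exprn_ge0 ?ltW.
  by ring.
have kM : k1 + ep < Re M%:C by rewrite /= /ep; lra.
have hl l : has_laplace (f l) M%:C ((l`!%:R^-1)%:C * d ^+ l *
    (Gamma (a + l%:R + 1) * M `^ (- (a + l%:R + 1)))%:C).
  by apply: has_laplaceZ; apply: has_laplace_powR_real; rewrite // ltr_pwDl.
have [L cL lL] := has_laplace_csum rho01 kM bd hl.
have fE t : 0 < t -> csum (fun l => f l t) = (t `^ a)%:C * cexp (d * t%:C).
  move=> t0; apply: csumE; apply: eq_has_csum (has_csumZ _ (cexp_series (d * t%:C))) => l.
  rewrite /f powRD ?(gt_eqF t0) ?implybT // powR_mulrn ?(ltW t0) // exprMn rmorphM.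
  by rewrite -rmorphXn /=; ring.
have -> : (Gamma (a + 1))%:C * cpow s (- (a + 1)) = L.
  apply: has_csum_unique cL.
  have dM1 : cabs (d / M%:C) < 1.
    by rewrite cabsM cabsV cabsR (gtr0_norm M0) ltr_pdivrMr // mul1r.
  have := has_csumZ ((Gamma (a + 1))%:C * (M `^ (- (a + 1)))%:C)
    (binomial_series (a + 1) dM1).
  have nM : M%:C != 0 :> R[i] by rewrite -cabs_gt0 cabsR gtr0_norm.
  (* The binomial series at d / M sums to a power of s / M; the power of M then cancels against the
     real transform. *)
  have E : 1 - d / M%:C = s * (M^-1)%:C.
    by rewrite /d fmorphV mulrBl divff // opprB addrCA subrr addr0.
  rewrite E cpowM ?invr_gt0 //= cpowR ?invr_gt0 // -[M^-1]powR_inv1 ?(ltW M0) // -powRrM.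
  have Mc : (M `^ (- (a + 1)))%:C * (M `^ (-1 * - (a + 1)))%:C = 1 :> R[i].
    by rewrite mulN1r -rmorphM /= -powRD ?(gt_eqF M0) ?implybT // addrN powRr0.
  rewrite mulrACA Mc mulr1.
  apply: eq_has_csum => l.
  have -> : M `^ (- (a + l%:R + 1)) = M `^ (- (a + 1)) * M ^- l.
    rewrite (_ : - (a + l%:R + 1) = - (a + 1) - l%:R); last by ring.
    by rewrite powRD ?(gt_eqF M0) ?implybT // powR_invn ?(ltW M0).
  clearbody M; rewrite GammaD // /bcoef expr_div_n !rmorphM /= !fmorphV !rmorphXn /=.
  by ring.
apply: eq_laplace_integrand lL => t t0; rewrite /laplace_integrand fE //.
rewrite mulrCA -cexpD mulrC; congr (cexp _ * _).
by rewrite /d; ring.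
Qed.

End PowerLaplace.

(** * The Laplace transform of a Bessel function *)

Section BesselLaplace.
Variable R : realType.
Implicit Types (nu t x z kappa : R) (s y : R[i]) (N n j : nat).

Definition bessel_term nu x j : R :=
  (-1) ^+ j / (j`!%:R * Gamma (j%:R + nu + 1)) * (x / 2) `^ (2 * j%:R + nu).

(** This is Gamma(2 j + nu + 1) / (j! Gamma(j + nu + 1)), the factor left of the j-th Bessel term
    after integration. *)
Definition bessel_coef nu j : R := bcoef (j%:R + nu + 1) j.

Lemma GammaD2 nu j : 0 < nu ->
  Gamma (2 * j%:R + nu + 1) = j`!%:R * bessel_coef nu j * Gamma (j%:R + nu + 1).
Proof.
move=> nu0; have jn : 0 < j%:R + nu :> R by rewrite ltr_wpDl.
have jf : j`!%:R != 0 :> R by rewrite pnatr_eq0 -lt0n fact_gt0.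
rewrite (_ : 2 * j%:R + nu = j%:R + nu + j%:R); last by ring.
by rewrite GammaD // /bessel_coef /bcoef mulrCA divff // mulr1.
Qed.

Lemma bessel_coef_ge0 nu j : 0 < nu -> 0 <= bessel_coef nu j.
Proof.
by move=> nu0; rewrite divr_ge0 ?pochhammer_ge0 ?addr_ge0 // ltW.
Qed.

(** The bound equals 2 times 2^(2 j + nu), so the powers of 2 cancel against those in (z / 2)^(2 j +
    nu). *)
Lemma bessel_coef_le nu j : 0 < nu -> bessel_coef nu j <= 2 * 2 `^ nu * 4 ^+ j.
Proof.
move=> nu0; pose N := Num.truncn nu.
have Nnu : nu <= N.+1%:R by rewrite ltW // truncnS_gt.
have Nle : N%:R <= nu by rewrite truncn_le // ltW.
apply: le_trans (@bcoef_nat_le _ _ (j + N).+1 j _ _) _.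
- by rewrite !addr_ge0 // ltW.
- by rewrite -[(j + N).+2%:R]natr1 lerD2r -addnS natrD lerD2l.
rewrite (_ : ((j + N).+1 + j = 1 + N + 2 * j)%N); last by lia.
have -> : (4 : R) = 2 ^+ 2 by rewrite -natrX.
rewrite 2!exprD expr1 exprM ler_wpM2r ?exprn_ge0 // ler_wpM2l //.
by rewrite -powR_mulrn // ler_powR // ler1n.
Qed.

Lemma powRV x (a : R) : 0 <= x -> x^-1 `^ a = (x `^ a)^-1.
Proof. by move=> x0; rewrite -(powR_inv1 x0) -powRrM mulN1r powRN. Qed.

(** [powR_le_Gamma] at the exponent 2 j + nu brings in Gamma(2 j + nu + 1), and its quotient by the
    denominator is [bessel_coef]. The order enters only through (z / kappa)^nu, which makes the
    bound summable over the growing orders of the kernel. *)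
Lemma bessel_term_le nu z kappa j t : 0 < nu -> 0 < z -> 0 < kappa -> 0 < t ->
  `|bessel_term nu (z * t) j| <=
  2 * (z / kappa) `^ nu * ((z / kappa) ^+ 2) ^+ j * expR (kappa * t).
Proof.
move=> nu0 z0 k0 t0.
have G0 : 0 < Gamma (j%:R + nu + 1) :> R by rewrite Gamma_gt0 // addr_ge0 // ltW.
have jf : 0 < j`!%:R :> R by rewrite ltr0n fact_gt0.
have e0 : 0 <= 2 * j%:R + nu by rewrite addr_ge0 ?mulr_ge0 // ltW.
rewrite /bessel_term !normrM normrX normrN1 expr1n mul1r normfV.
rewrite (gtr0_norm (mulr_gt0 jf G0)) (ger0_norm (powR_ge0 _ _)).
rewrite (_ : z * t / 2 = z / 2 * t); last by ring.
rewrite powRM ?divr_ge0 ?(ltW z0) ?(ltW t0) //.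
rewrite mulrC ler_pdivrMr ?mulr_gt0 //.
apply: le_trans (ler_wpM2l (powR_ge0 _ _) (powR_le_Gamma e0 k0 t0)) _.
rewrite GammaD2 //.
pose q := z / kappa; have q0 : 0 < q by rewrite divr_gt0.
pose T : R := 2 `^ nu * 4 ^+ j.
have T0 : 0 < T by rewrite mulr_gt0 ?powR_gt0 ?exprn_gt0.
have TE : T = 2 `^ (2 * j%:R + nu).
  rewrite powRD ?pnatr_eq0 ?implybT // powRrM powR_mulrn ?powR_ge0 //.
  by rewrite (_ : 2 `^ 2 = 4) 1?mulrC // (powR_mulrn 2) // -natrX.
have E1 : (z / 2) `^ (2 * j%:R + nu) * kappa `^ (- (2 * j%:R + nu)) =
    q `^ nu * (q ^+ 2) ^+ j / T.
  have -> : q `^ nu * (q ^+ 2) ^+ j = q `^ (2 * j%:R + nu).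
    rewrite -exprM -powR_mulrn ?(ltW q0) // natrM mulrC.
    by rewrite powRD ?(gt_eqF q0) ?implybT.
  rewrite TE powRN !powRM ?invr_ge0 ?(ltW z0) ?(ltW k0) //.
  by rewrite !powRV ?(ltW k0) // mulrAC.
have bT : bessel_coef nu j / T <= 2.
  by rewrite ler_pdivrMr // mulrA bessel_coef_le.
rewrite [leLHS](_ : _ = ((z / 2) `^ (2 * j%:R + nu) * kappa `^ (- (2 * j%:R + nu))) *
  (bessel_coef nu j * (expR (kappa * t) * (j`!%:R * Gamma (j%:R + nu + 1))))); last by ring.
rewrite E1 -/q.
set E := expR _ * _; have E0 : 0 <= E by rewrite mulr_ge0 ?expR_ge0 // (ltW (mulr_gt0 _ _)).
rewrite [leLHS](_ : _ = (bessel_coef nu j / T) * (q `^ nu * (q ^+ 2) ^+ j * E)); last by ring.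
rewrite [leRHS](_ : _ = 2 * (q `^ nu * (q ^+ 2) ^+ j * E)); last by rewrite /E; ring.
apply: ler_wpM2r bT; apply: mulr_ge0 => //; apply: mulr_ge0; first exact: powR_ge0.
by rewrite exprn_ge0 // exprn_ge0 // ltW.
Qed.

Lemma besselJE nu x : besselJ nu x = limn (series (bessel_term nu x)).
Proof. by []. Qed.

Lemma csum_real (u : nat -> R) l : has_csum (fun j => (u j)%:C) l ->
  l = (limn (series u))%:C.
Proof.
move=> [h1 h2]; apply: complex_ext => /=.
  by apply/esym/cvg_lim.
suff -> : Im l = limn (series (fun j => Im (u j)%:C : R)).
  apply: cvg_lim => //; rewrite (_ : series _ = cst 0); first exact: cvg_cst.
  by apply/funext => n; rewrite /series /= big1.
by apply/esym/cvg_lim.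
Qed.

Section Bessel.
Variables (nu z kappa : R).
Hypotheses (nu0 : 0 < nu) (z0 : 0 < z) (k0 : 0 < kappa) (zk : z / kappa <= 8^-1).

Let rho01 : 0 <= (z / kappa) ^+ 2 < 1.
Proof.
have q0 : 0 < z / kappa by rewrite divr_gt0.
rewrite exprn_ge0 ?(ltW q0) // exprn_ilt1 ?(ltW q0) //.
by rewrite (le_lt_trans zk) // invf_lt1 ?ltr1n.
Qed.

Lemma bessel_has_csum t : 0 < t ->
  has_csum (fun j => (bessel_term nu (z * t) j)%:C) (besselJ nu (z * t))%:C.
Proof.
move=> t0; have [j|l hl] := @geometric_has_csum _ (fun j => (bessel_term nu (z * t) j)%:C)
  (2 * (z / kappa) `^ nu * expR (kappa * t)) _ rho01.
  by rewrite cabsR mulrAC; apply: bessel_term_le.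
by rewrite besselJE -(csum_real hl).
Qed.

Lemma besselJ_le t : 0 < t ->
  `|besselJ nu (z * t)| <= 4 * (z / kappa) `^ nu * expR (kappa * t).
Proof.
move=> t0; rewrite -cabsR.
have /andP[r0 r1] := rho01.
have q0 : 0 < z / kappa by rewrite divr_gt0.
apply: le_trans (geometric_csum_le rho01 _ (bessel_has_csum t0)) _.
  by move=> j; rewrite cabsR; apply: le_trans (bessel_term_le j nu0 z0 k0 t0) _; rewrite mulrAC.
rewrite ler_pdivrMr ?subr_gt0 //.
have P : 0 <= (z / kappa) `^ nu * expR (kappa * t) by rewrite mulr_ge0 ?powR_ge0 ?expR_ge0.
move: (z / kappa) zk q0 P => q q8 q0; move: (q `^ nu) (expR _) => A E P.
(* The constant 4 bounds 2 / (1 - q^2). *)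
have h : q ^+ 2 <= 2^-1 by rewrite expr2; nra.
rewrite -subr_ge0 (_ : _ - _ = 4 * ((A * E) * (2^-1 - q ^+ 2))); last by field.
by rewrite mulr_ge0 // mulr_ge0 // subr_ge0.
Qed.

(** The two rising factorials are consecutive and join into one of length i + l. On a diagonal i + l
    = N it is thus a polynomial of degree N in i, weighted by C(N, i). *)
Lemma bessel_coef_bcoef i l :
  bessel_coef nu i * bcoef (2 * i%:R + nu + 1) l =
  'C(i + l, i)%:R * pochhammer (nu + 1 + i%:R) (i + l) / (i + l)`!%:R.
Proof.
have f0 (n : nat) : n`!%:R != 0 :> R by rewrite pnatr_eq0 -lt0n fact_gt0.
have c0 : 'C(i + l, i)%:R != 0 :> R by rewrite pnatr_eq0 -lt0n bin_gt0 leq_addr.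
have := bin_fact (leq_addr l i); rewrite addKn => <-.
rewrite pochhammerD (_ : nu + 1 + i%:R + i%:R = 2 * i%:R + nu + 1); last by ring.
rewrite /bessel_coef /bcoef (_ : i%:R + nu + 1 = nu + 1 + i%:R); last by ring.
by rewrite !natrM; field; rewrite !f0 c0.
Qed.

Lemma bessel_coef_diagonal N :
  \sum_(0 <= i < N.+1) (-1) ^+ i * (bessel_coef nu i * bcoef (2 * i%:R + nu + 1) (N - i))
  = (-1) ^+ N.
Proof.
have f0 : N`!%:R != 0 :> R by rewrite pnatr_eq0 -lt0n fact_gt0.
rewrite -[RHS](mulfK f0) -(alternating_pochhammer_sum N (nu + 1)) mulr_suml big_mkord.
apply: eq_bigr => i _; rewrite bessel_coef_bcoef subnKC -1?ltnS //.
by rewrite !mulrA.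
Qed.

Lemma bcoef2_le i l : bcoef (2 * i%:R + nu + 1) l <= 2 * 2 `^ nu * 4 ^+ i * 2 ^+ l.
Proof.
pose N := Num.truncn nu.
have Nnu : nu <= N.+1%:R by rewrite ltW // truncnS_gt.
have Nle : N%:R <= nu by rewrite truncn_le // ltW.
apply: le_trans (@bcoef_nat_le _ _ (2 * i + N).+1 l _ _) _.
- by rewrite !addr_ge0 ?mulr_ge0 // ltW.
- by rewrite -[(2 * i + N).+2%:R]natr1 lerD2r -addnS natrD natrM lerD2l.
rewrite (_ : ((2 * i + N).+1 + l = 1 + N + 2 * i + l)%N); last by lia.
have -> : (4 : R) = 2 ^+ 2 by rewrite -natrX.
rewrite 3!exprD expr1 exprM ler_wpM2r ?exprn_ge0 // ler_wpM2r ?exprn_ge0 //.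
by rewrite ler_wpM2l // -powR_mulrn // ler_powR // ler1n.
Qed.

(** By [bessel_coef_diagonal] the diagonal sums of the double series are (- y)^N, a geometric
    series. *)
Lemma bessel_generating y : cabs y <= 64^-1 ->
  has_csum (fun j => (-1) ^+ j * (bessel_coef nu j)%:C * y ^+ j
                       * cpow (1 - y) (- (2 * j%:R + nu + 1))) (1 + y)^-1.
Proof.
move=> y64; have y0 := cabs_ge0 y.
have y1 : cabs y < 1 by rewrite (le_lt_trans y64) // invf_lt1 ?ltr1n.
pose f i l : R[i] := (-1) ^+ i * (bessel_coef nu i)%:C * y ^+ i *
  ((bcoef (2 * i%:R + nu + 1) l)%:C * y ^+ l).
pose T j : R[i] := (-1) ^+ j * (bessel_coef nu j)%:C * y ^+ j
  * cpow (1 - y) (- (2 * j%:R + nu + 1)).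
pose P : R := 2 * 2 `^ nu.
have P0 : 0 <= P by rewrite mulr_ge0 ?powR_ge0.
have bc0 i l : 0 <= bcoef (2 * i%:R + nu + 1) l.
  by rewrite divr_ge0 ?pochhammer_ge0 ?addr_ge0 ?mulr_ge0 // ltW.
have h01 : 0 <= (2^-1 : R) < 1 by rewrite invr_ge0 ler0n invf_lt1 ?ltr1n.
(* The terms are at most P^2 (16 |y|)^i (2 |y|)^l; |y| <= 1 / 64 is what brings 16 |y| down to 1 /
   4, as [has_csum_diagonal] with rho = 1 / 2 demands. *)
have bd i l : cabs (f i l) <= P ^+ 2 * (2^-1 / 2) ^+ i * 2^-1 ^+ l.
  rewrite /f !cabsM !cabsX cabsN cabs1 expr1n mul1r !cabsR.
  rewrite (ger0_norm (bessel_coef_ge0 _ nu0)) (ger0_norm (bc0 _ _)).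
  rewrite [leLHS](_ : _ = (bessel_coef nu i * bcoef (2 * i%:R + nu + 1) l)
    * (cabs y ^+ i * cabs y ^+ l)); last by ring.
  apply: le_trans (_ : (P * 4 ^+ i) * (P * 4 ^+ i * 2 ^+ l) *
     (cabs y ^+ i * cabs y ^+ l) <= _).
    rewrite ler_wpM2r ?mulr_ge0 ?exprn_ge0 //.
    by apply: ler_pM; rewrite ?bessel_coef_ge0 ?bessel_coef_le ?bcoef2_le.
  rewrite [leLHS](_ : _ = P ^+ 2 * (4 * 4 * cabs y) ^+ i * (2 * cabs y) ^+ l); last first.
    by clearbody P; rewrite !exprMn; ring.
  have yi : (4 * 4 * cabs y) ^+ i <= (2^-1 / 2) ^+ i.
    by rewrite lerXn2r ?nnegrE ?mulr_ge0 ?invr_ge0 //; lra.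
  have yl : (2 * cabs y) ^+ l <= 2^-1 ^+ l.
    by rewrite lerXn2r ?nnegrE ?mulr_ge0 ?invr_ge0 //; lra.
  apply: ler_pM => //; rewrite ?mulr_ge0 ?exprn_ge0 ?mulr_ge0 //.
  by apply: ler_wpM2l yi; rewrite exprn_ge0.
have fT i : has_csum (f i) (T i).
  by apply: has_csumZ; apply: binomial_series.
have Tb i : cabs (T i) <= P ^+ 2 / (1 - 2^-1) * (2^-1 / 2) ^+ i.
  by rewrite mulrAC; apply: geometric_csum_le h01 (bd i) (fT i).
have [|S hS] := @geometric_has_csum _ T _ (2^-1 / 2) _ Tb.
  by rewrite divr_ge0 ?invr_ge0 //=; lra.
have dg := has_csum_diagonal h01 bd fT hS.
have y1' : 0 < Re (1 + y).
  rewrite ReD /=; have := ler_norm (- Re y); rewrite normrN.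
  by have := ler_Re_cabs y; lra.
suff -> : (1 + y)^-1 = S by [].
apply: has_csum_unique dg.
have gs : has_csum (fun N => (- y) ^+ N) (1 + y)^-1.
  have := @binomial_series _ 1 (- y); rewrite cabsN => /(_ y1).
  rewrite opprK cpowN ?Re_gt0_neq0 // cpowr1; apply: eq_has_csum => j.
  suff -> : bcoef 1 j = 1 :> R by rewrite mul1r.
  rewrite /bcoef; have := pochhammer_nat R 0 j; rewrite fact0 mulr1 add0n => ->.
  by rewrite divff // pnatr_eq0 -lt0n fact_gt0.
apply: eq_has_csum gs => N; rewrite -mulN1r exprMn.
have -> : (-1) ^+ N = ((-1) ^+ N)%:C :> R[i] by rewrite rmorphXn rmorphN1.
rewrite -bessel_coef_diagonal rmorph_sum mulr_suml !big_nat.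
apply: eq_bigr => i /andP[_ iN].
have -> : y ^+ N = y ^+ i * y ^+ (N - i) by rewrite -exprD subnKC.
rewrite /f !rmorphM rmorphXn rmorphN1 /=.
by ring.
Qed.

(* With v = s + r, the substitution s = v (1 - y) / 2, r = v (1 + y) / 2, where
   y = (z / v) ^ 2, reduces the transform to bessel_generating. *)
Lemma has_laplace_besselJ s : kappa < Re s ->
  has_laplace (fun t => (besselJ nu (z * t))%:C) s
   ((z `^ nu)%:C * cpow (s + cradius z s) (- nu) / cradius z s).
Proof.
move=> ks; have s0 : 0 < Re s by rewrite (lt_trans k0).
set r := cradius z s; set v := s + r.
have r0 : 0 < Re r := Re_cradius_gt0 z s0.
have v0 : Re s < Re v by rewrite ReD ltrDl.
have v0' : 0 < Re v by rewrite (lt_trans s0).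
have nv := Re_gt0_neq0 v0'; have nr := Re_gt0_neq0 r0.
pose q := z%:C / v; pose y := q ^+ 2.
(* This holds because |v| >= Re v > Re s > kappa. *)
have qb : cabs q <= 8^-1.
  rewrite /q cabsM cabsV cabsR (gtr0_norm z0); apply: le_trans zk.
  rewrite ler_wpM2l ?(ltW z0) // lef_pV2 ?posrE ?cabs_gt0 //.
  apply: le_trans (ltW ks) _; apply: le_trans (ltW v0) _.
  exact: le_trans (ler_norm _) (ler_Re_cabs _).
have y64 : cabs y <= 64^-1.
  rewrite /y cabsX; have q0 := cabs_ge0 q.
  by move: (cabs q) qb q0 => x x8 x0; rewrite expr2; nra.
have rr : r ^+ 2 = s ^+ 2 + z%:C ^+ 2 := cradius_sqr z s.
clearbody r.
have zz : z%:C ^+ 2 = v * (r - s).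
  have -> : v * (r - s) = r ^+ 2 - s ^+ 2 by rewrite /v; ring.
  by rewrite rr addrC addKr.
have yv : y * v = r - s.
  by rewrite /y /q expr_div_n zz; field.
have sE : s = v / 2 * (1 - y).
  by rewrite mulrBr mulrAC -[v / 2 * y]mulrAC [v * y]mulrC yv /v; field.
have rE : r = v * (1 + y) / 2.
  by rewrite mulrDr [v * y]mulrC yv /v; field.
(* Both factors of s = (v / 2) (1 - y) lie in the right half-plane, so [cpowM] splits the powers of
   s. *)
have y1' : 0 < Re (1 - y).
  rewrite ReD ReN /=; have := ler_norm (Re y).
  by have := ler_Re_cabs y; lra.
have ry : 0 < Re (v / 2).
  by rewrite (_ : v / 2 = v * (2^-1)%:C) ?ReM /= ?mulr0 ?subr0 ?divr_gt0 // fmorphV rmorph_nat.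
(* The part of each term that does not depend on j; the remaining powers of z and v form y^j. *)
pose cc : R[i] := ((z / 2) `^ nu)%:C * cpow (v / 2) (- (nu + 1)).
pose bb j : R[i] := ((-1) ^+ j / (j`!%:R * Gamma (j%:R + nu + 1)) * (z / 2) `^ (2 * j%:R + nu))%:C
  * ((Gamma (2 * j%:R + nu + 1))%:C * cpow s (- (2 * j%:R + nu + 1))).
have hb j : has_laplace (fun t => (bessel_term nu (z * t) j)%:C) s (bb j).
  have e0 : 0 < 2 * j%:R + nu by rewrite ltr_wpDl ?mulr_ge0.
  apply: eq_has_laplace (has_laplaceZ _ (has_laplace_powR e0 s0)) => t t0.
  rewrite -rmorphM /= /bessel_term (_ : z * t / 2 = z / 2 * t) ?powRM ?divr_ge0 ?(ltW z0) ?(ltW t0) //.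
    by rewrite !mulrA.
  by ring.
have bd j t : 0 < t -> cabs (bessel_term nu (z * t) j)%:C <=
    2 * (z / kappa) `^ nu * ((z / kappa) ^+ 2) ^+ j * expR (kappa * t).
  by move=> t0; rewrite cabsR; apply: bessel_term_le.
have [L hL lL] := has_laplace_csum rho01 ks bd hb.
have bE j : bb j = cc * ((-1) ^+ j * (bessel_coef nu j)%:C * y ^+ j
    * cpow (1 - y) (- (2 * j%:R + nu + 1))).
  have nvh := Re_gt0_neq0 ry.
  have G0 : Gamma (j%:R + nu + 1) != 0 :> R.
    by rewrite gt_eqF // Gamma_gt0 // addr_ge0 // ltW.
  have jf : j`!%:R != 0 :> R by rewrite pnatr_eq0 -lt0n fact_gt0.
  have z2 : z / 2 != 0 by rewrite gt_eqF // divr_gt0.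
  have -> : y ^+ j = (z / 2)%:C ^+ (2 * j) * cpow (v / 2) (- (2 * j)%:R).
    rewrite cpowN // cpow_nat -expr_div_n exprM; congr (_ ^+ j).
    by rewrite /y /q rmorphM fmorphV rmorph_nat; congr (_ ^+ 2); field.
  rewrite /bb /cc {1}sE cpowM //.
  have -> : - (2 * j%:R + nu + 1) = - (nu + 1) - (2 * j)%:R by rewrite natrM; ring.
  rewrite (cpowD _ _ nvh) GammaD2 //.
  rewrite (_ : 2 * j%:R + nu = nu + (2 * j)%:R); last by rewrite natrM; ring.
  rewrite powRD ?z2 ?implybT // powR_mulrn ?divr_ge0 ?(ltW z0) //.
  rewrite mulrA -rmorphM /=.
  have -> : (-1) ^+ j / (j`!%:R * Gamma (j%:R + nu + 1)) * ((z / 2) `^ nu * (z / 2) ^+ (2 * j))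
      * (j`!%:R * bessel_coef nu j * Gamma (j%:R + nu + 1)) =
      (-1) ^+ j * bessel_coef nu j * ((z / 2) `^ nu * (z / 2) ^+ (2 * j)).
    by move: (Gamma _) G0 (j`!%:R) jf => G G0 F F0; field; rewrite G0 F0.
  have gen (e a b c : R) : (e * a * (b * c))%:C = e%:C * a%:C * (b%:C * c%:C) :> R[i].
    by rewrite !rmorphM.
  rewrite gen 2!rmorphXn rmorphN1 /=.
  by move: ((z / 2)%:C ^+ _) => Z; ring.
have LE : L = cc * (1 + y)^-1.
  apply: has_csum_unique hL _.
  by apply: eq_has_csum (has_csumZ cc (bessel_generating y64)) => j; rewrite bE.
have -> : (z `^ nu)%:C * cpow v (- nu) / r = L.
  (* The halves in [cc] leave one factor 2, which r = v (1 + y) / 2 absorbs. *)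
  have h2 : (0 : R) < 2^-1 by rewrite invr_gt0.
  have p2 : (2^-1 `^ nu)%:C * (2^-1 `^ (- (nu + 1)))%:C = 2 :> R[i].
    rewrite -rmorphM /= -powRD ?(gt_eqF h2) ?implybT //.
    rewrite (_ : nu + - (nu + 1) = -1); last by ring.
    by rewrite powR_inv1 ?(ltW h2) // invrK rmorph_nat.
  have ny : 1 + y != 0 by apply: contraTneq r0 => y0; rewrite rE y0 mulr0 mul0r ltxx.
  have vh : v / 2 = v * (2^-1)%:C by rewrite fmorphV rmorph_nat.
  rewrite LE /cc vh cpowM // cpowR // powRM ?(ltW z0) ?(ltW h2) // rmorphM /=.
  rewrite (_ : cpow v (- (nu + 1)) = cpow v (- nu) / v); last first.
    by rewrite opprD cpowD // (cpowN 1 nv) cpowr1.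
  rewrite [RHS](_ : _ = (z `^ nu)%:C * ((2^-1 `^ nu)%:C * (2^-1 `^ (- (nu + 1)))%:C) *
    cpow v (- nu) / v / (1 + y)); last by ring.
  by rewrite p2 rE; field; rewrite ny nv.
apply: eq_has_laplace lL => t t0; apply: csumE; exact: bessel_has_csum.
Qed.

End Bessel.
End BesselLaplace.

(** * Gegenbauer polynomials: growth and generating functions *)

Section Gegenbauer.
Variable R : realType.
Implicit Types (lam x w : R) (u : R[i]) (j k l N : nat).

(** Coefficientwise, the derivative of (1 - v)^(-lam) is lam (1 - v)^(-(lam + 1)). *)
Lemma bcoefS_shift lam j : j.+1%:R * bcoef lam j.+1 = lam * bcoef (lam + 1) j.
Proof.
have f0 : j`!%:R != 0 :> R by rewrite pnatr_eq0 -lt0n fact_gt0.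
have j0 : j.+1%:R != 0 :> R by rewrite pnatr_eq0.
rewrite /bcoef pochhammerSl factS natrM.
by move: (j.+1%:R) j0 (j`!%:R) f0 => a a0 b b0; field; rewrite a0 b0.
Qed.

Lemma coef_linear_exp_le x j l : `|((x%:P - 'X) ^+ j)`_l| <= (1 + `|x|) ^+ j.
Proof.
elim: j l => [|j IH] l; first by rewrite !expr0 coef1; case: eqP; rewrite ?normr1 ?normr0.
rewrite exprS mulrBl coefB coefCM coefXM [leRHS]exprS.
have h i : `|((x%:P - 'X) ^+ j)`_i| <= (1 + `|x|) ^+ j := IH i.
apply: le_trans (ler_normB _ _) _; rewrite addrC mulrDl mul1r normrM lerD ?ler_wpM2l //.
by case: eqP => _; rewrite ?normr0 ?exprn_ge0 ?addr_ge0.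
Qed.

Let p w : {poly R} := (2 * w) *: 'X - 'X ^+ 2.

Let pE w : p w = ((2 * w)%:P - 'X) * 'X.
Proof. by rewrite /p -mul_polyC; ring. Qed.

Let coef_p w j k : ((p w) ^+ j)`_k = if (k < j)%N then 0 else (((2 * w)%:P - 'X) ^+ j)`_(k - j).
Proof. by rewrite pE exprMn coefMXn. Qed.

(** The j-th power of 2 w X - X^2 is divisible by X^j, so truncating the binomial series at any m >=
    k leaves the coefficient of X^k intact. *)
Lemma gegenbauerE lam w k m : (k <= m)%N ->
  (gegenbauer lam k).[w] =
  (\sum_(j < m.+1) bcoef lam j *: ((2 * w) *: 'X - 'X ^+ 2) ^+ j)`_k.
Proof.
move=> km; rewrite -gegenbauer_generating !coef_sum.
rewrite (big_ord_widen m.+1 (fun j => (pochhammer lam j / j`!%:R *: p w ^+ j)`_k)) ?ltnS //.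
rewrite big_mkcond; apply: eq_bigr => j _; case: ifP => // /negbT; rewrite -leqNgt => kj.
by rewrite coefZ coef_p kj mulr0.
Qed.

Lemma gegenbauer_sum lam w k : (gegenbauer lam k).[w] =
  \sum_(0 <= j < k.+1) bcoef lam j * (((2 * w)%:P - 'X) ^+ j)`_(k - j).
Proof.
rewrite (gegenbauerE _ _ (leqnn k)) coef_sum big_mkord; apply: eq_bigr => j _.
by rewrite coefZ coef_p ltnNge -ltnS ltn_ord.
Qed.

(** The X-derivative of the generating function, with inner derivative 2 w - 2 X, compared at X^k on
    truncated series. *)
Lemma gegenbauerS lam w k : k.+1%:R * (gegenbauer lam k.+1).[w] =
  lam * (2 * w * (gegenbauer (lam + 1) k).[w] -
         2 * (if k is k'.+1 then (gegenbauer (lam + 1) k').[w] else 0)).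
Proof.
rewrite (gegenbauerE lam w (leqnn k.+1)) mulr_natl -coef_deriv (raddf_sum (@deriv R)).
have dp : deriv (p w) = (2 * w)%:P - 'X *+ 2.
  by rewrite /p derivB derivZ derivX derivXn /= expr1 -mul_polyC mulr1.
have -> : \sum_(j < k.+2) deriv (bcoef lam j *: p w ^+ j) =
    lam *: (((2 * w)%:P - 'X *+ 2) * (\sum_(j < k.+1) bcoef (lam + 1) j *: p w ^+ j)).
  rewrite big_ord_recl derivZ expr0 derivC scaler0 add0r mulr_sumr scaler_sumr.
  apply: eq_bigr => j _; rewrite lift0 derivZ deriv_exp /= dp.
  rewrite -scaler_nat scalerA [_ * _%:R]mulrC bcoefS_shift -scalerA.
  by congr (_ *: _); rewrite scalerAr.
rewrite coefZ mulrBl coefB coefCM [('X *+ 2) * _]mulrnAl coefMn coefXM -[X in _ * (_ - X) = _]mulr_natl.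
congr (_ * (_ * _ - _ * _)); first by rewrite -gegenbauerE.
by case: k => [|k] //=; rewrite (@gegenbauerE _ _ k k.+1).
Qed.

Lemma bcoef_le lam j : 0 <= lam -> bcoef lam j <= 2 `^ lam * 2 ^+ j * 2.
Proof.
move=> l0; pose N := Num.truncn lam.
have lN : lam <= N.+1%:R by rewrite ltW // truncnS_gt.
have Nl : N%:R <= lam by rewrite truncn_le.
apply: le_trans (bcoef_nat_le j l0 lN) _.
have h : 2 ^+ N <= 2 `^ lam :> R by rewrite -powR_mulrn // ler_powR // ler1n.
rewrite exprD; apply: le_trans (ler_wpM2r (exprn_ge0 j _) h) _ => //.
by rewrite ler_peMr ?mulr_ge0 ?powR_ge0 ?exprn_ge0 // ler1n.
Qed.

(** Each of the k + 1 <= 2^k summands is at most 2 times 2^lam (2 A)^k. *)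
Lemma gegenbauer_le lam w k : 0 <= lam ->
  `|(gegenbauer lam k).[w]| <= 2 * 2 `^ lam * (4 * (1 + 2 * `|w|)) ^+ k.
Proof.
move=> l0; set A := 1 + 2 * `|w|; have A1 : 1 <= A by rewrite lerDl mulr_ge0.
have A0 := le_trans ler01 A1.
have P0 : (0 : R) <= 2 * 2 `^ lam by rewrite mulr_ge0 ?powR_ge0.
rewrite gegenbauer_sum; apply: le_trans (ler_norm_sum _ _ _) _.
apply: le_trans (_ : \sum_(0 <= j < k.+1) 2 * 2 `^ lam * (2 * A) ^+ k <= _).
  rewrite !big_nat; apply: ler_sum => j /andP[_ jk]; rewrite normrM.
  have b0 : 0 <= bcoef lam j by rewrite divr_ge0 ?pochhammer_ge0.
  rewrite (ger0_norm b0).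
  apply: le_trans (_ : 2 `^ lam * 2 ^+ j * 2 * A ^+ j <= _).
    apply: ler_pM => //; first exact: bcoef_le.
    by apply: le_trans (coef_linear_exp_le _ _ _) _; rewrite normrM ger0_norm.
  rewrite [leLHS](_ : _ = 2 * 2 `^ lam * (2 * A) ^+ j); last by rewrite exprMn; ring.
  rewrite ler_wpM2l // ler_weXn2l -1?ltnS //.
  by apply: le_trans A1 _; rewrite ler_peMl // ler1n.
rewrite sumr_const_nat subn0 -[leLHS]mulr_natr -[leLHS]mulrA ler_wpM2l //.
have -> : 4 * A = 2 * A * 2 by ring.
rewrite [leRHS]exprMn ler_wpM2l ?exprn_ge0 ?mulr_ge0 // -natrX ler_nat.
by rewrite ltn_expl.
Qed.

Section GeneratingFunction.
Variables (lam w : R) (u : R[i]).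
Hypotheses (lam0 : 0 <= lam) (u_small : cabs u * (1 + 2 * `|w|) <= 16^-1).

Let A := 1 + 2 * `|w|.

Let A1 : 1 <= A. Proof. by rewrite lerDl mulr_ge0. Qed.

Let uA : cabs u <= 16^-1.
Proof. by apply: le_trans u_small; rewrite ler_peMr ?cabs_ge0. Qed.

Let uw : cabs (u * (2 * w%:C - u)) <= 16^-1.
Proof.
apply: le_trans u_small; rewrite cabsM ler_wpM2l ?cabs_ge0 //.
apply: le_trans (cabsD _ _) _; rewrite cabsN cabsM cabsR addrC lerD //.
  by apply: le_trans uA _; rewrite invf_le1 ?ler1n.
by rewrite -(rmorph_nat (real_complex R) 2) cabsR normr_nat.
Qed.

Lemma gegenbauer_base_neq0 : 1 - 2 * w%:C * u + u ^+ 2 != 0.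
Proof.
have -> : 1 - 2 * w%:C * u + u ^+ 2 = 1 - u * (2 * w%:C - u) by ring.
apply: Re_gt0_neq0; rewrite ReD ReN /=.
have := ler_norm (Re (u * (2 * w%:C - u))).
have := ler_Re_cabs (u * (2 * w%:C - u)); move: uw.
by lra.
Qed.

(** The binomial series in u (2 w - u) has the finite expansions of (2 w - u)^j as rows, and its
    diagonals collect the powers of u. *)
Lemma gegenbauer_has_csum :
  has_csum (fun k => ((gegenbauer lam k).[w])%:C * u ^+ k)
    (cpow (1 - 2 * w%:C * u + u ^+ 2) (- lam)).
Proof.
pose e j l : R := (((2 * w)%:P - 'X) ^+ j)`_l.
pose f j l : R[i] := (bcoef lam j)%:C * u ^+ j * ((e j l)%:C * u ^+ l).
pose T j : R[i] := (bcoef lam j)%:C * (u * (2 * w%:C - u)) ^+ j.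
have h01 : 0 <= (2^-1 : R) < 1 by rewrite invr_ge0 ler0n invf_lt1 ?ltr1n.
have u0 := cabs_ge0 u.
have bd i l : cabs (f i l) <= 2 * 2 `^ lam * (2^-1 / 2) ^+ i * 2^-1 ^+ l.
  rewrite /f !cabsM !cabsX !cabsR.
  have b0 : 0 <= bcoef lam i by rewrite divr_ge0 ?pochhammer_ge0.
  rewrite (ger0_norm b0).
  apply: le_trans (_ : 2 `^ lam * 2 ^+ i * 2 * cabs u ^+ i * (A ^+ i * cabs u ^+ l) <= _).
    apply: ler_pM; [exact: mulr_ge0 b0 (exprn_ge0 _ u0)|exact: mulr_ge0 _ (exprn_ge0 _ u0)| |].
      by rewrite ler_wpM2r ?exprn_ge0 // bcoef_le.
    rewrite ler_wpM2r ?exprn_ge0 //; apply: le_trans (coef_linear_exp_le _ _ _) _.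
    by rewrite normrM ger0_norm.
  rewrite [leLHS](_ : _ = 2 * 2 `^ lam * (2 * (cabs u * A)) ^+ i * cabs u ^+ l); last first.
    by rewrite !exprMn; ring.
  have yi : (2 * (cabs u * A)) ^+ i <= (2^-1 / 2) ^+ i.
    rewrite lerXn2r ?nnegrE ?mulr_ge0 ?invr_ge0 ?(le_trans ler01 A1) //.
    by move: u_small; rewrite -/A; move: (cabs u * A) => a; lra.
  have yl : cabs u ^+ l <= 2^-1 ^+ l.
    by rewrite lerXn2r ?nnegrE ?invr_ge0 //; move: uA; lra.
  apply: ler_pM => //; rewrite ?mulr_ge0 ?exprn_ge0 ?mulr_ge0 ?powR_ge0 ?(le_trans ler01 A1) //.
  by apply: ler_wpM2l yi; rewrite mulr_ge0 ?powR_ge0.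
have fT i : has_csum (f i) (T i).
  rewrite /T exprMn mulrA; apply: has_csumZ.
  pose q : {poly R} := ((2 * w)%:P - 'X) ^+ i.
  have -> : (2 * w%:C - u) ^+ i = (map_poly (real_complex R) q).[u].
    rewrite /q rmorphXn rmorphB /= map_polyC map_polyX horner_exp hornerD hornerN hornerC hornerX.
    by rewrite /= rmorphM rmorph_nat.
  rewrite horner_coef size_map_poly -(big_mkord xpredT (fun l => (map_poly (real_complex R) q)`_l * u ^+ l)).
  under eq_bigr do rewrite coef_map.
  apply: has_csum_finite => l ql; rewrite /e -/q nth_default // mul0r //.
have uw1 : cabs (u * (2 * w%:C - u)) < 1.
  by apply: le_lt_trans uw _; rewrite invf_lt1 ?ltr1n.
have hS := binomial_series lam uw1.
have dg := has_csum_diagonal h01 bd fT hS.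
have -> : 1 - 2 * w%:C * u + u ^+ 2 = 1 - u * (2 * w%:C - u) by ring.
apply: eq_has_csum dg => k; rewrite gegenbauer_sum rmorph_sum mulr_suml !big_nat.
apply: eq_bigr => i /andP[_ ik].
have -> : u ^+ k = u ^+ i * u ^+ (k - i) by rewrite -exprD subnKC.
by rewrite /f mulrACA -rmorphM.
Qed.

End GeneratingFunction.

(** This is u times the u-derivative of the generating function; the recurrence [gegenbauerS]
    expresses it through the series of parameter lam + 1, without differentiating a sum. *)
Lemma gegenbauer_weighted_has_csum lam w u : 0 <= lam -> cabs u * (1 + 2 * `|w|) <= 16^-1 ->
  has_csum (fun k => (k%:R * (gegenbauer lam k).[w])%:C * u ^+ k)
    (2 * lam%:C * u * (w%:C - u) * cpow (1 - 2 * w%:C * u + u ^+ 2) (- (lam + 1))).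
Proof.
move=> l0 us; have l10 : 0 <= lam + 1 by rewrite addr_ge0.
have h := gegenbauer_has_csum l10 us; set g := cpow _ _ in h *.
have h1 := has_csum_shift (has_csumZ u h).
have h2 := has_csum_shift (has_csumZ u (has_csumD (has_csumZ (lam%:C * (2 * w%:C)) h)
  (has_csumZ (- (lam%:C * 2)) h1))).
have -> : 2 * lam%:C * u * (w%:C - u) * g =
  u * (lam%:C * (2 * w%:C) * g + - (lam%:C * 2) * (u * g)) by ring.
apply: eq_has_csum h2 => -[|k]; first by rewrite mul0r mul0r.
rewrite gegenbauerS exprS; case: k => [|k].
  by rewrite !(mulr0, subr0) !rmorphM rmorph_nat /=; ring.
by rewrite !(rmorphM, rmorphB, rmorph_nat) /= exprS; ring.
Qed.

End Gegenbauer.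

(** * Series of Bessel functions as power series in u *)

Section BesselSeriesLaplace.
Variable R : realType.
Variables (z kappa M : R) (n : nat).
Hypotheses (z0 : 0 < z) (k0 : 0 < kappa) (n0 : (0 < n)%N).
Hypotheses (zk : z / kappa <= 8^-1) (M0 : 0 <= M) (zM : z / kappa * M <= 2^-1).

(** The factor (-i)^(k n) and the factor (z / v)^(n k) from the order n k + nu multiply to u^k.
    Since n >= 1, the growth M^k of the coefficients is beaten by (z / kappa)^(n k). *)
Lemma has_laplace_bessel_series (nu B : R) (c : nat -> R) (s G : R[i]) :
  0 < nu -> kappa < Re s -> (forall k, `|c k| <= B * M ^+ k) ->
  has_csum (fun k => (c k)%:C * (((- 'i%C * z%:C) / (s + cradius z s)) ^+ n) ^+ k) G ->
  has_laplace (fun t => csum (fun k => (c k)%:C * (- 'i%C) ^+ (k * n)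
      * (besselJ (n%:R * k%:R + nu) (z * t))%:C)) s
    ((z `^ nu)%:C * cpow (s + cradius z s) (- nu) / cradius z s * G).
Proof.
move=> nu0 ks cB hG; have s0 : 0 < Re s by rewrite (lt_trans k0).
have q0 : 0 < z / kappa by rewrite divr_gt0.
have nuk k : 0 < n%:R * k%:R + nu by rewrite ltr_wpDl ?mulr_ge0.
have nv : s + cradius z s != 0.
  by apply: Re_gt0_neq0; rewrite ReD addr_gt0 // Re_cradius_gt0.
have h01 : 0 <= (2^-1 : R) < 1 by rewrite invr_ge0 ler0n invf_lt1 ?ltr1n.
have B0 : 0 <= B by have := cB 0%N; rewrite expr0 mulr1; apply: le_trans.
have bd k t : 0 < t -> cabs ((c k)%:C * (- 'i%C) ^+ (k * n)
      * (besselJ (n%:R * k%:R + nu) (z * t))%:C) <=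
    B * (4 * (z / kappa) `^ nu) * 2^-1 ^+ k * expR (kappa * t).
  move=> t0; rewrite !cabsM cabsX cabsN cabs_i expr1n mulr1 !cabsR.
  apply: le_trans (ler_pM _ _ (cB k) (besselJ_le (nuk k) z0 k0 zk t0)) _ => //.
  rewrite powRD ?(gt_eqF q0) ?implybT // -natrM powR_mulrn ?(ltW q0) // exprM.
  have h : M ^+ k * (z / kappa) ^+ n ^+ k <= 2^-1 ^+ k.
    rewrite -exprMn lerXn2r ?nnegrE ?mulr_ge0 ?exprn_ge0 ?invr_ge0 ?(ltW q0) //.
    apply: le_trans zM; rewrite mulrC ler_wpM2r // -(prednK n0) exprS.
    rewrite ler_piMr ?(ltW q0) // exprn_ile1 ?(ltW q0) // (le_trans zk) //.
    by rewrite invf_le1 ?ler1n.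
  rewrite [leLHS](_ : _ = B * (4 * (z / kappa) `^ nu) * (M ^+ k * (z / kappa) ^+ n ^+ k)
    * expR (kappa * t)); last by ring.
  by rewrite ler_wpM2r ?expR_ge0 // ler_wpM2l // !mulr_ge0 ?powR_ge0.
have hl k := has_laplaceZ ((c k)%:C * (- 'i%C) ^+ (k * n))
  (has_laplace_besselJ (nuk k) z0 k0 zk ks).
have [L hL lL] := has_laplace_csum h01 ks bd hl.
suff -> : (z `^ nu)%:C * cpow (s + cradius z s) (- nu) / cradius z s * G = L by [].
apply: has_csum_unique hL; apply: eq_has_csum (has_csumZ _ hG) => k.
rewrite opprD (cpowD _ _ nv) (cpowN (n%:R * k%:R) nv) -natrM cpow_nat powRD ?(gt_eqF z0) ?implybT //.
rewrite powR_mulrn ?(ltW z0) // -exprM expr_div_n exprMn rmorphM rmorphXn (mulnC k).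
by move: (cpow _ _) (_ ^+ (n * k)) => a b; ring.
Qed.

End BesselSeriesLaplace.

(** * The transforms of the scalar and bivector parts *)

(** The non-rational quantities become letters: Z = z^(n lam), a = z^nt, b = v^nt, V = v^(-n lam), e
    = (-1)^nt, and g is the power -(lam + 1) of 1 - 2 w u + u^2. The numerators 1 - u^2 of the
    weighted sums and 1 - 2 w u + u^2 of the plain ones have half sum 1 - w u and half difference w
    u - u^2. *)
Lemma kernel_scal_identity (R : realType) (Z a b e z w v V g r l u : R[i]) :
  Z != 0 -> a != 0 -> b != 0 -> v != 0 -> V != 0 -> g != 0 -> r != 0 -> l != 0 ->
  e ^+ 2 = 1 -> u = - (e * 'i%C * (a ^+ 2 * z) / (b ^+ 2 * v)) ->
  (2 * l)^-1 * (Z * a)^-1 * (Z * a * (V * b^-1) / r * (l * (1 - u ^+ 2) * g) +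
      e * (Z * a^-1 * (V * b) / r * (l * (1 - u ^+ 2) * g))) +
  2^-1 * (Z * a)^-1 * (Z * a * (V * b^-1) / r * (g * (1 - 2 * w * u + u ^+ 2)) +
      - e * (Z * a^-1 * (V * b) / r * (g * (1 - 2 * w * u + u ^+ 2)))) =
  1 / r * ((b * v + e * (a ^+ 2 * z ^+ 2 / (b * v))) / (b ^+ 2 * v / (V * g)))
    + 'i%C * w * z / r * ((e * (a ^+ 2 / b) - b) / (b ^+ 2 * v / (V * g))).
Proof.
move=> Z0 a0 b0 v0 V0 g0 r0 l0 e2 uE.
have I2 : 'i%C * 'i%C = -1 :> R[i] by rewrite -expr2 sqr_i.
(* The relations i^2 = -1 and e^2 = 1 are spent by hand, since [field] sees free letters; the sign e
   is finally split into its two values. *)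
have uu : u ^+ 2 = - (a ^+ 2 * z / (b ^+ 2 * v)) ^+ 2.
  rewrite uE sqrrN [LHS](_ : _ = e ^+ 2 * ('i%C * 'i%C) * (a ^+ 2 * z / (b ^+ 2 * v)) ^+ 2).
    by rewrite e2 I2 mul1r mulN1r.
  by field; rewrite ?b0 ?v0.
transitivity (V * g / r * ((1 - w * u) / b + e * b / a ^+ 2 * (u * w - u ^+ 2))).
  by field; rewrite ?Z0 ?a0 ?b0 ?r0 ?l0 ?pnatr_eq0.
rewrite uu uE; move/eqP: e2; rewrite sqrf_eq1 => /orP[] /eqP ->.
  by field; rewrite ?a0 ?b0 ?r0 ?v0 ?V0 ?g0 ?pnatr_eq0.
by field; rewrite ?a0 ?b0 ?r0 ?v0 ?V0 ?g0 ?pnatr_eq0.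
Qed.

Section KernelLaplace.
Variable R : realType.
Variables (lam z w kappa : R) (nt : nat).
Let n := (2 * nt + 1)%N.
Hypotheses (z0 : 0 < z) (k0 : 0 < kappa) (lam_ge : 2^-1 <= lam).
Hypothesis zk : z / kappa * (16 * (1 + 2 * `|w|)) <= 1.
Variable s : R[i].
Hypothesis ks : kappa < Re s.

Let A := 1 + 2 * `|w|.
Let r := cradius z s.
Let v := s + r.
Let u := ((- 'i%C * z%:C) / v) ^+ n.
Let g := cpow (1 - 2 * w%:C * u + u ^+ 2) (- (lam + 1)).

Let A1 : 1 <= A. Proof. by rewrite lerDl mulr_ge0. Qed.
Let n0 : (0 < n)%N. Proof. by rewrite /n addn1. Qed.
Let lam0 : 0 < lam. Proof. by apply: lt_le_trans lam_ge; rewrite invr_gt0. Qed.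
Let s0 : 0 < Re s. Proof. exact: lt_trans ks. Qed.
Let q0 : 0 < z / kappa. Proof. by rewrite divr_gt0. Qed.

Let qA : z / kappa * A <= 16^-1.
Proof. by move: zk; rewrite -/A; lra. Qed.

Let q8 : z / kappa <= 8^-1.
Proof.
apply: (le_trans (y := z / kappa * A)); first by rewrite ler_peMr // ltW.
by apply: le_trans qA _; rewrite lef_pV2 ?posrE ?ler_nat.
Qed.

Let zM : z / kappa * (8 * A) <= 2^-1.
Proof. by move: qA; lra. Qed.

Let M0 : 0 <= 8 * A. Proof. by rewrite mulr_ge0 ?(le_trans ler01 A1). Qed.

Let rpos : 0 < Re r. Proof. exact: Re_cradius_gt0. Qed.
Let nr : r != 0. Proof. exact: Re_gt0_neq0 rpos. Qed.
Let vpos : Re s < Re v. Proof. by rewrite ReD ltrDl. Qed.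
Let nv : v != 0. Proof. by apply: Re_gt0_neq0; apply: lt_trans vpos. Qed.

Let uA : cabs u * A <= 16^-1.
Proof.
apply: le_trans qA; rewrite ler_wpM2r ?(le_trans ler01 A1) //.
rewrite /u cabsX !cabsM cabsN cabs_i mul1r cabsV cabsR (gtr0_norm z0).
have zv : z / cabs v <= z / kappa.
  rewrite ler_wpM2l ?(ltW z0) // lef_pV2 ?posrE ?cabs_gt0 //.
  apply: le_trans (ltW ks) _; apply: le_trans (ltW vpos) _.
  exact: le_trans (ler_norm _) (ler_Re_cabs _).
have zv0 : 0 <= z / cabs v by rewrite divr_ge0 ?(ltW z0) ?cabs_ge0.
apply: (le_trans _ zv); rewrite -(prednK n0) exprS ler_piMr // exprn_ile1 //.
by apply: (le_trans zv); apply: (le_trans q8); rewrite invf_le1 ?ler1n.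
Qed.

Let gcs l (l0 : 0 <= l) := gegenbauer_has_csum l0 uA.

(** Puts the unweighted sums over the power -(lam + 1) that the weighted ones carry. *)
Let cpow_base : cpow (1 - 2 * w%:C * u + u ^+ 2) (- lam) =
  g * (1 - 2 * w%:C * u + u ^+ 2).
Proof.
rewrite -[X in _ = _ * X]cpowr1 /g -cpowD; last exact: gegenbauer_base_neq0 uA.
by congr cpow; ring.
Qed.

Let gb l : 0 <= l -> exists B, forall k, `|(gegenbauer l k).[w]| <= B * (8 * A) ^+ k.
Proof.
move=> l0; exists (2 * 2 `^ l) => k; apply: le_trans (gegenbauer_le w k l0) _.
rewrite ler_wpM2l ?mulr_ge0 ?powR_ge0 // lerXn2r ?nnegrE ?mulr_ge0 ?(le_trans ler01 A1) //.
by rewrite ler_wpM2r ?(le_trans ler01 A1) // ler_nat.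
Qed.

(** The weight k + lam costs a factor 2^k; this is why the common growth rate is 8 A although the
    polynomials alone grow like (4 A)^k. *)
Let gbk : exists B, forall k, `|(k%:R + lam) * (gegenbauer lam k).[w]| <= B * (8 * A) ^+ k.
Proof.
exists ((1 + lam) * (2 * 2 `^ lam)) => k.
have -> : 8 * A = 2 * (4 * A) by ring.
rewrite exprMn mulrACA normrM; apply: ler_pM => //; last exact: gegenbauer_le (ltW lam0).
rewrite ger0_norm ?addr_ge0 ?(ltW lam0) // mulrDl mul1r lerD //.
  by rewrite -natrX ler_nat ltnW // ltn_expl.
by rewrite ler_peMr ?(ltW lam0) // exprn_ege1 // ler1n.
Qed.

Let bessel_sum (nu B : R) (c : nat -> R) (G : R[i]) : 0 < nu ->
  (forall k, `|c k| <= B * (8 * A) ^+ k) -> has_csum (fun k => (c k)%:C * u ^+ k) G ->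
  has_laplace (fun t => csum (fun k => (c k)%:C * (- 'i%C) ^+ (k * n)
      * (besselJ (n%:R * k%:R + nu) (z * t))%:C)) s
    ((z `^ nu)%:C * cpow v (- nu) / r * G).
Proof.
move=> nu0 hB; exact: (has_laplace_bessel_series z0 k0 n0 q8 M0 zM nu0 ks hB).
Qed.

(** The order is a variable function [ord] so that the kernel's own bracketing of the order matches
    without rewriting under the sum. *)
Lemma has_laplace_gegenbauer l nu (ord : nat -> R) : 0 < l -> 0 < nu ->
  (forall k, ord k = n%:R * k%:R + nu) ->
  has_laplace (fun t => csum (fun k => (- 'i%C) ^+ (k * n)
      * (besselJ (ord k) (z * t))%:C * ((gegenbauer l k).[w])%:C)) s
    ((z `^ nu)%:C * cpow v (- nu) / r * cpow (1 - 2 * w%:C * u + u ^+ 2) (- l)).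
Proof.
move=> l0 nu0 ordE; have [B hB] := gb (ltW l0).
apply: eq_has_laplace (bessel_sum nu0 hB (gcs (ltW l0))) => t _.
by congr csum; apply/funext => k; rewrite ordE; ring.
Qed.

Lemma has_laplace_gegenbauer_weighted nu (ord : nat -> R) : 0 < nu ->
  (forall k, ord k = n%:R * k%:R + nu) ->
  has_laplace (fun t => csum (fun k => (k%:R + lam)%:C * (- 'i%C) ^+ (k * n)
      * (besselJ (ord k) (z * t))%:C * ((gegenbauer lam k).[w])%:C)) s
    ((z `^ nu)%:C * cpow v (- nu) / r * (lam%:C * (1 - u ^+ 2) * g)).
Proof.
move=> nu0 ordE; have [B hB] := gbk.
have cs : has_csum (fun k => ((k%:R + lam) * (gegenbauer lam k).[w])%:C * u ^+ k)
    (lam%:C * (1 - u ^+ 2) * g).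
  have := has_csumD (gegenbauer_weighted_has_csum (ltW lam0) uA)
    (has_csumZ lam%:C (gcs (ltW lam0))).
  rewrite -/g cpow_base (_ : _ + _ = lam%:C * (1 - u ^+ 2) * g); last by ring.
  by apply: eq_has_csum => k; rewrite !rmorphM rmorphD; ring.
apply: eq_has_laplace (bessel_sum nu0 hB cs) => t _.
by congr csum; apply/funext => k; rewrite ordE rmorphM; ring.
Qed.

Let cnv p : cpow v (- (n%:R * lam + p)) = cpow v (- (n%:R * lam)) * cpow v (- p).
Proof. by rewrite opprD (cpowD _ _ nv). Qed.

Let znv p : (z `^ (n%:R * lam + p))%:C = (z `^ (n%:R * lam))%:C * (z `^ p)%:C :> R[i].
Proof. by rewrite powRD ?(gt_eqF z0) ?implybT // rmorphM. Qed.

Let sgn_exp (a : R[i]) : a ^+ 2 = -1 -> a ^+ n = (-1) ^+ nt * a.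
Proof. by move=> a2; rewrite /n exprD expr1 exprM a2. Qed.

Let rs_v : r - s = z%:C ^+ 2 / v.
Proof.
apply: (canRL (mulfK nv)); rewrite (_ : _ * v = r ^+ 2 - s ^+ 2); last by rewrite /v; ring.
by rewrite (cradius_sqr z s) addrC addKr.
Qed.

Let V := cpow v (- (n%:R * lam)).
Let a : R[i] := z%:C ^+ nt.
Let b : R[i] := v ^+ nt.
Let e : R[i] := (-1) ^+ nt.

Let expn_n (x : R[i]) : x ^+ n = (x ^+ nt) ^+ 2 * x.
Proof. by rewrite /n exprD expr1 mulnC exprM. Qed.

Let uE : u = - (e * 'i%C * (a ^+ 2 * z%:C) / (b ^+ 2 * v)).
Proof.
rewrite /u expr_div_n exprMn sgn_exp ?sqrrN ?sqr_i // -/e !expn_n -/a -/b.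
by rewrite mulrN !mulNr.
Qed.

Let nz : z%:C != 0 :> R[i]. Proof. by rewrite -cabs_gt0 cabsR gtr0_norm. Qed.
Let na : a != 0. Proof. by rewrite expf_neq0. Qed.
Let nb : b != 0. Proof. by rewrite expf_neq0. Qed.
Let nV : V != 0. Proof. exact: cpow_neq0. Qed.
Let Z0 : (z `^ (n%:R * lam))%:C != 0 :> R[i].
Proof. by rewrite -cabs_gt0 cabsR gtr0_norm ?powR_gt0. Qed.
Let e2 : e ^+ 2 = 1. Proof. exact: sqrr_sign. Qed.

Let DE : den_pow n z w (lam + 1) s = b ^+ 2 * v / (V * g).
Proof.
rewrite /den_pow -/r -/v -/u.
have nP : 1 - 2 * w%:C * u + u ^+ 2 != 0 := gegenbauer_base_neq0 uA.
have -> : n%:R * (lam + 1) = n%:R * lam + n%:R by ring.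
rewrite (cpowD _ _ nv) cpow_nat /V /g (cpowN _ nv) (cpowN _ nP) invfM !invrK expn_n -/b.
by ring.
Qed.

Let cpowNn k : cpow v (- k%:R) = (v ^+ k)^-1.
Proof. by rewrite cpowN // cpow_nat. Qed.

Let ng : g != 0. Proof. exact: cpow_neq0 (gegenbauer_base_neq0 uA). Qed.

Let scal_target :
  1 / r * (((s + r) ^+ (nt + 1) + (-1) ^+ nt * (r - s) ^+ (nt + 1))
      / den_pow n z w (lam + 1) s)
   + 'i%C * w%:C * z%:C / r * (((-1) ^+ nt * (r - s) ^+ nt - (s + r) ^+ nt)
      / den_pow n z w (lam + 1) s) =
  1 / r * ((b * v + e * (a ^+ 2 * z%:C ^+ 2 / (b * v))) / (b ^+ 2 * v / (V * g)))
    + 'i%C * w%:C * z%:C / r * ((e * (a ^+ 2 / b) - b) / (b ^+ 2 * v / (V * g))).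
Proof.
have h1 : (r - s) ^+ nt = a ^+ 2 / b.
  by rewrite rs_v expr_div_n exprAC.
have h2 : (r - s) ^+ (nt + 1) = a ^+ 2 * z%:C ^+ 2 / (b * v).
  by rewrite addn1 exprSr h1 rs_v mulf_div.
have h3 : (s + r) ^+ (nt + 1) = b * v by rewrite addn1 exprSr.
by rewrite DE h1 h2 h3.
Qed.

Let cv1 : cpow v (- (n%:R * lam + nt%:R)) = V * b^-1.
Proof. by rewrite cnv cpowNn. Qed.

Let cv2 : cpow v (- (n%:R * lam - nt%:R)) = V * b.
Proof. by rewrite cnv opprK (cpow_nat v nt). Qed.

Let zp : (z `^ nt%:R)%:C = a :> R[i].
Proof. by rewrite powR_mulrn ?(ltW z0) // rmorphXn. Qed.

Let zz1 : (z `^ (n%:R * lam + nt%:R))%:C = (z `^ (n%:R * lam))%:C * a :> R[i].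
Proof. by rewrite znv zp. Qed.

Let zz2 : (z `^ (n%:R * lam - nt%:R))%:C = (z `^ (n%:R * lam))%:C * a^-1 :> R[i].
Proof. by rewrite znv powR_invn ?(ltW z0) // fmorphV rmorphXn. Qed.

Let nl : lam%:C != 0 :> R[i].
Proof. by rewrite -cabs_gt0 cabsR gtr0_norm ?lam0. Qed.

Let c1E : (1 / (2 * lam) * z `^ (- (n%:R * lam + nt%:R)))%:C =
  (2 * lam%:C)^-1 * ((z `^ (n%:R * lam))%:C * a)^-1 :> R[i].
Proof. by rewrite powRN mul1r rmorphM !fmorphV /= zz1 rmorphM rmorph_nat. Qed.

Let c2E : (1 / 2 * z `^ (- (n%:R * lam + nt%:R)))%:C =
  2^-1 * ((z `^ (n%:R * lam))%:C * a)^-1 :> R[i].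
Proof. by rewrite powRN mul1r rmorphM !fmorphV /= zz1 rmorph_nat. Qed.

Let i_n : 'i%C ^+ (n - 1) = e :> R[i].
Proof. by rewrite /n addnK exprM sqr_i. Qed.

(** From lam >= 1 / 2 the lowest order is at least (2 nt + 1) / 2 - nt = 1 / 2; the transform of a
    Bessel function was obtained for positive orders. *)
Let nlam_nt : 0 < n%:R * lam - nt%:R.
Proof.
rewrite subr_gt0; apply: lt_le_trans (ler_wpM2l (ler0n _ _) lam_ge).
by rewrite /n natrD natrM mulrDl mulrAC divff ?pnatr_eq0 // mul1r ltrDl mul1r invr_gt0.
Qed.

Lemma has_laplace_scal :
  has_laplace (fun t => (1 / (2 * lam) * z `^ (- (n%:R * lam + nt%:R)))%:C
      * series_A lam z w n nt t
    + (1 / 2 * z `^ (- (n%:R * lam + nt%:R)))%:C * series_B lam z w n nt t) s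
  (1 / r * (((s + r) ^+ (nt + 1) + (-1) ^+ nt * (r - s) ^+ (nt + 1))
      / den_pow n z w (lam + 1) s)
   + 'i%C * w%:C * z%:C / r * (((-1) ^+ nt * (r - s) ^+ nt - (s + r) ^+ nt)
      / den_pow n z w (lam + 1) s)).
Proof.
have l0 := lam0.
have p1 : 0 < n%:R * lam + nt%:R by rewrite ltr_wpDr // mulr_gt0 // ltr0n.
have o1 k : n%:R * k%:R + n%:R * lam + nt%:R = n%:R * k%:R + (n%:R * lam + nt%:R).
  by rewrite addrA.
have o2 k : n%:R * k%:R + n%:R * lam - nt%:R = n%:R * k%:R + (n%:R * lam - nt%:R).
  by rewrite addrA.
(* The closed form is rewritten backwards into the very expression that linearity produces from the
   four sums. *)
rewrite scal_target -(kernel_scal_identity w%:C Z0 na nb nv nV ng nr nl e2 uE).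
rewrite -c1E -c2E -cv1 -cv2 -zz1 -zz2 -cpow_base -i_n.
apply: has_laplaceD; apply: has_laplaceZ; apply: has_laplaceD.
- exact: has_laplace_gegenbauer_weighted p1 o1.
- by apply: has_laplaceZ; exact: has_laplace_gegenbauer_weighted nlam_nt o2.
- exact: has_laplace_gegenbauer l0 p1 o1.
- under eq_fun do rewrite -mulNr.
  by apply: has_laplaceZ; exact: has_laplace_gegenbauer l0 nlam_nt o2.
Qed.

Let nt3E : 3 * nt%:R + 1 = (nt * 3).+1%:R :> R.
Proof. by rewrite -[RHS]natr1 natrM mulrC. Qed.

Let cv3 : cpow v (- (n%:R * lam + 3 * nt%:R + 1)) = V * (b ^+ 3 * v)^-1.
Proof. by rewrite -addrA cnv nt3E cpowNn exprSr exprM. Qed.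

Let cv4 : cpow v (- (n%:R * lam + nt%:R + 1)) = V * (b * v)^-1.
Proof. by rewrite -addrA cnv natr1 cpowNn exprSr. Qed.

Let zz3 : (z `^ (n%:R * lam + 3 * nt%:R + 1))%:C =
  (z `^ (n%:R * lam))%:C * (a ^+ 3 * z%:C) :> R[i].
Proof.
by rewrite -addrA znv nt3E powR_mulrn ?(ltW z0) // rmorphXn exprSr exprM.
Qed.

Let zz4 : (z `^ (n%:R * lam + nt%:R + 1))%:C = (z `^ (n%:R * lam))%:C * (a * z%:C) :> R[i].
Proof. by rewrite -addrA znv natr1 powR_mulrn ?(ltW z0) // rmorphXn exprSr. Qed.

(** The sums already have parameter lam + 1, so g appears directly; their orders differ by 2 nt, and
    (z / v)^(2 nt) = (r - s)^nt / (s + r)^nt. *)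
Let biv_target :
  'i%C / r * (((-1) ^+ nt * (r - s) ^+ nt - (s + r) ^+ nt) / den_pow n z w (lam + 1) s) =
  - ((z `^ (n%:R * lam))%:C * (a * z%:C))^-1 *
   ((e * - 'i%C) * ((z `^ (n%:R * lam))%:C * (a ^+ 3 * z%:C) * (V * (b ^+ 3 * v)^-1) / r * g) +
    'i%C * ((z `^ (n%:R * lam))%:C * (a * z%:C) * (V * (b * v)^-1) / r * g)).
Proof.
have h1 : (r - s) ^+ nt = a ^+ 2 / b by rewrite rs_v expr_div_n exprAC.
rewrite DE h1; change ((s + r) ^+ nt) with b; change ((-1) ^+ nt) with e.
move: (z `^ _)%:C Z0 => Z Z0'; move: a b e z%:C v V g r na nb nz nv nV ng nr.
by move=> a' b' e' z' v' V' g' r' *; field; do ?[apply/andP; split].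
Qed.

Lemma has_laplace_biv :
  has_laplace (fun t => - (z `^ (- (n%:R * lam + nt%:R + 1)))%:C * series_C lam z w n nt t) s
  ('i%C / r * (((-1) ^+ nt * (r - s) ^+ nt - (s + r) ^+ nt) / den_pow n z w (lam + 1) s)).
Proof.
have l0 : 0 < lam + 1 by rewrite addr_gt0 // lam0.
have nlam : 0 < n%:R * lam by rewrite mulr_gt0 ?lam0 // ltr0n.
have p1 : 0 < n%:R * lam + 3 * nt%:R + 1 by rewrite addr_gt0 // ltr_wpDr ?mulr_ge0.
have p2 : 0 < n%:R * lam + nt%:R + 1 by rewrite addr_gt0 // ltr_wpDr.
have o1 k : n%:R * k%:R + n%:R * lam + 3 * nt%:R + 1 =
    n%:R * k%:R + (n%:R * lam + 3 * nt%:R + 1) by rewrite !addrA.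
have o2 k : n%:R * k%:R + n%:R * lam + nt%:R + 1 =
    n%:R * k%:R + (n%:R * lam + nt%:R + 1) by rewrite !addrA.
have zE : (z `^ (- (n%:R * lam + nt%:R + 1)))%:C = ((z `^ (n%:R * lam))%:C * (a * z%:C))^-1 :> R[i].
  by rewrite powRN fmorphV /= zz4.
have iE : (- 'i%C) ^+ n = e * - 'i%C :> R[i] by rewrite sgn_exp // sqrrN sqr_i.
rewrite biv_target -cv3 -cv4 -zz3 -zE -zz4 -iE.
apply: has_laplaceZ; apply: has_laplaceD; apply: has_laplaceZ.
- exact: has_laplace_gegenbauer l0 p1 o1.
- exact: has_laplace_gegenbauer l0 p2 o2.
Qed.

End KernelLaplace.

(** * The Clifford-valued kernel and the conclusion *)

Lemma enorm_gt0 (R : rcfType) (m : nat) (x : 'rV[R]_m) : x != 0 -> 0 < enorm x.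
Proof.
move=> x0; have sq i : 0 <= x 0 i * x 0 i by rewrite -expr2 sqr_ge0.
rewrite /enorm sqrtr_gt0 lt_neqAle sumr_ge0 // andbT eq_sym.
apply: contra x0 => /eqP E; apply/eqP/rowP => i; rewrite mxE.
have := @psumr_eq0P _ _ xpredT (fun i => x 0 i * x 0 i) (fun i _ => sq i) E i isT.
by move=> /eqP; rewrite mulf_eq0 orbb => /eqP.
Qed.

Section KernelCoordinates.
Variables (R : realType) (m n nt : nat) (c : R) (x y : 'rV[R]_m).

Lemma rdft_kernelE t (B : {set 'I_m}) : rdft_kernel n nt c x y t B =
  (1 : clifford R[i] m) B * rdft_scal n nt c x y t + cl_wedge x y B * rdft_biv n nt c x y t.
Proof.
by rewrite /rdft_kernel -scalerAr mulr1 !ffunE; congr (_ + _); rewrite mulrC.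
Qed.

(** Each coordinate of the kernel is a combination of the two parts with coefficients independent of
    t. *)
Lemma cl_laplace_kernel s : laplace_exists (rdft_scal n nt c x y) s ->
  laplace_exists (rdft_biv n nt c x y) s ->
  cl_laplace_exists (rdft_kernel n nt c x y) s /\
  cl_laplace (rdft_kernel n nt c x y) s =
    (laplace (rdft_scal n nt c x y) s)%:A + cl_wedge x y * (laplace (rdft_biv n nt c x y) s)%:A.
Proof.
move=> ha hb; set a := laplace _ s; set b := laplace _ s.
have h B : has_laplace (fun t => rdft_kernel n nt c x y t B) s
    ((1 : clifford R[i] m) B * a + cl_wedge x y B * b).
  apply: eq_has_laplace (has_laplaceD (has_laplaceZ _ (conj ha erefl))
    (has_laplaceZ _ (conj hb erefl))) => t _.
  by rewrite rdft_kernelE.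
split=> [B|]; first by have [] := h B.
apply/ffunP => B; rewrite ffunE (h B).2 -scalerAr mulr1 !ffunE.
by congr (_ + _); rewrite mulrC.
Qed.

End KernelCoordinates.

Theorem theorem3p7 (R : realType) (m n nt : nat) (c : R) (x y : 'rV[R]_m)
  (hm : (2 < m)%N) (hnt : (1 <= nt)%N) (hn : n = (2 * nt + 1)%N)
  (hc : 1 + c = 1 / n%:R) (hx : x != 0) (hy : y != 0) :
  let lam : R := (m%:R - 2) / 2 in
  let z : R := enorm x * enorm y in
  let w : R := edot x y / z in
  exists2 sigma : R, 0 < sigma & forall s : R[i], sigma < complex.Re s ->
    let r : R[i] := cradius z s in
    let D : R[i] := den_pow n z w (lam + 1) s in
    (laplace_exists (rdft_scal n nt c x y) s
     /\ laplace_exists (rdft_biv n nt c x y) s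
     /\ cl_laplace_exists (rdft_kernel n nt c x y) s)
    /\ cl_laplace (rdft_kernel n nt c x y) s
        = (laplace (rdft_scal n nt c x y) s)%:A
          + cl_wedge x y * (laplace (rdft_biv n nt c x y) s)%:A
    /\ laplace (rdft_scal n nt c x y) s
        = 1 / r * (((s + r) ^+ (nt + 1) + (-1) ^+ nt * (r - s) ^+ (nt + 1)) / D)
          + 'i%C * w%:C * z%:C / r
            * (((-1) ^+ nt * (r - s) ^+ nt - (s + r) ^+ nt) / D)
    /\ laplace (rdft_biv n nt c x y) s
        = 'i%C / r * (((-1) ^+ nt * (r - s) ^+ nt - (s + r) ^+ nt) / D).
Proof.
move=> lam z w.
have z0 : 0 < z by rewrite mulr_gt0 ?enorm_gt0.
(* With A = 1 + 2 |w| this gives z A / kappa = 1 / 16, hence z / kappa <= 1 / 8 for the Bessel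
   series, 8 A z / kappa <= 1 / 2 for the sums over k, and |u| A <= 1 / 16 for the generating
   functions. *)
pose kappa := z * (16 * (1 + 2 * `|w|)).
have A0 : 0 < 16 * (1 + 2 * `|w|) by rewrite mulr_gt0 // ltr_pwDl // mulr_ge0.
have k0 : 0 < kappa by rewrite mulr_gt0.
have zk : z / kappa * (16 * (1 + 2 * `|w|)) <= 1.
  by rewrite mulrAC -/kappa divff ?gt_eqF.
have lam_ge : 2^-1 <= lam.
  have : (3%:R : R) <= m%:R by rewrite ler_nat.
  by rewrite /lam => m3; lra.
exists kappa => // s ks r D.
have cn : (m%:R - 1) / (1 + c) = n%:R * (m%:R - 1) :> R by rewrite hc mul1r invrK mulrC.
have nE : n%:R = 2 * nt%:R + 1 :> R by rewrite hn natrD natrM.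
have mE : m%:R = 2 * lam + 2 :> R by rewrite /lam; field.
(* Here mu = 1 + n (2 lam + 1) = 2 (n lam + nt + 1), so the prefactors cancel the power of z of one
   Bessel sum in each part. *)
have e1 : - ((1 + (m%:R - 1) / (1 + c) - 2) / 2) = - (n%:R * lam + nt%:R) :> R.
  by rewrite cn mE nE; field.
have e2 : - ((1 + (m%:R - 1) / (1 + c)) / 2) = - (n%:R * lam + nt%:R + 1) :> R.
  by rewrite cn mE nE; field.
have hs := has_laplace_scal nt z0 k0 lam_ge zk ks.
have hb := has_laplace_biv nt z0 k0 lam_ge zk ks.
rewrite -hn -e1 in hs; rewrite -hn -e2 in hb.
have [es Es] := hs; have [eb Eb] := hb.
have [ck ckE] := cl_laplace_kernel es eb.
split; first by split; [exact: es | split; [exact: eb | exact: ck]].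
split; first exact: ckE.
by split; [exact: Es | exact: Eb].
Qed.
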